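(* Let $N\ge3$, let $\mathcal{A}=\mathcal{U}_\xi(\mathbf{B}^\vee)$ be the twisted Hopf algebra over $\mathbb{C}[[\xi]]$ described in the context, with generators $x_\alpha,\pi_\alpha$ ($1\le\alpha\le N-1$), and let $x^\alpha,\pi^\alpha\in\mathcal{A}^*$ be the elements of the canonical dual basis corresponding to the generators $x_\alpha,\pi_\alpha$. Then the canonical element $\mathcal{T}=\sum_{\vec k}z^{\vec k}\otimes z_{\vec k}\in\mathcal{A}^*\hat\otimes\mathcal{A}$ is $$\mathcal{T}=\sum_{\vec m,\vec n}\frac{1}{\vec m!\,\vec n!}(\pi^1)^{n_1}\cdots(\pi^{N-1})^{n_{N-1}}(x^1)^{m_1}\cdots(x^{N-1})^{m_{N-1}}\otimes x_1^{m_1}\cdots x_{N-1}^{m_{N-1}}\pi_1^{n_1}\cdots\pi_{N-1}^{n_{N-1}},$$ and it can be written as the ordered product $$\mathcal{T}=\prod_{\alpha=1,\dots,N-1}^{<}\exp\left(-x^\alpha\otimes S(x_\alpha)\right)\prod_{\alpha=1,\dots,N-1}^{>}\exp\left(-\pi^\alpha\otimes S(\pi_\alpha)\right),$$ where $S$ is the antipode of $\mathcal{A}$.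
   Context: $\mathbf{B}^{\vee}\subset sl(N)$ is the complex Lie subalgebra with basis $H_{1N}=E_{11}-E_{NN}$, $E_{1N}$, $E_{1j}$, $E_{jN}$ ($2\le j\le N-1$), $E_{ij}$ being matrix units. $\xi$ is a formal parameter, $\sigma=\frac12\ln(1+2\xi E_{1N})$, and $$\mathcal{F}=\exp(H_{1N}\otimes\sigma)\prod_{j=2}^{N-1}\exp(2\xi E_{1j}\otimes E_{jN}e^{-2\sigma}).$$ $\mathcal{A}=\mathcal{U}_\xi(\mathbf{B}^\vee)$ is $\mathcal{U}(\mathbf{B}^{\vee})[[\xi]]$ with its usual multiplication and counit and coproduct $\Delta_{\mathcal{F}}(a)=\mathcal{F}\Delta(a)\mathcal{F}^{-1}$, where $\Delta$ is the standard cocommutative coproduct (tensor products are $\xi$-adically completed); this is a Hopf algebra. Generators of $\mathcal{A}$: $x_1=H_{1N}$, $x_i=2E_{1i}$, $\pi_1=\frac1\xi\sigma$, $\pi_i=E_{iN}e^{-2\sigma}$ ($2\le i\le N-1$). For $\vec k=(\vec m,\vec n)$, $\vec m,\vec n\in\mathbb{Z}_{\ge0}^{N-1}$, the ordered monomials $z_{\vec k}=x_1^{m_1}\cdots x_{N-1}^{m_{N-1}}\pi_1^{n_1}\cdots\pi_{N-1}^{n_{N-1}}$ form a topological $\mathbb{C}[[\xi]]$-basis of $\mathcal{A}$. $\mathcal{A}^*=\mathrm{Hom}_{\mathbb{C}[[\xi]]}(\mathcal{A},\mathbb{C}[[\xi]])$ has the product $(fg)(a)=(f\otimes g)(\Delta_{\mathcal{F}}(a))$,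 and $\{z^{\vec k}\}$ is the dual basis, $\langle z^{\vec k},z_{\vec l}\rangle=\delta^{\vec k}_{\vec l}$. The completed tensor product $\mathcal{A}^*\hat\otimes\mathcal{A}$ is identified with $\mathrm{End}_{\mathbb{C}[[\xi]]}(\mathcal{A})$ via $f\otimes a\mapsto(b\mapsto f(b)a)$, with convolution as its product and the topology of pointwise ($\xi$-adic) convergence, in which all series are understood. Notation: $\vec n!=n_1!\cdots n_{N-1}!$; $\prod^{<}_{\alpha}$ (resp. $\prod^{>}_{\alpha}$) is the product in which the factors are written from left to right in order of increasing (resp. decreasing) index $\alpha$. *)

(* Defs.v *)
From HB Require Import structures.
From mathcomp Require Import all_boot all_order all_algebra.
From mathcomp Require Import generic_quotient boolp reals complex.

Set Implicit Arguments.
Unset Strict Implicit.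
Unset Printing Implicit Defensive.

Import GRing.Theory.
Local Open Scope ring_scope.
Local Open Scope quotient_scope.

(* [fps V] is V[[xi]]; the series \sum_n a_n xi^n is stored as n |-> a_n.     *)
Record fps (V : Type) := Fps { coef :> nat -> V }.

HB.instance Definition _ V := gen_eqMixin (fps V).
HB.instance Definition _ V := gen_choiceMixin (fps V).

Lemma fpsP V (a b : fps V) : a =1 b -> a = b.
Proof. by case: a b => a [b] /= /funext ->. Qed.

Lemma triangular_sum3 (V : nmodType) (F : nat -> nat -> nat -> V) n :
  \sum_(i < n.+1) \sum_(j < i.+1) F j (i - j)%N (n - i)%N =
  \sum_(i < n.+1) \sum_(j < (n - i).+1) F i j (n - i - j)%N.
Proof.
under eq_bigr => i _ do
  rewrite (big_ord_widen _ (fun j => F j (i - j)%N (n - i)%N) (ltn_ord i)).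
rewrite (exchange_big_dep xpredT) //=; apply: eq_bigr => i _.
under eq_bigl => j do rewrite ltnS.
rewrite -(big_geq_mkord _ _ xpredT (fun j => F i (j - i)%N (n - j)%N)).
rewrite -{1}[val i]add0n big_addn subSn; last by rewrite -ltnS ltn_ord.
rewrite big_mkord.
by apply: eq_bigr => j _; rewrite addnK subnDA subnAC.
Qed.

Section FpsZmodule.
Variable V : zmodType.
Implicit Types a b c : fps V.

Definition fps0 : fps V := Fps (fun=> 0).
Definition fps_add a b := Fps (fun n => a n + b n).
Definition fps_opp a := Fps (fun n => - a n).

Fact fps_addA : associative fps_add.
Proof. by move=> a b c; apply: fpsP => n /=; rewrite addrA. Qed.
Fact fps_addC : commutative fps_add.
Proof. by move=> a b; apply: fpsP => n /=; rewrite addrC. Qed.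
Fact fps_add0 : left_id fps0 fps_add.
Proof. by move=> a; apply: fpsP => n /=; rewrite add0r. Qed.
Fact fps_addN : left_inverse fps0 fps_opp fps_add.
Proof. by move=> a; apply: fpsP => n /=; rewrite addNr. Qed.
HB.instance Definition _ :=
  GRing.isZmodule.Build (fps V) fps_addA fps_addC fps_add0 fps_addN.

Definition fpsC (v : V) : fps V := Fps (fun n => if n == 0%N then v else 0).
Definition fpsX (a : fps V) : fps V := Fps (fun n => if n is m.+1 then a m else 0).
(* The quotient of a - a_0 by xi. *)
Definition fps_divX (a : fps V) : fps V := Fps (fun n => a n.+1).

End FpsZmodule.

Section FpsRing.
Variable A : pzRingType.
Implicit Types a b c : fps A.

Definition fps1 : fps A := fpsC 1.
Definition fps_mul a b := Fps (fun n => \sum_(i < n.+1) a i * b (n - i)%N).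

Fact fps_mulA : associative fps_mul.
Proof.
move=> a b c; apply: fpsP => n /=; symmetry.
under eq_bigr do rewrite mulr_suml.
rewrite (triangular_sum3 (fun i j k => a i * b j * c k)).
by apply: eq_bigr => i _; rewrite mulr_sumr; apply: eq_bigr => j _; rewrite mulrA.
Qed.
Fact fps_mul1r : left_id fps1 fps_mul.
Proof.
move=> a; apply: fpsP => n /=; rewrite big_ord_recl /= mul1r subn0.
by rewrite big1 ?addr0 // => i _; rewrite mul0r.
Qed.
Fact fps_mulr1 : right_id fps1 fps_mul.
Proof.
move=> a; apply: fpsP => n /=; rewrite big_ord_recr /= subnn mulr1.
by rewrite big1 ?add0r // => i _; rewrite subn_eq0 leqNgt ltn_ord mulr0.
Qed.
Fact fps_mulDl : left_distributive fps_mul (@fps_add A).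
Proof.
move=> a b c; apply: fpsP => n /=; rewrite -big_split /=.
by apply: eq_bigr => i _; rewrite mulrDl.
Qed.
Fact fps_mulDr : right_distributive fps_mul (@fps_add A).
Proof.
move=> a b c; apply: fpsP => n /=; rewrite -big_split /=.
by apply: eq_bigr => i _; rewrite mulrDr.
Qed.
HB.instance Definition _ := GRing.Zmodule_isPzRing.Build (fps A)
  fps_mulA fps_mul1r fps_mulr1 fps_mulDl fps_mulDr.

End FpsRing.

Fact fps_oner_neq0 (A : nzRingType) : (1 : fps A) != 0.
Proof.
apply/eqP => /(congr1 (fun a : fps A => a 0%N)) /= e.
by have := oner_neq0 A; rewrite e eqxx.
Qed.
HB.instance Definition _ (A : nzRingType) :=
  GRing.PzSemiRing_isNonZero.Build (fps A) (@fps_oner_neq0 A).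

Fact fps_mulC (A : comPzRingType) : commutative (@fps_mul A).
Proof.
move=> a b; apply: fpsP => n /=; rewrite (reindex_inj rev_ord_inj) /=.
by apply: eq_bigr => i _; rewrite subSS mulrC subKn // -ltnS.
Qed.
HB.instance Definition _ (A : comPzRingType) :=
  GRing.PzRing_hasCommutativeMul.Build (fps A) (@fps_mulC A).

Section FpsLmodule.
Variables (K : pzRingType) (V : lmodType K).

Definition fps_scale (c : fps K) (a : fps V) : fps V :=
  Fps (fun n => \sum_(i < n.+1) c i *: a (n - i)%N).

Fact fps_scaleA c d a : fps_scale c (fps_scale d a) = fps_scale (c * d) a.
Proof.
apply: fpsP => n /=; symmetry.
under eq_bigr do rewrite scaler_suml.
rewrite (triangular_sum3 (fun i j k => (c i * d j) *: a k)).
by apply: eq_bigr => i _; rewrite scaler_sumr; apply: eq_bigr => j _; rewrite scalerA.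
Qed.
Fact fps_scale1 : left_id 1 fps_scale.
Proof.
move=> a; apply: fpsP => n /=; rewrite big_ord_recl /= scale1r subn0.
by rewrite big1 ?addr0 // => i _; rewrite scale0r.
Qed.
Fact fps_scaleDr : right_distributive fps_scale +%R.
Proof.
move=> c a b; apply: fpsP => n /=; rewrite -big_split /=.
by apply: eq_bigr => i _; rewrite scalerDr.
Qed.
Fact fps_scaleDl a : {morph fps_scale^~ a : c d / c + d}.
Proof.
move=> c d; apply: fpsP => n /=; rewrite -big_split /=.
by apply: eq_bigr => i _; rewrite scalerDl.
Qed.
HB.instance Definition _ := GRing.Zmodule_isLmodule.Build (fps K) (fps V)
  fps_scaleA fps_scale1 fps_scaleDr fps_scaleDl.

End FpsLmodule.

Fact fps_scaleAl (K : pzRingType) (A : lalgType K) (c : fps K) (a b : fps A) :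
  c *: (a * b) = c *: a * b.
Proof.
apply: fpsP => n /=; symmetry.
under eq_bigr do rewrite mulr_suml.
rewrite (triangular_sum3 (fun i j k => c i *: a j * b k)).
apply: eq_bigr => i _; rewrite scaler_sumr.
by apply: eq_bigr => j _; rewrite scalerAl.
Qed.
HB.instance Definition _ (K : pzRingType) (A : lalgType K) :=
  GRing.Lmodule_isLalgebra.Build (fps K) (fps A) (@fps_scaleAl K A).

Fact fps_scaleAr (K : comPzRingType) (A : algType K) (c : fps K) (a b : fps A) :
  c *: (a * b) = a * (c *: b).
Proof.
apply: fpsP => n /=.
under eq_bigr do rewrite scaler_sumr.
under [RHS]eq_bigr do rewrite mulr_sumr.
rewrite -(triangular_sum3 (fun i j k => c i *: (a j * b k))).
rewrite -(triangular_sum3 (fun i j k => a i * (c j *: b k))).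
apply: eq_bigr => i _; rewrite (reindex_inj rev_ord_inj) /=.
by apply: eq_bigr => j _; rewrite subSS subKn -1?ltnS// scalerAr.
Qed.
HB.instance Definition _ (K : comPzRingType) (A : algType K) :=
  GRing.Lalgebra_isAlgebra.Build (fps K) (fps A) (@fps_scaleAr K A).

Definition fps_map (V W : Type) (f : V -> W) (a : fps V) : fps W :=
  Fps (fun n => f (a n)).

(* The series exp a and ln (1 + a) for a with zero constant term, and 1 / a   *)
(* for a with constant term 1: under these conditions a ^+ k (resp.           *)
(* (1 - a) ^+ k) is divisible by xi^k, so that only the terms of index        *)
(* k <= n contribute to the coefficient of xi^n.                              *)
Section FpsFunctions.
Variables (K : fieldType) (A : algType K).
Implicit Types a : fps A.

Definition fps_exp a : fps A :=
  Fps (fun n => \sum_(k < n.+1) (k`!%:R : K)^-1 *: (a ^+ k) n).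

Definition fps_ln1p a : fps A :=
  Fps (fun n => \sum_(1 <= k < n.+1) ((-1) ^+ k.-1 / k%:R : K) *: (a ^+ k) n).

Definition fps_inv a : fps A :=
  Fps (fun n => \sum_(k < n.+1) ((1 - a) ^+ k) n).

End FpsFunctions.

Definition lie_map (K : fieldType) (L : lmodType K) (br : L -> L -> L)
    (A : algType K) (f : L -> A) : Prop :=
  linear f /\ forall x y, f (br x y) = f x * f y - f y * f x.

(* U(L) is the set of noncommutative polynomials in the elements of L, an     *)
(* element of [uterm L] standing for the sum of its scaled words, modulo the  *)
(* identities that hold under every Lie map from L to an associative unital   *)
(* algebra; it is characterized by [uliftP] and [ulift_unique] below.         *)
Section Enveloping.
Variables (K : fieldType) (L : lmodType K) (br : L -> L -> L).

Definition uterm : Type := seq (K * seq L).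
HB.instance Definition _ := Choice.on uterm.

Definition ueval (A : algType K) (f : L -> A) (s : uterm) : A :=
  \sum_(t <- s) t.1 *: \prod_(x <- t.2) f x.

Definition ueq (s t : uterm) : bool :=
  `[< forall (A : algType K) (f : L -> A), lie_map br f ->
        ueval f s = ueval f t >].

Fact ueq_refl : reflexive ueq.
Proof. by move=> s; apply/asboolP. Qed.
Fact ueq_sym : symmetric ueq.
Proof.
by move=> s t; apply/asboolP/asboolP => e A f /e.
Qed.
Fact ueq_trans : transitive ueq.
Proof.
move=> s t u /asboolP e /asboolP e'; apply/asboolP => A f fL.
by rewrite e // e'.
Qed.
Canonical ueq_equiv := EquivRel ueq ueq_refl ueq_sym ueq_trans.

Definition Uenv : Type := {eq_quot ueq_equiv}.
HB.instance Definition _ := Choice.on Uenv.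

Definition uclass (s : uterm) : Uenv := \pi_{eq_quot ueq_equiv} s.
Definition urepr (u : Uenv) : uterm := repr (u : {eq_quot ueq_equiv}).

(* The algebra morphism extending f, when f is a Lie map.                     *)
Definition ulift (A : algType K) (f : L -> A) (u : Uenv) : A :=
  ueval f (urepr u).

Lemma ulift_class (A : algType K) (f : L -> A) s :
  lie_map br f -> ulift f (uclass s) = ueval f s.
Proof.
move=> fL; have /eqmodP/asboolP : urepr (uclass s) = s %[mod {eq_quot ueq_equiv}].
  by rewrite /urepr reprK.
exact.
Qed.

Lemma uenvP (u v : Uenv) :
  (forall (A : algType K) (f : L -> A), lie_map br f -> ulift f u = ulift f v) ->
  u = v.
Proof.
move=> e; rewrite -[u](@reprK _ {eq_quot ueq_equiv}).
by rewrite -[v](@reprK _ {eq_quot ueq_equiv}); apply/eqmodP/asboolP.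
Qed.

Definition uscale_term (c : K) (s : uterm) : uterm := [seq (c * t.1, t.2) | t <- s].
Definition umul_term (s t : uterm) : uterm :=
  [seq (a.1 * b.1, a.2 ++ b.2) | a <- s, b <- t].

Definition uzero : Uenv := uclass [::].
Definition uadd u v := uclass (urepr u ++ urepr v).
Definition uscale c u := uclass (uscale_term c (urepr u)).
Definition uopp u := uscale (-1) u.
Definition uone : Uenv := uclass [:: (1, [::])].
Definition umul u v := uclass (umul_term (urepr u) (urepr v)).
Definition uin (x : L) : Uenv := uclass [:: (1, [:: x])].

Section Lift.
Variables (A : algType K) (f : L -> A) (fL : lie_map br f).

Fact ulift0 : ulift f uzero = 0.
Proof. by rewrite ulift_class // /ueval big_nil. Qed.
Fact uliftD u v : ulift f (uadd u v) = ulift f u + ulift f v.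
Proof. by rewrite ulift_class // /ueval big_cat. Qed.
Fact uliftZ c u : ulift f (uscale c u) = c *: ulift f u.
Proof.
rewrite ulift_class // /ueval big_map scaler_sumr.
by apply: eq_bigr => t _; rewrite scalerA.
Qed.
Fact uliftN u : ulift f (uopp u) = - ulift f u.
Proof. by rewrite uliftZ scaleN1r. Qed.
Fact ulift1 : ulift f uone = 1.
Proof. by rewrite ulift_class // /ueval big_seq1 big_nil scale1r. Qed.
Fact uliftM u v : ulift f (umul u v) = ulift f u * ulift f v.
Proof.
rewrite ulift_class // /ueval big_allpairs_dep /= mulr_suml.
apply: eq_bigr => s _; rewrite mulr_sumr; apply: eq_bigr => t _.
by rewrite big_cat /= -scalerAl -scalerAr scalerA.
Qed.
Fact ulift_in x : ulift f (uin x) = f x.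
Proof. by rewrite ulift_class // /ueval !big_seq1 scale1r. Qed.

End Lift.

Let uliftE := (ulift0, uliftD, uliftZ, uliftN, ulift1, uliftM).

Fact uaddA : associative uadd.
Proof. by move=> u v w; apply: uenvP => A f fL; rewrite !uliftE // addrA. Qed.
Fact uaddC : commutative uadd.
Proof. by move=> u v; apply: uenvP => A f fL; rewrite !uliftE // addrC. Qed.
Fact uadd0 : left_id uzero uadd.
Proof. by move=> u; apply: uenvP => A f fL; rewrite !uliftE // add0r. Qed.
Fact uaddN : left_inverse uzero uopp uadd.
Proof. by move=> u; apply: uenvP => A f fL; rewrite !uliftE // addNr. Qed.
HB.instance Definition _ := GRing.isZmodule.Build Uenv uaddA uaddC uadd0 uaddN.

Fact umulA : associative umul.
Proof. by move=> u v w; apply: uenvP => A f fL; rewrite !uliftE // mulrA. Qed.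
Fact umul1r : left_id uone umul.
Proof. by move=> u; apply: uenvP => A f fL; rewrite !uliftE // mul1r. Qed.
Fact umulr1 : right_id uone umul.
Proof. by move=> u; apply: uenvP => A f fL; rewrite !uliftE // mulr1. Qed.
Fact umulDl : left_distributive umul uadd.
Proof. by move=> u v w; apply: uenvP => A f fL; rewrite !uliftE // mulrDl. Qed.
Fact umulDr : right_distributive umul uadd.
Proof. by move=> u v w; apply: uenvP => A f fL; rewrite !uliftE // mulrDr. Qed.
Fact lie_map0 : lie_map br (fun=> 0 : K^o).
Proof. by split=> [c x y|x y]; rewrite ?scaler0 ?addr0 // mulr0 subrr. Qed.
Fact uone_neq0 : uone != uzero.
Proof.
apply/eqP => /(congr1 (ulift (fun=> 0 : K^o))).
by rewrite ulift1 ?ulift0; [apply/eqP/oner_neq0 | apply: lie_map0..].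
Qed.
HB.instance Definition _ := GRing.Zmodule_isNzRing.Build Uenv
  umulA umul1r umulr1 umulDl umulDr uone_neq0.

Fact uscaleA c d u : uscale c (uscale d u) = uscale (c * d) u.
Proof. by apply: uenvP => A f fL; rewrite !uliftE // scalerA. Qed.
Fact uscale1 : left_id 1 uscale.
Proof. by move=> u; apply: uenvP => A f fL; rewrite !uliftE // scale1r. Qed.
Fact uscaleDr : right_distributive uscale +%R.
Proof. by move=> c u v; apply: uenvP => A f fL; rewrite !uliftE // scalerDr. Qed.
Fact uscaleDl u : {morph uscale^~ u : c d / c + d}.
Proof. by move=> c d; apply: uenvP => A f fL; rewrite !uliftE // scalerDl. Qed.
HB.instance Definition _ := GRing.Zmodule_isLmodule.Build K Uenv
  uscaleA uscale1 uscaleDr uscaleDl.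

Fact uscaleAl c (u v : Uenv) : c *: (u * v) = c *: u * v.
Proof. by apply: uenvP => A f fL; rewrite !uliftE // scalerAl. Qed.
HB.instance Definition _ := GRing.Lmodule_isLalgebra.Build K Uenv uscaleAl.
Fact uscaleAr c (u v : Uenv) : c *: (u * v) = u * (c *: v).
Proof. by apply: uenvP => A f fL; rewrite !uliftE // scalerAr. Qed.
HB.instance Definition _ := GRing.Lalgebra_isAlgebra.Build K Uenv uscaleAr.

Lemma uin_lie_map : lie_map br uin.
Proof.
split=> [c x y|x y]; apply: uenvP => A f fL; rewrite !uliftE // !ulift_in //.
  by rewrite fL.1.
by rewrite fL.2 scaleN1r.
Qed.

Lemma uliftP (A : algType K) (f : L -> A) : lie_map br f ->
  [/\ linear (ulift f), {morph ulift f : u v / u * v}, ulift f 1 = 1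
    & forall x, ulift f (uin x) = f x].
Proof.
move=> fL; split=> [c u v|u v||x]; rewrite ?uliftE ?ulift_in //.
Qed.

Fact alg_map_ueval (A B : algType K) (f : L -> A) (g : A -> B) s :
    linear g -> {morph g : u v / u * v} -> g 1 = 1 ->
  g (ueval f s) = ueval (g \o f) s.
Proof.
move=> glin gM g1.
have g0 : g 0 = 0 by have := glin (-1) 0 0; rewrite scaler0 addr0 scaleN1r addNr.
rewrite /ueval; elim: s => [|t s IH]; first by rewrite !big_nil.
rewrite !big_cons glin IH; congr (_ *: _ + _).
by elim: t.2 => [|x r IHr] /=; rewrite ?big_nil // !big_cons gM IHr.
Qed.

Lemma ulift_unique (A : algType K) (f : L -> A) (g : {lrmorphism Uenv -> A}) :
  lie_map br f -> (forall x, g (uin x) = f x) -> g =1 ulift f.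
Proof.
move=> fL gf u; have -> : u = ueval uin (urepr u).
  apply: uenvP => B h hL; have [hlin hM h1 hin] := uliftP hL.
  rewrite (alg_map_ueval _ _ hlin) // {1}/ulift; congr (ueval _ _).
  by apply/funext => x /=; rewrite hin.
have [flin fM f1 fin] := uliftP fL.
rewrite (alg_map_ueval _ _ flin) // (alg_map_ueval _ _ (linearP g)).
- by congr (ueval _ _); apply/funext => x /=; rewrite fin gf.
- exact: rmorphM.
- exact: rmorph1.
Qed.

End Enveloping.

Definition bilinear_map (K : fieldType) (A B X : lmodType K) (f : A -> B -> X) :=
  (forall a, linear (f a)) /\ (forall b, linear (f^~ b)).

(* A (x) B is the set of formal sums of pairs (a, b) modulo the identities    *)
(* that hold under every bilinear map on A * B.                               *)
Section Tensor.
Variables (K : fieldType) (A B : algType K).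

Definition tterm : Type := seq (A * B).
HB.instance Definition _ := Choice.on tterm.

Definition teval (X : nmodType) (f : A -> B -> X) (s : tterm) : X :=
  \sum_(t <- s) f t.1 t.2.

Definition teq (s t : tterm) : bool :=
  `[< forall (X : lmodType K) (f : A -> B -> X), bilinear_map f ->
        teval f s = teval f t >].

Fact teq_refl : reflexive teq.
Proof. by move=> s; apply/asboolP. Qed.
Fact teq_sym : symmetric teq.
Proof. by move=> s t; apply/asboolP/asboolP => e X f /e. Qed.
Fact teq_trans : transitive teq.
Proof.
move=> s t u /asboolP e /asboolP e'; apply/asboolP => X f fL.
by rewrite e // e'.
Qed.
Canonical teq_equiv := EquivRel teq teq_refl teq_sym teq_trans.

Definition tens : Type := {eq_quot teq_equiv}.
HB.instance Definition _ := Choice.on tens.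

Definition tclass (s : tterm) : tens := \pi_{eq_quot teq_equiv} s.
Definition trepr (u : tens) : tterm := repr (u : {eq_quot teq_equiv}).

(* The linear map sending a (x) b to f a b, when f is bilinear.               *)
Definition tlift (X : nmodType) (f : A -> B -> X) (u : tens) : X :=
  teval f (trepr u).

Lemma tlift_class (X : lmodType K) (f : A -> B -> X) s :
  bilinear_map f -> tlift f (tclass s) = teval f s.
Proof.
move=> fL; have /eqmodP/asboolP : trepr (tclass s) = s %[mod {eq_quot teq_equiv}].
  by rewrite /trepr reprK.
exact.
Qed.

Lemma tensP (u v : tens) :
  (forall (X : lmodType K) (f : A -> B -> X), bilinear_map f ->
     tlift f u = tlift f v) -> u = v.
Proof.
move=> e; rewrite -[u](@reprK _ {eq_quot teq_equiv}).
by rewrite -[v](@reprK _ {eq_quot teq_equiv}); apply/eqmodP/asboolP.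
Qed.

Definition tpure (a : A) (b : B) : tens := tclass [:: (a, b)].
Definition tzero : tens := tclass [::].
Definition tadd u v := tclass (trepr u ++ trepr v).
Definition tscale (c : K) u := tclass [seq (c *: t.1, t.2) | t <- trepr u].
Definition topp u := tscale (-1) u.
Definition tone : tens := tpure 1 1.
Definition tmul u v :=
  tclass [seq (s.1 * t.1, s.2 * t.2) | s <- trepr u, t <- trepr v].

Section Lift.
Variables (X : lmodType K) (f : A -> B -> X) (fL : bilinear_map f).

Fact tlift_pure a b : tlift f (tpure a b) = f a b.
Proof. by rewrite tlift_class // /teval big_seq1. Qed.
Fact tlift0 : tlift f tzero = 0.
Proof. by rewrite tlift_class // /teval big_nil. Qed.
Fact tliftD u v : tlift f (tadd u v) = tlift f u + tlift f v.
Proof. by rewrite tlift_class // /teval big_cat. Qed.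
Fact tliftZ c u : tlift f (tscale c u) = c *: tlift f u.
Proof.
rewrite tlift_class // /teval big_map scaler_sumr.
apply: eq_bigr => t _ /=.
pose g : {linear A -> X} := HB.pack (f^~ t.2)
  (GRing.isLinear.Build _ _ _ _ (f^~ t.2) (fL.2 t.2)).
exact: (linearZ_LR g).
Qed.
Fact tliftN u : tlift f (topp u) = - tlift f u.
Proof. by rewrite tliftZ scaleN1r. Qed.

Definition tshiftl (c : A) (d : B) a b := f (c * a) (d * b).
Definition tshiftr (c : A) (d : B) a b := f (a * c) (b * d).
Fact tshiftl_bilinear c d : bilinear_map (tshiftl c d).
Proof.
split=> [a|b] k x y; rewrite /tshiftl mulrDr -scalerAr; first exact: fL.1.
exact: fL.2.
Qed.
Fact tshiftr_bilinear c d : bilinear_map (tshiftr c d).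
Proof.
split=> [a|b] k x y; rewrite /tshiftr mulrDl -scalerAl; first exact: fL.1.
exact: fL.2.
Qed.

End Lift.

Lemma tlift_mull (X : lmodType K) (f : A -> B -> X) u v : bilinear_map f ->
  tlift f (tmul u v) =
    \sum_(s <- trepr u) tlift (tshiftl f s.1 s.2) v.
Proof. by move=> fL; rewrite tlift_class // /teval big_allpairs_dep. Qed.

Lemma tlift_mulr (X : lmodType K) (f : A -> B -> X) u v : bilinear_map f ->
  tlift f (tmul u v) =
    \sum_(t <- trepr v) tlift (tshiftr f t.1 t.2) u.
Proof.
by move=> fL; rewrite tlift_class // /teval big_allpairs_dep exchange_big.
Qed.

Let tliftE := (tlift0, tliftD, tliftZ, tliftN).

Fact taddA : associative tadd.
Proof. by move=> u v w; apply: tensP => X f fL; rewrite !tliftE // addrA. Qed.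
Fact taddC : commutative tadd.
Proof. by move=> u v; apply: tensP => X f fL; rewrite !tliftE // addrC. Qed.
Fact tadd0 : left_id tzero tadd.
Proof. by move=> u; apply: tensP => X f fL; rewrite !tliftE // add0r. Qed.
Fact taddN : left_inverse tzero topp tadd.
Proof. by move=> u; apply: tensP => X f fL; rewrite !tliftE // addNr. Qed.
HB.instance Definition _ := GRing.isZmodule.Build tens taddA taddC tadd0 taddN.

Fact tmulA : associative tmul.
Proof.
move=> u v w; apply: tensP => X f fL; rewrite tlift_mull // tlift_mulr //.
under eq_bigr => s _ do rewrite (tlift_mulr _ _ (tshiftl_bilinear fL _ _)).
under [RHS]eq_bigr => s _ do rewrite (tlift_mull _ _ (tshiftr_bilinear fL _ _)).
rewrite exchange_big; apply: eq_bigr => s _; apply: eq_bigr => t _.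
by apply: eq_bigr => r _; rewrite /tshiftl /tshiftr !mulrA.
Qed.
Fact tmul1r : left_id tone tmul.
Proof.
move=> u; apply: tensP => X f fL; rewrite tlift_mulr //.
apply: eq_bigr => s _; rewrite tlift_pure; last exact: tshiftr_bilinear.
by rewrite /tshiftr !mul1r.
Qed.
Fact tmulr1 : right_id tone tmul.
Proof.
move=> u; apply: tensP => X f fL; rewrite tlift_mull //.
apply: eq_bigr => s _; rewrite tlift_pure; last exact: tshiftl_bilinear.
by rewrite /tshiftl !mulr1.
Qed.
Fact tmulDl : left_distributive tmul tadd.
Proof.
move=> u v w; apply: tensP => X f fL; rewrite tliftD // !tlift_mulr //.
rewrite -big_split; apply: eq_bigr => s _; rewrite tliftD //.
exact: tshiftr_bilinear.
Qed.
Fact tmulDr : right_distributive tmul tadd.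
Proof.
move=> u v w; apply: tensP => X f fL; rewrite tliftD // !tlift_mull //.
rewrite -big_split; apply: eq_bigr => s _; rewrite tliftD //.
exact: tshiftl_bilinear.
Qed.
HB.instance Definition _ := GRing.Zmodule_isPzRing.Build tens
  tmulA tmul1r tmulr1 tmulDl tmulDr.

Fact tscaleA c d u : tscale c (tscale d u) = tscale (c * d) u.
Proof. by apply: tensP => X f fL; rewrite !tliftE // scalerA. Qed.
Fact tscale1 : left_id 1 tscale.
Proof. by move=> u; apply: tensP => X f fL; rewrite !tliftE // scale1r. Qed.
Fact tscaleDr : right_distributive tscale +%R.
Proof. by move=> c u v; apply: tensP => X f fL; rewrite !tliftE // scalerDr. Qed.
Fact tscaleDl u : {morph tscale^~ u : c d / c + d}.
Proof. by move=> c d; apply: tensP => X f fL; rewrite !tliftE // scalerDl. Qed.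
HB.instance Definition _ := GRing.Zmodule_isLmodule.Build K tens
  tscaleA tscale1 tscaleDr tscaleDl.

Fact tscaleAl c (u v : tens) : c *: (u * v) = c *: u * v.
Proof.
apply: tensP => X f fL; rewrite tliftZ // !tlift_mulr // scaler_sumr.
by apply: eq_bigr => s _; rewrite tliftZ //; apply: tshiftr_bilinear.
Qed.
Fact tscaleAr c (u v : tens) : c *: (u * v) = u * (c *: v).
Proof.
apply: tensP => X f fL; rewrite tliftZ // !tlift_mull // scaler_sumr.
by apply: eq_bigr => s _; rewrite tliftZ //; apply: tshiftl_bilinear.
Qed.

Lemma tpure_bilinear : bilinear_map tpure.
Proof.
split=> [a|b] c x y; apply: tensP => X f fL; rewrite !tliftE // !tlift_pure //.
  exact: fL.1.
exact: fL.2.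
Qed.

Lemma tpureM a b c d : tpure a b * tpure c d = tpure (a * c) (b * d).
Proof.
apply: tensP => X f fL; rewrite tlift_mulr // [RHS]tlift_pure //.
transitivity (tlift (tshiftl f a b) (tpure c d)).
  by apply: eq_bigr => s _; rewrite tlift_pure //; apply: tshiftr_bilinear.
by rewrite tlift_pure //; apply: tshiftl_bilinear.
Qed.

Lemma tens_pureE (u : tens) : u = \sum_(t <- trepr u) tpure t.1 t.2.
Proof.
apply: tensP => X f fL.
have E s : tlift f (\sum_(t <- s) tpure t.1 t.2) = teval f s.
  rewrite /teval; elim: s => [|t s IH]; first by rewrite !big_nil tlift0.
  by rewrite !big_cons tliftD // IH tlift_pure.
by rewrite E.
Qed.

End Tensor.

Section EnvelopingBialgebra.
Variables (K : fieldType) (L : lmodType K) (br : L -> L -> L).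
Local Notation U := (Uenv br).

Definition ucounit : U -> K := ulift (fun=> 0 : K^o).

(* The counit is what shows that U (x) U is not the zero ring.                *)
Fact utens_oner_neq0 : (1 : tens U U) != 0.
Proof.
have [lin _ e1 _] := uliftP (lie_map0 br).
have bil : bilinear_map (fun u v : U => ucounit u * ucounit v : K^o).
  split=> [a|b] c x y; rewrite /ucounit lin.
    by rewrite mulrDr /GRing.scale /= mulrCA.
  by rewrite mulrDl /GRing.scale /= mulrA.
apply/eqP => /(congr1 (tlift (fun u v : U => ucounit u * ucounit v : K^o))).
rewrite tlift_pure // tlift0 // /ucounit !e1 mulr1; apply/eqP; exact: oner_neq0.
Qed.
HB.instance Definition _ :=
  GRing.PzSemiRing_isNonZero.Build (tens U U) utens_oner_neq0.
HB.instance Definition _ :=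
  GRing.Lmodule_isLalgebra.Build K (tens U U) (@tscaleAl K U U).
HB.instance Definition _ :=
  GRing.Lalgebra_isAlgebra.Build K (tens U U) (@tscaleAr K U U).

Definition ucoproduct : U -> tens U U :=
  ulift (fun x => tpure (uin br x) 1 + tpure 1 (uin br x)).

End EnvelopingBialgebra.

(* f (x) g in the completed tensor product (A (x) B)[[xi]] of A[[xi]] and     *)
(* B[[xi]] over K[[xi]].                                                      *)
Definition fps_tpure (K : fieldType) (A B : algType K) (a : fps A) (b : fps B) :
    fps (tens A B) :=
  Fps (fun n => \sum_(i < n.+1) tpure (a i) (b (n - i)%N)).

(* The K[[xi]]-linear xi-adically continuous map sending a (x) b to f a b,    *)
(* when f is K[[xi]]-bilinear.                                                *)
Definition fps_tlift (K : fieldType) (A B : algType K) (V : nmodType)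
    (f : fps A -> fps B -> fps V) (w : fps (tens A B)) : fps V :=
  Fps (fun n => \sum_(i < n.+1)
    tlift (fun a b => f (fpsC a) (fpsC b) (n - i)%N) (w i)).

Section Bvee.
Variables (K : fieldType) (N : nat).

(* Rows and columns of matrices, and the generators below, are numbered       *)
(* from 1.                                                                    *)
Definition Emx (i j : nat) : 'M[K]_N :=
  \matrix_(a < N, b < N) ((a.+1 == i) && (b.+1 == j))%:R.

Definition Hmx : 'M[K]_N := Emx 1 1 - Emx N N.

Definition Bvee_basis : seq 'M[K]_N :=
  Hmx :: Emx 1 N :: [seq Emx 1 j | j <- index_iota 2 N]
                 ++ [seq Emx j N | j <- index_iota 2 N].

Definition Bvee : {vspace 'M[K]_N} := <<Bvee_basis>>%VS.

(* By [Bvee_closed] below, vsproj only retypes the commutator.                *)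
Definition Bvee_br (x y : subvs_of Bvee) : subvs_of Bvee :=
  vsproj Bvee (vsval x *m vsval y - vsval y *m vsval x).

Lemma mul_Emx (i j k l : nat) : (0 < j <= N)%N ->
  Emx i j *m Emx k l = (j == k)%:R *: Emx i l.
Proof.
case/andP=> j0 jN; apply/matrixP => a b; rewrite !mxE.
have jN' : (j.-1 < N)%N by rewrite prednK.
rewrite (bigD1 (Ordinal jN')) //= big1 => [|c nc]; rewrite !mxE.
  rewrite /= prednK // eqxx addr0 andbT.
  by case: (_ == i); case: (j == k); case: (_ == l); rewrite ?mul0r ?mulr0 ?mul1r.
suff -> : (c.+1 == j) = false by rewrite andbF mul0r.
by apply: contraNF nc => /eqP e; apply/eqP/val_inj; rewrite /= -e.
Qed.

Lemma Bvee_closed x y : (1 < N)%N ->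
  x \in Bvee -> y \in Bvee -> x *m y - y *m x \in Bvee.
Proof.
move=> N1.
have N0 : (0 < N)%N by apply: ltnW.
have gens z : z \in Bvee_basis -> z \in Bvee by apply: memv_span.
have E1N : Emx 1 N \in Bvee by apply: gens; rewrite !inE eqxx orbT.
have E1j j : (1 < j < N)%N -> Emx 1 j \in Bvee.
  move=> jN; apply: gens; rewrite !inE mem_cat (map_f (Emx 1)) ?orbT //.
  by rewrite mem_index_iota.
have EjN j : (1 < j < N)%N -> Emx j N \in Bvee.
  move=> jN; apply: gens; rewrite !inE mem_cat (map_f (Emx^~ N)) ?orbT //.
  by rewrite mem_index_iota.
have comm_span z : (forall w, w \in Bvee_basis -> z *m w - w *m z \in Bvee) ->
    forall w, w \in Bvee -> z *m w - w *m z \in Bvee.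
  move=> H w /(@coord_span _ _ _ (in_tuple Bvee_basis)) ->.
  rewrite mulmx_sumr mulmx_suml -sumrB; apply: memv_suml => i _.
  rewrite -scalemxAl -scalemxAr -scalerBr; apply: memvZ; apply: H.
  exact: mem_nth.
move=> xB; apply: (comm_span x) => {}y yB.
rewrite -opprB memvN; apply: (comm_span y) xB => {}x xB.
have NN : (0 < N <= N)%N by rewrite N0 leqnn.
have N11 : (0 < 1 <= N)%N by [].
have N_1 : (N == 1%N) = false by rewrite gtn_eqF.
have mid j : (1 < j < N)%N -> [/\ (0 < j <= N)%N, (j == 1%N) = false,
    (1%N == j) = false, (j == N) = false & (N == j) = false].
  case/andP=> j1 jN; rewrite (ltnW j1) (ltnW jN) gtn_eqF // ltn_eqF //.
  by rewrite ltn_eqF // gtn_eqF.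
move: xB yB; rewrite /Bvee_basis /Hmx !inE !mem_cat.
have mem2N i : i \in index_iota 2 N -> (1 < i < N)%N by rewrite mem_index_iota.
move=> /or4P[/eqP->|/eqP->|/mapP[i /mem2N iN ->]|/mapP[i /mem2N iN ->]];
  try have [i0 i1 i1' iN1 iN1'] := mid _ iN;
move=> /or4P[/eqP->|/eqP->|/mapP[j /mem2N jN ->]|/mapP[j /mem2N jN ->]];
  try have [j0 j1 j1' jN1 jN1'] := mid _ jN;
rewrite ?(mulmxBl, mulmxBr) !mul_Emx // ?eqxx ?(eq_sym 1%N N).
all: repeat match goal with e : _ = false |- _ => rewrite ?e; clear e end.
all: rewrite ?(mulr0n, mulr1n, scale0r, scale1r, subr0, sub0r, opprK, subrr).
all: rewrite ?(addr0, add0r, oppr0, memvN, mem0v) //.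
all: first [exact: E1N | exact: E1j | exact: EjN | idtac].
all: by rewrite ?memvB ?memvD ?memvZ ?memvN.
Qed.
End Bvee.

Notation UB K N := (Uenv (@Bvee_br K N)).

Section Twisted.
Variables (K : fieldType) (N : nat).
Local Notation U := (UB K N).
Local Notation A := (fps U).
Local Notation E := (Emx K N).

(* The element of U(B^vee) given by a matrix belonging to B^vee. *)
Definition umx (M : 'M[K]_N) : U := uin (@Bvee_br K N) (vsproj (Bvee K N) M).

Definition sigma : A := fpsC (2%:R^-1) *: fps_ln1p (fpsX (fpsC (umx (E 1 N) *+ 2))).
Definition expN2sigma : A := fps_exp (- (sigma *+ 2)).

Definition xgen (i : nat) : A :=
  fpsC (if i == 1%N then umx (Hmx K N) else umx (E 1 i) *+ 2).
Definition pgen (i : nat) : A :=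
  if i == 1%N then fps_divX sigma else fpsC (umx (E i N)) * expN2sigma.

Definition twist : fps (tens U U) :=
  fps_exp (fps_tpure (fpsC (umx (Hmx K N))) sigma) *
  \prod_(2 <= j < N) fps_exp
    (fpsX (fps_tpure (fpsC (umx (E 1 j))) (fpsC (umx (E j N)) * expN2sigma) *+ 2)).

(* The ring operations of fps are those of U(B^vee)[[xi]] with its usual      *)
(* multiplication; the constant term of twist is 1.                           *)
Definition twisted_coproduct (a : A) : fps (tens U U) :=
  twist * fps_map (@ucoproduct _ _ (@Bvee_br K N)) a * fps_inv twist.

Definition counit (a : A) : fps K := fps_map (@ucounit _ _ (@Bvee_br K N)) a.

(* The convolution product of A^* for V := K, and of End(A) for V := U.       *)
Definition conv (V : pzRingType) (f g : A -> fps V) (a : A) : fps V :=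
  fps_tlift (fun b c => f b * g c) (twisted_coproduct a).
Definition conv_unit (a : A) : A := counit a *: 1.

Definition is_antipode (S : A -> A) : Prop :=
  conv S id =1 conv_unit /\ conv id S =1 conv_unit.

(* f (x) a as an element of End(A). *)
Definition rank1 (f : A -> fps K) (a : A) (b : A) : A := f b *: a.

(* Unordered summation in End(A), for the topology of pointwise xi-adic       *)
(* convergence.                                                               *)
Definition eqmod_xi (p : nat) (a b : A) : Prop := forall n, (n < p)%N -> a n = b n.
Definition has_sum (I : eqType) (F : I -> A -> A) (T : A -> A) : Prop :=
  forall (b : A) (p : nat), exists J : seq I, forall J' : seq I,
    uniq J' -> {subset J <= J'} -> eqmod_xi p (\sum_(i <- J') F i b) (T b).

Definition is_conv_exp (F G : A -> A) : Prop :=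
  has_sum (fun n b => fpsC (n`!%:R)^-1 *: iter n (conv F) conv_unit b) G.

(* The index i : 'I_N.-1 stands for i.+1 in {1, ..., N-1}. *)
Definition mindex : eqType := {ffun 'I_N.-1 -> nat}.
Definition mfact (n : mindex) : nat := \prod_i (n i)`!.
Definition mzero : mindex := [ffun=> 0%N].
Definition mdelta (i : 'I_N.-1) : mindex := [ffun j => (i == j) : nat].

Definition zmon (k : mindex * mindex) : A :=
  (\prod_(i < N.-1) xgen i.+1 ^+ k.1 i) * (\prod_(i < N.-1) pgen i.+1 ^+ k.2 i).

(* f_1 ^ n_1 ... f_(N-1) ^ n_(N-1) in A^*. *)
Definition dual_mon (f : 'I_N.-1 -> A -> fps K) (n : mindex) : A -> fps K :=
  \big[@conv K/counit]_(i < N.-1) iter (n i) (conv (f i)) counit.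

Definition prod_incr (F : 'I_N.-1 -> A -> A) : A -> A :=
  \big[@conv U/conv_unit]_(i < N.-1) F i.
Definition prod_decr (F : 'I_N.-1 -> A -> A) : A -> A :=
  \big[@conv U/conv_unit]_(i < N.-1) F (rev_ord i).

End Twisted.

(* Main.v *)
From HB Require Import structures.
Require Import Defs.
From mathcomp Require Import all_boot all_order all_algebra.
From mathcomp Require Import boolp reals complex ring.
Import GRing.Theory.
Local Open Scope ring_scope.
Set Implicit Arguments.
Unset Strict Implicit.
Unset Printing Implicit Defensive.

(* The proof evaluates everything on monomials. In closed form
     Delta_F(x_j) = x_j (x) e^(-sigma) + 1 (x) x_j,
     Delta_F(pi_j) = pi_j (x) e^(-sigma) + 1 (x) pi_j  (j >= 2),
   sigma is primitive, and
     Delta_F(x_1) = x_1 (x) e^(-2 sigma) + 1 (x) x_1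
                    - 2 xi \sum_j x_j (x) pi_j e^(-sigma).
   Hence the closed left ideal J generated by the pi_i is a two-sided ideal and a
   coideal, and a product f g of functionals with f vanishing on all x_i A and g
   vanishing on J takes the value f(pi^n) g(x^m) on x^m pi^n; modulo J the x_i are
   primitive, which computes the powers of the dual elements.
   The antipode equation gives y_i = - S(x_i) and q_i = - S(pi_i) explicitly. The
   monomials y^m q^n again span A topologically, a convolution X * Q with X
   vanishing on J and Q on all x_i A maps y^m q^n to X(x^m) Q(q^n), and the two
   products of exponentials map x^m to y^m and q^n to q^n. So their convolution is
   the identity, which is also the canonical element. *)

(** * Formal power series *)

(** All formulas are compared as linear maps, and a K[[xi]]-linear map is determined by its values
    on lifts of a spanning set of U(B^vee), so each identity is checked on one family of ordered
    monomials. The obstacle is that the two formulas multiply functionals in opposite orders. The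
    first has the pi^i on the left and fits the monomials x^m pi^n. In the ordered product the x^i
    stand on the left, and the factor e^(-sigma) in the second leg of Delta_F(x_i) then meets
    functionals of pi_1, which see it. Since S reverses the coproduct, passing to y_i and q_i
    repairs this: up to terms killed by the functionals, y_i behaves as x_i (x) 1 and q_i as 1 (x)
    q_i. Series in xi E_1N with constant term 1, such as e^sigma and e^(-sigma), are invisible to
    functionals vanishing on A pi_1. This also explains the two orders of the pi^i: the factor
    e^(-sigma) of Delta_F(pi_j) sits in the second leg and asks for pi^1 first, while the factor
    e^sigma of Delta_F(q_j) sits in the first leg and asks for pi^1 last. *)

Section Linear.
Variables (R : pzRingType) (V W : lmodType R) (f : V -> W).
Hypothesis f_lin : linear f.
Let g : {linear V -> W} := HB.pack f (GRing.isLinear.Build _ _ _ _ f f_lin).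

Lemma lin0 : f 0 = 0. Proof. exact: (linear0 g). Qed.
Lemma linD : {morph f : a b / a + b}. Proof. exact: (linearD g). Qed.
Lemma linB : {morph f : a b / a - b}. Proof. exact: (linearB g). Qed.
Lemma linN : {morph f : a / - a}. Proof. exact: (linearN g). Qed.
Lemma linZ c a : f (c *: a) = c *: f a. Proof. exact: (linearZ_LR g). Qed.
Lemma linMn k : {morph f : a / a *+ k}. Proof. exact: (linearMn g). Qed.
Lemma lin_sum I r (P : pred I) F :
  f (\sum_(i <- r | P i) F i) = \sum_(i <- r | P i) f (F i).
Proof. exact: (linear_sum g). Qed.
End Linear.

Section FpsModule.
Variables (K : fieldType).
Implicit Types V W : lmodType K.

Lemma fpsZ_coef V c (a : fps V) n : (fpsC c *: a) n = c *: a n.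
Proof.
rewrite /= big_ord_recl /= subn0 big1 ?addr0 // => i _; by rewrite scale0r.
Qed.

Lemma fpsX_scale V (a : fps V) : fpsX (1 : fps K) *: a = fpsX a.
Proof.
apply: fpsP => -[|n] /=; first by rewrite big_ord_recl big_ord0 scale0r addr0.
rewrite big_ord_recl /= scale0r add0r big_ord_recl /= scale1r subSS subn0.
by rewrite big1 ?addr0 // => i _; rewrite scale0r.
Qed.

Lemma fpsCD V (u v : V) : fpsC (u + v) = fpsC u + fpsC v.
Proof. by apply: fpsP => -[|n] //=; rewrite addr0. Qed.
Lemma fpsC0 V : fpsC (0 : V) = 0.
Proof. by apply: fpsP => -[|n]. Qed.
Lemma fpsCZ V (c : K) (u : V) : fpsC (c *: u) = fpsC c *: fpsC u.
Proof.
by apply: fpsP => n; rewrite fpsZ_coef /=; case: n => //=; rewrite scaler0.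
Qed.
Lemma fpsC_sum V I r (P : pred I) (F : I -> V) :
  fpsC (\sum_(i <- r | P i) F i) = \sum_(i <- r | P i) fpsC (F i).
Proof. by apply: (big_morph _ (@fpsCD V) (@fpsC0 V)). Qed.
Lemma fpsCMn V (v : V) k : fpsC (v *+ k) = fpsC v *+ k.
Proof. by elim: k => [|k IH]; rewrite ?mulr0n ?fpsC0 // !mulrS fpsCD IH. Qed.

Lemma fps_splitX V (a : fps V) : a = fpsC (a 0%N) + fpsX (fps_divX a).
Proof. by apply: fpsP => -[|n] /=; rewrite ?addr0 ?add0r. Qed.

Lemma fpsX_inj V : injective (@fpsX V).
Proof. by move=> a b e; apply: fpsP => n; have := congr1 (fun c : fps V => c n.+1) e. Qed.

Lemma fcoef_sum V I r (P : pred I) (F : I -> fps V) n :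
  (\sum_(i <- r | P i) F i) n = \sum_(i <- r | P i) F i n.
Proof. by elim/big_rec2: _ => //= i _ b _ <-. Qed.

Lemma fcoefMn V (a : fps V) k n : (a *+ k) n = a n *+ k.
Proof. by elim: k => // k IH; rewrite !mulrS /= IH. Qed.

Lemma lin_fpsX V W (f : fps V -> fps W) : linear f -> forall a,
  f (fpsX a) = fpsX (f a).
Proof. by move=> fl a; rewrite -fpsX_scale linZ // fpsX_scale. Qed.

(* K[[xi]]-linearity forces xi-adic continuity, so generators modulo xi suffice. *)
Lemma linear_coef0 V W (f : fps V -> fps W) (I : Type) (w : I -> fps V) :
    linear f -> (forall i, f (w i) = 0) ->
    (forall v : V, exists s : seq (K * I), v = \sum_(t <- s) t.1 *: w t.2 0%N) ->
  forall a, f a = 0.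
Proof.
move=> fl fw sp a; apply: fpsP => n; move: n a.
(* Subtracting a lift of the constant term, on which f vanishes, leaves a multiple of xi. So f a is
   xi times another value of f, and iteration makes it divisible by every power of xi. *)
have step a : exists b, f a = fpsX (f b).
  have [s es] := sp (a 0%N).
  pose c := a - \sum_(t <- s) fpsC t.1 *: w t.2.
  have c0 : c 0%N = 0.
    rewrite /c /= fcoef_sum {1}es; apply/eqP; rewrite subr_eq0; apply/eqP.
    by apply: eq_bigr => t _; rewrite fpsZ_coef.
  exists (fps_divX c); rewrite -lin_fpsX //.
  have -> : fpsX (fps_divX c) = c by rewrite {2}[c]fps_splitX c0 fpsC0 add0r.
  rewrite linB // lin_sum // big1 ?subr0 // => t _.
  by rewrite linZ // fw scaler0.
by elim=> [|n IH] a; have [b ->] := step a; rewrite //= IH.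
Qed.

Lemma linear_eq_span V W (f g : fps V -> fps W) (I : Type) (w : I -> fps V) :
    linear f -> linear g -> (forall i, f (w i) = g (w i)) ->
    (forall v : V, exists s : seq (K * I), v = \sum_(t <- s) t.1 *: w t.2 0%N) ->
  f =1 g.
Proof.
move=> fl gl e sp a; apply/eqP; rewrite -subr_eq0; apply/eqP.
apply: (@linear_coef0 V W (fun a => f a - g a) I w) => //.
  by move=> c u v; rewrite fl gl scalerBr opprD addrACA.
by move=> i; rewrite e subrr.
Qed.

Lemma linear_eq_const V W (f g : fps V -> fps W) : linear f -> linear g ->
  (forall v, f (fpsC v) = g (fpsC v)) -> f =1 g.
Proof.
move=> fl gl e; apply: (linear_eq_span fl gl e) => v.
by exists [:: (1, v)]; rewrite big_seq1 scale1r.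
Qed.

End FpsModule.

Section FpsConst.
Variable R : pzRingType.

Lemma fpsCM (u v : R) : fpsC (u * v) = fpsC u * fpsC v.
Proof.
apply: fpsP => n /=; rewrite big_ord_recl /= subn0 big1 ?addr0; last first.
  by move=> i _; rewrite mul0r.
by case: n => //=; rewrite mulr0.
Qed.

Lemma fpsC_nat k : fpsC (k%:R : R) = k%:R.
Proof.
elim: k => [|k IH]; first by apply: fpsP => -[].
by rewrite !mulrS -IH; apply: fpsP => -[|n] /=; rewrite ?addr0.
Qed.
End FpsConst.

Section FpsAlgebra.
Variables (K : fieldType) (A B : algType K).
Implicit Types a b c X Y u v : fps A.

Lemma fpsX_mull a b : fpsX (a * b) = fpsX a * b.
Proof. by rewrite -fpsX_scale scalerAl fpsX_scale. Qed.
Lemma fpsX_mulr a b : fpsX (a * b) = a * fpsX b.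
Proof. by rewrite -fpsX_scale scalerAr fpsX_scale. Qed.
Lemma fpsXD a b : fpsX (a + b) = fpsX a + fpsX b.
Proof. by rewrite -!fpsX_scale scalerDr. Qed.
Lemma fpsXN a : fpsX (- a) = - fpsX a.
Proof. by rewrite -!fpsX_scale scalerN. Qed.
Lemma fpsXMn a k : fpsX (a *+ k) = fpsX a *+ k.
Proof. by rewrite -!fpsX_scale scalerMnr. Qed.

Lemma fcoefD a b n : (a + b) n = a n + b n. Proof. by []. Qed.
Lemma fcoefN a n : (- a) n = - a n. Proof. by []. Qed.
Lemma fcoefM0 a b : (a * b) 0%N = a 0%N * b 0%N.
Proof. by rewrite /= big_ord_recl big_ord0 addr0. Qed.
Lemma fcoefX0 a k : (a ^+ k) 0%N = a 0%N ^+ k.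
Proof.
by elim: k => [//|k IH]; rewrite exprS fcoefM0 exprS IH.
Qed.
Lemma fcoef_prod0 I r (P : pred I) (F : I -> fps A) :
  (\prod_(i <- r | P i) F i) 0%N = \prod_(i <- r | P i) F i 0%N.
Proof.
elim: r => [|i r IH]; first by rewrite !big_nil.
by rewrite !big_cons; case: (P i); rewrite // fcoefM0 IH.
Qed.

Lemma expr_coef_lt a k n : a 0%N = 0 -> (n < k)%N -> (a ^+ k) n = 0.
Proof.
move=> a0; elim: k n => // k IH n nk; rewrite exprS /=.
rewrite big1 // => -[[|i] /= lt] _; first by rewrite a0 mul0r.
rewrite IH ?mulr0 // ltn_subLR ?(leq_trans nk) // ?addSn ?ltnS ?leq_addl //.
Qed.

(** Equality modulo xi^M. Below this order [fps_exp] can be replaced by the single polynomial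
    [expT], whereas its definition truncates each coefficient at a different length. *)
Definition eqm M a b := forall n, (n < M)%N -> a n = b n.

Lemma eqm_mul M a b c d : eqm M a b -> eqm M c d -> eqm M (a * c) (b * d).
Proof.
move=> e e' n nM /=; apply: eq_bigr => -[i lt] _ /=; congr (_ * _).
  by apply: e; apply: leq_trans nM.
by apply: e'; apply: leq_ltn_trans nM; apply: leq_subr.
Qed.

Lemma eqm_eq a b : (forall M, eqm M a b) -> a = b.
Proof. by move=> e; apply: fpsP => n; apply: (e n.+1). Qed.

Definition expT M a : fps A := \sum_(k < M) fpsC (k`!%:R : K)^-1 *: a ^+ k.

Lemma coef_exp a n :
  fps_exp a n = \sum_(k < n.+1) (k`!%:R : K)^-1 *: (a ^+ k) n.
Proof. by []. Qed.

Lemma fps_expT M a : a 0%N = 0 -> eqm M (fps_exp a) (expT M a).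
Proof.
move=> a0 n nM; rewrite coef_exp fcoef_sum.
rewrite (big_ord_widen M (fun k => (k`!%:R : K)^-1 *: (a ^+ k) n)) //.
rewrite big_mkcond; apply: eq_bigr => i _; rewrite fpsZ_coef.
by case: ltnP => // ni; rewrite expr_coef_lt ?scaler0.
Qed.

Lemma fps_exp_coef0 a : fps_exp a 0%N = 1.
Proof. by rewrite /= big_ord_recl big_ord0 /= invr1 scale1r addr0. Qed.

Lemma fps_exp_intertwine X Y u : X 0%N = 0 -> Y 0%N = 0 -> X * u = u * Y ->
  fps_exp X * u = u * fps_exp Y.
Proof.
move=> X0 Y0 e; apply: eqm_eq => M n nM.
rewrite (eqm_mul (fps_expT X0) (fun n _ => erefl (u n)) nM).
rewrite (eqm_mul (fun n _ => erefl (u n)) (fps_expT Y0) nM).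
congr (coef _ _); rewrite mulr_suml mulr_sumr; apply: eq_bigr => k _.
rewrite -scalerAl -scalerAr; congr (_ *: _).
elim: (k : nat) => [|m IH]; first by rewrite !expr0 mul1r mulr1.
by rewrite (exprS X) (exprS Y) -mulrA IH mulrA e mulrA.
Qed.

Hypothesis char0 : forall k, k.+1%:R != 0 :> K.

Lemma fact_neq0 k : k`!%:R != 0 :> K.
Proof. by rewrite -(prednK (fact_gt0 k)). Qed.

(** Hadamard's formula stopped at first order: [X, u] = v commutes with X, so X^k u = u X^k + k v
    X^(k-1). *)
Lemma fps_exp_shift X u v : X 0%N = 0 -> X * u = u * X + v -> X * v = v * X ->
  fps_exp X * u = (u + v) * fps_exp X.
Proof.
move=> X0 e c; apply: eqm_eq => M n nM.
rewrite (eqm_mul (fps_expT X0) (fun n _ => erefl (u n)) (leqW nM)).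
rewrite mulrDl fcoefD.
rewrite (eqm_mul (fun n _ => erefl (u n)) (fps_expT X0) (leqW nM)).
(* The factor k / k! shifts the exponential series of the v-part by one term, so this part is
   truncated at [M] and the other two at [M.+1]. *)
rewrite (eqm_mul (fun n _ => erefl (v n)) (fps_expT X0) nM).
rewrite -fcoefD; congr (coef _ _).
have P k : X ^+ k * u = u * X ^+ k + (v * X ^+ k.-1) *+ k.
  elim: k => [|k IH]; first by rewrite !expr0 mul1r mulr1 mulr0n addr0.
  rewrite exprS -mulrA IH mulrDr mulrA e mulrDl -mulrA -exprS -addrA.
  congr (_ + _); rewrite mulrnAr mulrA c -mulrA -exprS /= mulrS; congr (_ + _).
  by case: k {IH} => [|k] //; rewrite !mulr0n.
rewrite /expT mulr_suml !mulr_sumr.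
under eq_bigr do rewrite -scalerAl P scalerDr.
rewrite big_split /=; congr (_ + _).
  by apply: eq_bigr => k _; rewrite scalerAr.
rewrite big_ord_recl mulr0n scaler0 add0r; apply: eq_bigr => k _.
rewrite -scalerAr lift0 /= -scaler_nat scalerA; congr (_ *: _).
by rewrite -fpsC_nat -fpsCM factS natrM invfM mulrAC mulVf ?mul1r.
Qed.

Lemma fps_expD X Y : X 0%N = 0 -> Y 0%N = 0 -> X * Y = Y * X ->
  fps_exp (X + Y) = fps_exp X * fps_exp Y.
Proof.
move=> X0 Y0 c; have XY0 : (X + Y) 0%N = 0 by rewrite /= X0 Y0 addr0.
apply: eqm_eq => -[//|M] n nM.
rewrite (eqm_mul (fps_expT X0) (fps_expT Y0) nM) (fps_expT XY0 nM).
pose F i j : fps A := fpsC ((i`!%:R)^-1 * (j`!%:R)^-1 : K) *: (X ^+ i * Y ^+ j).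
have -> : expT M.+1 X * expT M.+1 Y = \sum_(i < M.+1) \sum_(j < M.+1) F i j.
  rewrite mulr_suml; apply: eq_bigr => i _; rewrite mulr_sumr.
  by apply: eq_bigr => j _; rewrite -scalerAl -scalerAr scalerA -fpsCM.
(* X^i Y^j is divisible by xi^(i+j), so for coefficients up to [M] the square of indices can be cut
   to the triangle i + j <= M, where the binomial theorem applies. *)
have Fz i j : (M < i + j)%N -> F i j n = 0.
  move=> lt; rewrite fpsZ_coef /= big1 ?scaler0 // => -[k /= kn] _.
  have [ki|ik] := ltnP k i; first by rewrite expr_coef_lt ?mul0r.
  rewrite [(Y ^+ j) _]expr_coef_lt ?mulr0 //.
  rewrite ltn_subLR //; apply: leq_trans nM _; apply: (leq_trans lt).
  by rewrite leq_add2r.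
have -> : (\sum_(i < M.+1) \sum_(j < M.+1) F i j) n =
          (\sum_(i < M.+1) \sum_(j < (M - i).+1) F i j) n.
  rewrite !fcoef_sum; apply: eq_bigr => i _; rewrite !fcoef_sum.
  rewrite [RHS](big_ord_widen M.+1 (fun j => F i j n)); last first.
    by rewrite ltnS leq_subr.
  rewrite [RHS]big_mkcond; apply: eq_bigr => j _; rewrite ltnS.
  by case: leqP => // lt; rewrite Fz // -ltn_subLR // -ltnS.
rewrite -(triangular_sum3 (fun i j _ => F i j)); congr (coef _ _).
apply: eq_bigr => k _; rewrite exprDn_comm // scaler_sumr.
rewrite (reindex_inj rev_ord_inj) /=; apply: eq_bigr => i _.
rewrite /F subSS subKn -1?ltnS // -scaler_nat scalerA; congr (_ *: _).
have ik : (i <= k)%N by rewrite -ltnS.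
rewrite bin_sub // -fpsC_nat -fpsCM; congr fpsC.
rewrite -(bin_fact ik) !natrM !invfM mulrAC mulVf ?mul1r //.
by rewrite -(prednK (_ : 0 < 'C(k, i))%N) // bin_gt0.
Qed.

Lemma fps_exp0 : fps_exp (0 : fps A) = 1.
Proof.
apply: fpsP => n; rewrite coef_exp big_ord_recl expr0 invr1 scale1r.
by rewrite big1 ?addr0 // => k _; rewrite lift0 expr0n scaler0.
Qed.

Lemma fps_expN X : X 0%N = 0 -> fps_exp X * fps_exp (- X) = 1.
Proof.
move=> X0; rewrite -fps_expD ?subrr ?fps_exp0 //= ?X0 ?oppr0 //.
by rewrite mulrN mulNr.
Qed.

Lemma fps_exp_sum I r (P : pred I) (F : I -> fps A) :
    (forall i, F i 0%N = 0) -> (forall i j, F i * F j = F j * F i) ->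
  \prod_(i <- r | P i) fps_exp (F i) = fps_exp (\sum_(i <- r | P i) F i).
Proof.
move=> F0 FC; elim: r => [|i r IH]; first by rewrite !big_nil fps_exp0.
rewrite !big_cons IH; case: (P i) => //; rewrite fps_expD //.
  by rewrite fcoef_sum big1.
by rewrite mulr_sumr mulr_suml; apply: eq_bigr.
Qed.

(** As X has no constant term, the coefficient of xi^(M+1) in X^k with k >= 2 involves only the
    coefficients of X up to xi^M; so exp X determines X one coefficient after the other. It serves
    to take logarithms in the noncommutative tensor square. *)
Lemma fps_exp_inj X Y : X 0%N = 0 -> Y 0%N = 0 -> fps_exp X = fps_exp Y -> X = Y.
Proof.
move=> X0 Y0 e; apply: eqm_eq; elim=> [//|M IH] n; rewrite ltnS leq_eqVlt.
case/orP=> [/eqP {n}->|]; last exact: IH.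
case: M IH => [|M] IH; first by rewrite X0 Y0.
have E k : (X ^+ k.+2) M.+1 = (Y ^+ k.+2) M.+1.
  have : eqm M.+1 (fps_divX X * X ^+ k.+1) (fps_divX Y * Y ^+ k.+1) -> 
      (X ^+ k.+2) M.+1 = (Y ^+ k.+2) M.+1.
    move=> /(_ M (leqnn _)) e'; rewrite !(exprS _ k.+1).
    rewrite [X in X * _ ^+ _]fps_splitX [X in _ = coef (X * _ ^+ _) _]fps_splitX.
    by rewrite X0 Y0 fpsC0 !add0r -!fpsX_mull.
  apply=> m mM /=; apply: eq_bigr => -[i lt] _ /=.
  (* The top coefficient of [fps_divX X] is not covered by [IH], but it meets the zero constant term
     of X^(k+1). *)
  have [->|ne] := eqVneq i M.
    have -> : (m - M)%N = 0%N by apply/eqP; rewrite subn_eq0.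
    by rewrite [(X ^+ _) _]expr_coef_lt ?[(Y ^+ _) _]expr_coef_lt ?mulr0.
  have iM : (i < M)%N by rewrite ltn_neqAle ne -ltnS (leq_trans lt).
  congr (_ * _); first by apply: IH; rewrite ltnS.
  have P j : eqm M.+1 (X ^+ j) (Y ^+ j).
    by elim: j => [|j IHj] //; rewrite !exprS; apply: eqm_mul.
  by apply: P; apply: leq_ltn_trans mM; apply: leq_subr.
have S2 (Z : fps A) : fps_exp Z M.+1 = Z M.+1 +
    \sum_(i < M) (i.+2`!%:R : K)^-1 *: (Z ^+ i.+2) M.+1.
  rewrite coef_exp 2!big_ord_recl expr0 scaler0 add0r expr1 invr1 scale1r.
  by congr (_ + _); apply: eq_bigr => i _; rewrite !lift0.
have : fps_exp X M.+1 = fps_exp Y M.+1 by rewrite e.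
rewrite !S2.
under eq_bigr do rewrite E.
exact: addIr.
Qed.

Lemma fps_invr a : a 0%N = 1 -> a * fps_inv a = 1 /\ fps_inv a * a = 1.
Proof.
move=> a1; set b := 1 - a.
have b0 : b 0%N = 0 by rewrite /b /= a1 subrr.
have ab : a = 1 - b by rewrite /b opprB addrC subrK.
have T M : eqm M (fps_inv a) (\sum_(k < M) b ^+ k).
  move=> n nM; rewrite fcoef_sum /fps_inv [LHS]/= -/b.
  rewrite (big_ord_widen M (fun k => (b ^+ k) n)) // big_mkcond.
  by apply: eq_bigr => i _; case: ltnP => // ni; rewrite expr_coef_lt.
have G M : (1 - b) * (\sum_(k < M) b ^+ k) = 1 - b ^+ M.
  by rewrite -opprB mulNr -subrX1 opprB.
have G' M : (\sum_(k < M) b ^+ k) * (1 - b) = 1 - b ^+ M.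
  rewrite -G mulrBr mulrBl mulr1 mul1r mulr_suml mulr_sumr; congr (_ - _).
  by apply: eq_bigr => k _; rewrite -exprS exprSr.
split; apply: eqm_eq => M n nM.
  rewrite (eqm_mul (fun n _ => erefl (a n)) (@T M) nM) ab G.
  by rewrite /= expr_coef_lt // oppr0 addr0.
rewrite (eqm_mul (@T M) (fun n _ => erefl (a n)) nM) ab G'.
by rewrite /= expr_coef_lt // oppr0 addr0.
Qed.

End FpsAlgebra.

Section FpsMap.
Variables (K : fieldType) (A B : algType K) (phi : {lrmorphism A -> B}).

Fact fps_map_linear : linear (fps_map phi).
Proof.
move=> c a b; apply: fpsP => n; rewrite /= raddfD raddf_sum; congr (_ + _).
by apply: eq_bigr => i _; rewrite /= linearZ_LR.
Qed.
HB.instance Definition _ := GRing.isLinear.Build (fps K) (fps A) (fps B) _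
  (fps_map phi) fps_map_linear.

Fact fps_map_monoid : monoid_morphism (fps_map phi).
Proof.
split=> [|a b]; apply: fpsP => n /=.
  by case: n => [|n]; rewrite ?rmorph1 ?rmorph0.
by rewrite raddf_sum; apply: eq_bigr => i _; rewrite /= rmorphM.
Qed.
HB.instance Definition _ := GRing.isMonoidMorphism.Build (fps A) (fps B)
  (fps_map phi) fps_map_monoid.

Lemma fps_map_exp a : fps_map phi (fps_exp a) = fps_exp (fps_map phi a).
Proof.
apply: fpsP => n; rewrite /= raddf_sum; apply: eq_bigr => k _.
by rewrite /= linearZ_LR -rmorphXn.
Qed.

Lemma fcoef_map a k : fps_map phi a k = phi (a k). Proof. by []. Qed.
Lemma fps_mapC u : fps_map phi (fpsC u) = fpsC (phi u).
Proof. by apply: fpsP => -[|n] //=; rewrite rmorph0. Qed.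
Lemma fps_mapX a : fps_map phi (fpsX a) = fpsX (fps_map phi a).
Proof. by apply: fpsP => -[|n] //=; rewrite rmorph0. Qed.
End FpsMap.

(** * The scalar series (1/2) ln(1 + 2t) and its exponential *)

Section Theta.
Variables (K : fieldType).
Hypothesis char0 : forall k, k.+1%:R != 0 :> K.
Local Notation P := (fps (K^o)).
Implicit Types a b f : P.

(* The derivation xi d/dxi. *)
Definition theta (a : P) : P := Fps (fun n => a n *+ n).

Lemma coef_theta a n : theta a n = a n *+ n. Proof. by []. Qed.

Lemma thetaD a b : theta (a + b) = theta a + theta b.
Proof. by apply: fpsP => n; rewrite /= mulrnDl. Qed.
Lemma thetaM a b : theta (a * b) = theta a * b + a * theta b.
Proof.
apply: fpsP => n; rewrite /= -sumrMnl -big_split; apply: eq_bigr => i _ /=.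
by rewrite mulrnAl mulrnAr -mulrnDr subnKC // -ltnS.
Qed.
Lemma thetaX a k : theta (a ^+ k) = (theta a * a ^+ k.-1) *+ k.
Proof.
elim: k => [|k IH].
  by rewrite mulr0n; apply: fpsP => -[|n] //=; rewrite mul0rn.
rewrite exprS thetaM IH /= mulrS; congr (_ + _).
case: k {IH} => [|k]; first by rewrite !mulr0n mulr0.
by rewrite mulrnAr mulrCA -exprS.
Qed.
Lemma thetaZ (c : K) a : theta (fpsC c *: a) = fpsC c *: theta a.
Proof. by apply: fpsP => n; rewrite coef_theta !fpsZ_coef coef_theta scalerMnr. Qed.

Lemma theta_exp a : a 0%N = 0 -> theta (fps_exp a) = theta a * fps_exp a.
Proof.
move=> a0; apply: eqm_eq => M n nM.
rewrite (eqm_mul (fun n _ => erefl (theta a n)) (fps_expT a0) nM).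
rewrite coef_theta (fps_expT a0 (leqW nM)) -coef_theta.
suff -> : theta (expT M.+1 a) = theta a * expT M a by [].
have -> : theta (expT M.+1 a) = \sum_(k < M.+1) theta (fpsC (k`!%:R : K)^-1 *: a ^+ k).
  apply: (big_morph theta thetaD).
  by apply: fpsP => k; rewrite /= mul0rn.
rewrite big_ord_recl thetaZ thetaX mulr0n scaler0 add0r mulr_sumr.
apply: eq_bigr => k _; rewrite lift0 thetaZ thetaX /= -scaler_nat scalerA.
rewrite -scalerAr -fpsC_nat -fpsCM factS natrM invfM mulrAC mulVf ?mul1r //.
Qed.

(** This is (1/2) ln(1 + 2t), whose value at t = xi E_1N is [sigma] (see [sigma_at]). Identities
    about sigma are proved here, for commutative scalar series, and transported by the ring morphism
    [fps_at]. *)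
Definition slog : P := fpsC (2%:R^-1 : K) *: fps_ln1p (fpsX (fpsC (2%:R : K^o))).
Local Notation t := (fpsX 1 : P).

Lemma fpsXC_expr (c : K^o) k n :
  (fpsX (fpsC c) ^+ k) n = (n == k)%:R * c ^+ k :> K^o.
Proof.
elim: k n => [|k IH] n; first by rewrite expr0 /= mulr1; case: n.
rewrite exprS -fpsX_mull; case: n => [|n] /=; first by rewrite mul0r.
rewrite big_ord_recl big1 /= ?addr0 ?subn0 => [|i _]; last by rewrite mul0r.
by rewrite IH eqSS mulrCA -exprS.
Qed.

Lemma slog_coef n : slog n = if n is m.+1 then (-1) ^+ m * 2%:R ^+ m / m.+1%:R else 0.
Proof.
rewrite /slog fpsZ_coef; case: n => [|n].
  by rewrite /= big_geq // scaler0.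
rewrite /fps_ln1p [fps_ln1p _ _]/= big_nat_recr //=.
rewrite big_nat_cond big1 => [|k /andP[/andP[_ kn] _]]; last first.
  rewrite fpsXC_expr gtn_eqF // mul0r scaler0 //.
rewrite add0r fpsXC_expr eqxx mul1r /GRing.scale /=.
have h2 : (2%:R : K) != 0 := char0 1.
by rewrite (exprS (2%:R : K)) mulrCA mulKf // mulrAC.
Qed.

Lemma slog0 : slog 0%N = 0. Proof. by rewrite slog_coef. Qed.

Lemma theta_slog : (1 + t *+ 2) * theta slog = t.
Proof.
move: slog slog_coef => L LE.
rewrite mulrDl mul1r mulrnAl -fpsX_mull mul1r.
apply: fpsP => -[|n]; rewrite fcoefD fcoefMn /= ?mulr0n ?add0r ?mul0rn //.
rewrite !LE; case: n => [|n] /=.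
  by rewrite !expr0 invr1 !mulr1 mulr1n mulr0n mul0rn addr0.
have h2 : (n.+2%:R : K) != 0 := char0 n.+1.
have h1 : (n.+1%:R : K) != 0 := char0 n.
rewrite -[X in X + _ = _]mulr_natr -[X in _ + X *+ 2]mulr_natr !exprS.
by rewrite !divfK // -mulr_natr; ring.
Qed.

(** Both sides have constant term 1 and solve (1 + 2t) theta f = 2t f; the recurrence [C] on the
    coefficients has only one such solution. *)
Lemma exp_slog : fps_exp (slog *+ 2) = 1 + t *+ 2.
Proof.
set f := fps_exp _.
have s20 : (slog *+ 2) 0%N = 0 by rewrite fcoefMn slog0 mul0rn.
have f0 : f 0%N = 1 by apply: fps_exp_coef0.
have E : (1 + t *+ 2) * theta f = t *+ 2 * f.
  have -> : theta f = theta slog *+ 2 * f.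
    by rewrite theta_exp // [slog *+ 2]mulr2n thetaD -mulr2n.
  by rewrite mulrA mulrnAr theta_slog.
clearbody f; clear s20.
have C n : f n.+1 *+ n.+1 + f n *+ n *+ 2 = f n *+ 2.
  have := congr1 (fun a : P => a n.+1) E.
  rewrite mulrDl mul1r !mulrnAl -!fpsX_mull !mul1r fcoefD !fcoefMn.
  by rewrite coef_theta.
have f1 : f 1%N = 2%:R by have := C 0%N; rewrite f0 !mulr0n mul0rn addr0.
apply: fpsP => -[|[|n]].
- by rewrite f0 fcoefD fcoefMn /= mul0rn addr0.
- by rewrite f1 fcoefD fcoefMn /= add0r.
rewrite fcoefD fcoefMn /= mul0rn addr0; elim: n => [|n IH].
  have := C 1%N; rewrite -{2}[f 1%N *+ 2]add0r mulr1n => /addIr /eqP.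
  by rewrite -mulr_natr mulf_eq0 (negPf (char0 1)) orbF => /eqP.
have := C n.+2; rewrite IH !mul0rn addr0 => /eqP.
by rewrite -mulr_natr mulf_eq0 (negPf (char0 n.+2)) orbF => /eqP.
Qed.

Lemma theta_slogE : theta slog = t * fps_exp (- (slog *+ 2)).
Proof.
have s20 : (slog *+ 2) 0%N = 0 by rewrite fcoefMn slog0 mul0rn.
rewrite -{1}theta_slog -exp_slog mulrAC fps_expN // mul1r //.
Qed.
End Theta.

Section FpsAt.
Variables (K : fieldType) (A : algType K) (c : A).
Local Notation P := (fps (K^o)).
Implicit Types a b f : P.

(* The substitution of xi c for xi. *)
Definition fps_at (f : P) : fps A := Fps (fun n => (f n : K) *: c ^+ n).

Lemma coef_at f n : fps_at f n = (f n : K) *: c ^+ n. Proof. by []. Qed.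

Fact fps_at_zmod : zmod_morphism fps_at.
Proof. by move=> f g; apply: fpsP => n; rewrite /= scalerBl. Qed.
HB.instance Definition _ := GRing.isZmodMorphism.Build P (fps A) fps_at fps_at_zmod.

Fact fps_at_monoid : monoid_morphism fps_at.
Proof.
split=> [|f g]; apply: fpsP => n /=.
  by case: n => [|n]; rewrite ?expr0 ?scale1r ?scale0r.
rewrite scaler_suml; apply: eq_bigr => -[i lt] _ /=.
by rewrite -scalerAl -scalerAr scalerA -exprD subnKC.
Qed.
HB.instance Definition _ := GRing.isMonoidMorphism.Build P (fps A) fps_at fps_at_monoid.

Lemma fps_at_coefZ (k : K) f : fps_at (fpsC k *: f) = fpsC k *: fps_at f.
Proof. by apply: fpsP => n; rewrite fpsZ_coef !coef_at fpsZ_coef scalerA. Qed.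

Lemma fps_at_exp f : fps_at (fps_exp f) = fps_exp (fps_at f).
Proof.
apply: fpsP => n; rewrite /= scaler_suml; apply: eq_bigr => k _.
by rewrite -rmorphXn /= scalerA.
Qed.

Lemma fps_at_ln1p f : fps_at (fps_ln1p f) = fps_ln1p (fps_at f).
Proof.
apply: fpsP => n; rewrite /= scaler_suml; apply: eq_bigr => k _.
by rewrite -rmorphXn /= scalerA.
Qed.

Lemma fps_atX : fps_at (fpsX 1) = fpsX (fpsC c).
Proof.
apply: fpsP => -[|[|n]]; rewrite /= ?expr1 ?scale1r ?scale0r //.
Qed.

Lemma fps_at0 f : fps_at f 0%N = (f 0%N)%:A.
Proof. by rewrite /= expr0. Qed.

Lemma fps_at_comm f (a : fps A) : (forall n, a n * c = c * a n) -> a * fps_at f = fps_at f * a.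
Proof.
move=> e; apply: fpsP => n /=; rewrite (reindex_inj rev_ord_inj) /=.
apply: eq_bigr => -[i lt] _ /=; rewrite subSS subKn // -scalerAl -scalerAr.
congr (_ *: _); elim: i {lt} (n - i)%N => [|i IH] m; first by rewrite mulr1 mul1r.
by rewrite exprSr mulrA IH -!mulrA e.
Qed.

(** Since [h, c] = k c, the commutator with h multiplies c^m by m k; on series in xi c it is
    therefore k times the Euler derivation. *)
Lemma fps_at_theta h (k : nat) f : h * c = c * h + c *+ k ->
  fpsC h * fps_at f = fps_at f * fpsC h + fps_at (theta f *+ k).
Proof.
move=> e; have E m : h * c ^+ m = c ^+ m * h + c ^+ m *+ (m * k).
  elim: m => [|m IH]; first by rewrite expr0 mulr1 mul1r mulr0n addr0.
  rewrite exprSr mulrA IH mulrDl -mulrA e mulrDr mulrA -addrA mulSn mulrnDr.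
  by rewrite mulrnAr mulrnAl.
apply: fpsP => n; rewrite fcoefD.
have -> : (fps_at f * fpsC h) n = fps_at f n * h.
  rewrite /= big_ord_recr /= subnn big1 ?add0r // => -[i lt] _ /=.
  by rewrite subn_eq0 leqNgt lt mulr0.
rewrite /= big_ord_recl /= subn0 big1 ?addr0 => [|i _]; last by rewrite mul0r.
rewrite -scalerAl -scalerAr E scalerDr fcoefMn /= -mulrnA.
by rewrite -[f n *+ _]mulr_natr -scalerA scaler_nat.
Qed.

(** With c = E_1N it shows that a functional vanishing on multiples of E_1N sees only the constant
    term of a series in xi E_1N. *)
Lemma fps_at_split f : fps_at f =
  (fpsC (f 0%N : K))%:A + fps_at (fps_divX f) * fpsX (fpsC c).
Proof.
rewrite {1}[f]fps_splitX rmorphD /=; congr (_ + _).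
  apply: fpsP => n; rewrite fpsZ_coef /=; case: n => [|n] //=.
  by rewrite scale0r scaler0.
by rewrite -fps_atX -rmorphM -fpsX_mulr mulr1.
Qed.
End FpsAt.

(** * Functionals on the completed tensor square *)

Section TensorFps.
Variables (K : fieldType) (L : lmodType K) (br : L -> L -> L).
Local Notation U := (Uenv br).
Local Notation T := (tens U U).

Definition tinl (u : U) : T := tpure u 1.
Definition tinr (u : U) : T := tpure 1 u.

Fact tinl_linear : linear tinl.
Proof. exact: (tpure_bilinear U U).2. Qed.
HB.instance Definition _ := GRing.isLinear.Build K U T _ tinl tinl_linear.
Fact tinl_monoid : monoid_morphism tinl.
Proof. by split=> // u v; rewrite /tinl tpureM mulr1. Qed.
HB.instance Definition _ := GRing.isMonoidMorphism.Build U T tinl tinl_monoid.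
Fact tinr_linear : linear tinr.
Proof. exact: (tpure_bilinear U U).1. Qed.
HB.instance Definition _ := GRing.isLinear.Build K U T _ tinr tinr_linear.
Fact tinr_monoid : monoid_morphism tinr.
Proof. by split=> // u v; rewrite /tinr tpureM mulr1. Qed.
HB.instance Definition _ := GRing.isMonoidMorphism.Build U T tinr tinr_monoid.

Local Notation l := (fps_map tinl).
Local Notation r := (fps_map tinr).

Lemma tinlr u v : tinl u * tinr v = tpure u v.
Proof. by rewrite /tinl /tinr tpureM mulr1 mul1r. Qed.
Lemma tinrl u v : tinr v * tinl u = tpure u v.
Proof. by rewrite /tinl /tinr tpureM mulr1 mul1r. Qed.

Lemma fps_tpureE (a b : fps U) : fps_tpure a b = l a * r b.
Proof. by apply: fpsP => n /=; apply: eq_bigr => i _; rewrite tinlr. Qed.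

Lemma fps_lrC (a b : fps U) : r b * l a = l a * r b.
Proof.
apply: fpsP => n /=; rewrite (reindex_inj rev_ord_inj) /=.
apply: eq_bigr => i _; rewrite subSS subKn -1?ltnS //.
by rewrite tinlr tinrl.
Qed.

Lemma fps_tens_ext (V : lmodType K) (f g : fps T -> fps V) :
    linear f -> linear g ->
    (forall u v, f (l (fpsC u) * r (fpsC v)) = g (l (fpsC u) * r (fpsC v))) ->
  f =1 g.
Proof.
move=> fl gl e; apply: (linear_eq_const fl gl) => w.
rewrite (tens_pureE w) fpsC_sum !lin_sum //; apply: eq_bigr => t _.
by have := e t.1 t.2; rewrite !fps_mapC -fpsCM tinlr.
Qed.

Section Pairing.
Variable V : algType K.
Implicit Types f g : fps U -> fps V.

Definition pairing f g (w : fps T) : fps V := fps_tlift (fun b c => f b * g c) w.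

Lemma eq_pairing f f' g g' : f =1 f' -> g =1 g' -> pairing f g =1 pairing f' g'.
Proof. by move=> /funext -> /funext ->. Qed.

Lemma linear_mull f c : linear f -> linear (fun a => f (c * a)).
Proof. by move=> fl k a b; rewrite mulrDr -scalerAr fl. Qed.
Lemma linear_mulr f c : linear f -> linear (fun a => f (a * c)).
Proof. by move=> fl k a b; rewrite mulrDl -scalerAl fl. Qed.

Section Linear.
Variables (f g : fps U -> fps V).
Hypotheses (fl : linear f) (gl : linear g).

Fact pairing_bilinear n :
  bilinear_map (fun a b : U => (f (fpsC a) * g (fpsC b)) n).
Proof.
split=> [a|b] c x y; rewrite fpsCD fpsCZ.
  by rewrite gl mulrDr -scalerAr fcoefD fpsZ_coef.
by rewrite fl mulrDl -scalerAl fcoefD fpsZ_coef.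
Qed.

Lemma pairing_linear : linear (pairing f g).
Proof.
pose F j := tlift (fun a b : U => (f (fpsC a) * g (fpsC b)) j) : T -> V.
have FD j : {morph F j : x y / x + y} by move=> x y; apply: tliftD; exact: pairing_bilinear.
have FZ j c x : F j (c *: x) = c *: F j x by apply: tliftZ; exact: pairing_bilinear.
have F0 j : F j 0 = 0 by apply: tlift0; exact: pairing_bilinear.
have P w n : pairing f g w n = \sum_(i < n.+1) F (n - i)%N (w i) by [].
move=> c a b; apply: fpsP => n; rewrite fcoefD !P.
have -> : \sum_(i < n.+1) F (n - i)%N ((c *: a + b) i) =
  \sum_(i < n.+1) F (n - i)%N ((c *: a) i) + \sum_(i < n.+1) F (n - i)%N (b i).
  by rewrite -big_split; apply: eq_bigr => i _; exact: FD.
congr (_ + _).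
transitivity (\sum_(i < n.+1) \sum_(j < i.+1) c j *: F (n - i)%N (a (i - j)%N)).
  apply: eq_bigr => i _; rewrite /= (big_morph _ (FD _) (F0 _)).
  by apply: eq_bigr => j _; rewrite FZ.
rewrite (triangular_sum3 (fun i j k => c i *: F k (a j))).
by apply: eq_bigr => i _; rewrite P scaler_sumr.
Qed.

Lemma pairing_pure a b : pairing f g (l a * r b) = f a * g b.
Proof.
have C u v : pairing f g (l (fpsC u) * r (fpsC v)) = f (fpsC u) * g (fpsC v).
  apply: fpsP => n; rewrite !fps_mapC -fpsCM tinlr /pairing /=.
  rewrite big_ord_recl /= subn0 big1 ?addr0; last first.
    by move=> i _; apply: tlift0; exact: pairing_bilinear.
  by rewrite (tlift_pure (pairing_bilinear n)).
move: a; apply: linear_eq_const => [c x y|c x y|u].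
- by rewrite linearP mulrDl -scalerAl pairing_linear.
- by rewrite fl mulrDl -scalerAl.
move: b; apply: linear_eq_const => [c x y|c x y|v]; last exact: C.
- by rewrite linearP mulrDr -scalerAr pairing_linear.
by rewrite gl mulrDr -scalerAr.
Qed.

End Linear.

(** Multiplication of the tensor is transferred to the functionals, so that the coproduct of a
    product of generators can be paired one factor at a time. *)
Lemma pairing_mull f g c d w : linear f -> linear g ->
  pairing f g (l c * r d * w) = pairing (fun a => f (c * a)) (fun b => g (d * b)) w.
Proof.
move=> fl gl; have fl' := linear_mull c fl; have gl' := linear_mull d gl.
move: w; apply: fps_tens_ext => [k x y||u v].
- by rewrite mulrDr -scalerAr pairing_linear.
- exact: pairing_linear.
rewrite mulrA -[_ * r d * _]mulrA fps_lrC mulrA -rmorphM -[_ * r d * _]mulrA -rmorphM.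
by rewrite !pairing_pure.
Qed.

Lemma pairing_mulr f g c d w : linear f -> linear g ->
  pairing f g (w * (l c * r d)) = pairing (fun a => f (a * c)) (fun b => g (b * d)) w.
Proof.
move=> fl gl; have fl' := linear_mulr c fl; have gl' := linear_mulr d gl.
move: w; apply: fps_tens_ext => [k x y||u v].
- by rewrite mulrDl -scalerAl pairing_linear.
- exact: pairing_linear.
rewrite mulrA -[_ * r _ * l _]mulrA fps_lrC mulrA -rmorphM -[_ * r _ * r _]mulrA -rmorphM.
by rewrite !pairing_pure.
Qed.

Lemma pairing_mulll f g c w : linear f -> linear g ->
  pairing f g (l c * w) = pairing (fun a => f (c * a)) g w.
Proof.
move=> fl gl; rewrite -[l c]mulr1 -[1](rmorph1 r) pairing_mull //.
by apply: eq_pairing => // b; rewrite mul1r.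
Qed.
Lemma pairing_mullr f g d w : linear f -> linear g ->
  pairing f g (r d * w) = pairing f (fun b => g (d * b)) w.
Proof.
move=> fl gl; rewrite -[r d]mul1r -[1](rmorph1 l) pairing_mull //.
by apply: eq_pairing => // b; rewrite mul1r.
Qed.
Lemma pairing_mulrr f g d w : linear f -> linear g ->
  pairing f g (w * r d) = pairing f (fun b => g (b * d)) w.
Proof.
move=> fl gl; rewrite -[r d]mul1r -[1](rmorph1 l) pairing_mulr //.
by apply: eq_pairing => // b; rewrite mulr1.
Qed.

Lemma pairing1 f g : linear f -> linear g -> pairing f g 1 = f 1 * g 1.
Proof.
by move=> fl gl; rewrite -[1 in LHS]mulr1 -{1}(rmorph1 l) -(rmorph1 r) pairing_pure.
Qed.

Lemma pairing0l f g w : linear f -> linear g -> f =1 (fun=> 0) ->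
  pairing f g w = 0.
Proof.
move=> fl gl f0; move: w; apply: fps_tens_ext => [||u v].
- exact: pairing_linear.
- by move=> c x y; rewrite scaler0 addr0.
by rewrite pairing_pure // f0 mul0r.
Qed.
Lemma pairing0r f g w : linear f -> linear g -> g =1 (fun=> 0) ->
  pairing f g w = 0.
Proof.
move=> fl gl g0; move: w; apply: fps_tens_ext => [||u v].
- exact: pairing_linear.
- by move=> c x y; rewrite scaler0 addr0.
by rewrite pairing_pure // g0 mulr0.
Qed.

End Pairing.

Fact ucoproduct_lie_map : lie_map br (fun x => tinl (uin br x) + tinr (uin br x)).
Proof.
have [il im] := uin_lie_map br; split=> [c x y|x y].
  by rewrite il !linearP scalerDr addrACA.
rewrite im !rmorphB !rmorphM /=.
set a := uin br x; set b := uin br y.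
rewrite !mulrDl !mulrDr !tinlr !tinrl.
rewrite [_ + tinr a * _]addrC [_ + (_ + tpure b a)]addrACA.
rewrite [_ + tinr b * _]addrC [_ + (_ + tpure a b)]addrACA [tpure b a + _]addrC.
by rewrite [X in _ = _ + X]opprD [RHS]addrACA subrr addr0 opprD [RHS]addrACA.
Qed.

End TensorFps.

(** * The enveloping algebra of B^vee *)

Section Coproduct.
Variables (K : fieldType) (L : lmodType K) (br : L -> L -> L).
Local Notation U := (Uenv br).

Fact ucoproduct_linear : linear (@ucoproduct K L br).
Proof. by have [] := uliftP (ucoproduct_lie_map br). Qed.
HB.instance Definition _ := GRing.isLinear.Build K U (tens U U) _
  (@ucoproduct K L br) ucoproduct_linear.
Fact ucoproduct_monoid : monoid_morphism (@ucoproduct K L br).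
Proof. by have [] := uliftP (ucoproduct_lie_map br). Qed.
HB.instance Definition _ := GRing.isMonoidMorphism.Build U (tens U U)
  (@ucoproduct K L br) ucoproduct_monoid.
Lemma ucoproduct_uin x : ucoproduct (uin br x) = tinl (uin br x) + tinr (uin br x).
Proof. by have [_ _ _ h] := uliftP (ucoproduct_lie_map br); apply: h. Qed.

Fact ucounit_linear : linear (@ucounit K L br : U -> K^o).
Proof. by have [] := uliftP (lie_map0 br). Qed.
HB.instance Definition _ := GRing.isLinear.Build K U K^o _
  (@ucounit K L br : U -> K^o) ucounit_linear.
Fact ucounit_monoid : monoid_morphism (@ucounit K L br : U -> K^o).
Proof. by have [] := uliftP (lie_map0 br). Qed.
HB.instance Definition _ := GRing.isMonoidMorphism.Build U K^o
  (@ucounit K L br : U -> K^o) ucounit_monoid.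
Lemma ucounit_uin x : ucounit (uin br x) = 0.
Proof. by have [_ _ _ h] := uliftP (lie_map0 br); apply: h. Qed.

Lemma uenv_ind (I : Type) (g : I -> L) (P : U -> Prop) :
    (forall x : L, exists s : seq (K * I), x = \sum_(t <- s) t.1 *: g t.2) ->
    P 1 -> (forall c u v, P u -> P v -> P (c *: u + v)) ->
    (forall i u, P u -> P (uin br (g i) * u)) ->
  forall u, P u.
Proof.
move=> sp P1 PL Pg u.
have P0 : P 0 by have := PL (-1) _ _ P1 P1; rewrite scaleN1r addNr.
(* By uniqueness the identity of U is the lift of [uin], which writes u as the sum of words given by
   its own representative. *)
have -> : u = ueval (uin br) (urepr u).
  exact: (@ulift_unique K L br U (uin br) idfun (uin_lie_map br) (fun=> erefl) u).
rewrite /ueval; elim: (urepr u) => [|t s IH]; first by rewrite big_nil.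
rewrite big_cons; apply: (PL _ _ _ _ IH); elim: t.2 => [|x w IHw]; first by rewrite big_nil.
rewrite big_cons; have [r ->] := sp x.
have [ul _] := uin_lie_map br; rewrite lin_sum // mulr_suml.
elim: r => [|y r IHr]; first by rewrite big_nil.
by rewrite big_cons linZ // -scalerAl; apply: (PL _ _ _ _ IHr); apply: Pg.
Qed.
End Coproduct.

(** * Generators of U(B^vee): a Heisenberg algebra with centre E_1N, graded by H_1N *)

Section Generators.
Variables (K : fieldType) (n : nat).
Local Notation N := n.+2.
Local Notation U := (UB K N).
Local Notation E := (Emx K N).

Definition uh : U := umx (Hmx K N).
Definition ue : U := umx (E 1 N).
Definition ua (j : 'I_n) : U := umx (E 1 j.+2).
Definition ub (j : 'I_n) : U := umx (E j.+2 N).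

Lemma umx_linear : linear (@umx K N).
Proof.
have [ul _] := uin_lie_map (@Bvee_br K N).
by move=> c x y; rewrite /umx linearP ul.
Qed.

Lemma umxM x y : x \in Bvee K N -> y \in Bvee K N ->
  umx x * umx y = umx y * umx x + umx (x *m y - y *m x).
Proof.
move=> xB yB; have [_ um] := uin_lie_map (@Bvee_br K N).
rewrite /umx; have -> : vsproj (Bvee K N) (x *m y - y *m x) =
    Bvee_br (vsproj (Bvee K N) x) (vsproj (Bvee K N) y).
  by rewrite /Bvee_br !vsprojK.
by rewrite um addrC subrK.
Qed.

Lemma mid_index (j : 'I_n) : (1 < j.+2 < N)%N.
Proof. by rewrite /= !ltnS ltn_ord. Qed.

Lemma Hmx_in : Hmx K N \in Bvee K N.
Proof. by apply: memv_span; rewrite inE eqxx. Qed.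
Lemma E1N_in : E 1 N \in Bvee K N.
Proof. by apply: memv_span; rewrite !inE eqxx orbT. Qed.
Lemma E1j_in (j : 'I_n) : E 1 j.+2 \in Bvee K N.
Proof.
apply: memv_span; rewrite !inE mem_cat (map_f (E 1)) ?orbT //.
by rewrite mem_index_iota mid_index.
Qed.
Lemma EjN_in (j : 'I_n) : E j.+2 N \in Bvee K N.
Proof.
apply: memv_span; rewrite !inE mem_cat (map_f (E^~ N)) ?orbT //.
by rewrite mem_index_iota mid_index.
Qed.

Let ordE (j : 'I_n) : (j.+2 == N) = false.
Proof. by rewrite !eqSS ltn_eqF. Qed.
Let ordE' (j : 'I_n) : (N == j.+2) = false.
Proof. by rewrite eq_sym ordE. Qed.
Let ordle (j : 'I_n) : (0 < j.+2 <= N)%N.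
Proof. by rewrite /= !ltnS ltnW. Qed.

Ltac mxcomm :=
  rewrite umxM ?Hmx_in ?E1N_in ?E1j_in ?EjN_in // /Hmx ?mulmxBl ?mulmxBr;
  rewrite !mul_Emx ?ordle ?leqnn // ?ordE ?ordE' ?eqxx ?scale0r ?scale1r ?subr0 ?sub0r ?opprK.

Lemma uhe : uh * ue = ue * uh + ue *+ 2.
Proof.
rewrite /uh /ue; mxcomm; rewrite -mulr2n -(linMn umx_linear) //.
Qed.
Lemma uha j : uh * ua j = ua j * uh + ua j.
Proof. by rewrite /uh /ua; mxcomm; rewrite /= ?scale0r ?subr0. Qed.
Lemma uhb j : uh * ub j = ub j * uh + ub j.
Proof. by rewrite /uh /ub; mxcomm; rewrite /= ?scale0r ?subr0 ?sub0r ?opprK ?add0r. Qed.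
Lemma uaa i j : ua i * ua j = ua j * ua i.
Proof. by rewrite /ua; mxcomm; rewrite /= ?scale0r ?subr0 lin0 ?addr0 //; exact: umx_linear. Qed.
Lemma ubb i j : ub i * ub j = ub j * ub i.
Proof. by rewrite /ub; mxcomm; rewrite /= ?scale0r ?subr0 lin0 ?addr0 //; exact: umx_linear. Qed.
Lemma uae j : ua j * ue = ue * ua j.
Proof. by rewrite /ua /ue; mxcomm; rewrite /= ?scale0r ?subr0 lin0 ?addr0 //; exact: umx_linear. Qed.
Lemma ube j : ub j * ue = ue * ub j.
Proof. by rewrite /ub /ue; mxcomm; rewrite /= ?scale0r ?subr0 lin0 ?addr0 //; exact: umx_linear. Qed.
Lemma uab i j : ua i * ub j = ub j * ua i + ue *+ (i == j).
Proof.
rewrite /ua /ub /ue; mxcomm; congr (_ + _); rewrite !eqSS /= ?scale0r ?subr0.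
by rewrite linZ ?scaler_nat //; exact: umx_linear.
Qed.

Definition ugen (i : bool + bool * 'I_n) : U :=
  match i with
  | inl c => if c then uh else ue
  | inr (c, j) => if c then ua j else ub j
  end.

Lemma ugen_ind (P : U -> Prop) :
    P 1 -> (forall c u v, P u -> P v -> P (c *: u + v)) ->
    (forall i u, P u -> P (ugen i * u)) ->
  forall u, P u.
Proof.
move=> P1 PL Pg.
pose g (i : 'I_(size (Bvee_basis K N))) := vsproj (Bvee K N) (Bvee_basis K N)`_i.
apply: (@uenv_ind K _ (@Bvee_br K N) _ g) => // [x|i u Pu].
  have /(@coord_span _ _ _ (in_tuple (Bvee_basis K N))) e := subvsP x.
  exists [seq (coord (in_tuple (Bvee_basis K N)) i (vsval x), i) | i <- enum 'I_(size (Bvee_basis K N))].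
  rewrite big_map big_enum /= -[LHS]vsvalK {1}e linear_sum.
  by apply: eq_bigr => i _; rewrite linearZ_LR.
have : (Bvee_basis K N)`_i \in Bvee_basis K N by rewrite mem_nth.
rewrite /g -/(umx _); move: (_`_i) => M; rewrite /Bvee_basis !inE mem_cat.
have H k : k \in index_iota 2 N -> exists j : 'I_n, k = j.+2.
  rewrite mem_index_iota; case: k => [|[|k]] //= kN.
  by exists (Ordinal (kN : (k < n)%N)).
case/or4P=> [/eqP->|/eqP->|/mapP[k /H[j ->] ->]|/mapP[k /H[j ->] ->]].
- exact: (Pg (inl true)).
- exact: (Pg (inl false)).
- exact: (Pg (inr (true, j))).
- exact: (Pg (inr (false, j))).
Qed.

End Generators.

(** * Conjugation by the twist *)

Section TwistAlgebra.
Variables (K : fieldType) (n : nat) (U T : algType K).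
Variables (uh ue : U) (ua ub : 'I_n -> U).
Local Notation A := (fps U).
Hypotheses (uhe : uh * ue = ue * uh + ue *+ 2)
  (uha : forall j, uh * ua j = ua j * uh + ua j)
  (uhb : forall j, uh * ub j = ub j * uh + ub j)
  (uaa : forall i j, ua i * ua j = ua j * ua i)
  (ubb : forall i j, ub i * ub j = ub j * ub i)
  (uae : forall j, ua j * ue = ue * ua j)
  (ube : forall j, ub j * ue = ue * ub j)
  (uab : forall i j, ua i * ub j = ub j * ua i + ue *+ (i == j)).
Hypothesis char0 : forall k, k.+1%:R != 0 :> K.

Let h : A := fpsC uh.
Let e : A := fpsC ue.
Let a j : A := fpsC (ua j).
Let b j : A := fpsC (ub j).
Local Notation at_ := (fps_at ue).
Local Notation slog := (slog K).
(** [sigma] over an abstract algebra: this section works from the commutation relations and from two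
    commuting images of U in T; [twistE] identifies the outcome with the concrete twist. *)
Definition tsigma : A := fpsC (2%:R^-1 : K) *: fps_ln1p (fpsX (fpsC (ue *+ 2))).
Local Notation s := tsigma.
Definition exp_sigma : A := fps_exp s.
Definition exp_sigmaN : A := fps_exp (- s).
Definition exp_sigmaN2 : A := fps_exp (- (s *+ 2)).

Lemma sigma_at : s = at_ slog.
Proof.
rewrite /tsigma /slog fps_at_coefZ; congr (_ *: _).
rewrite fps_at_ln1p; congr fps_ln1p.
rewrite fpsCMn fpsXMn -fps_atX -rmorphMn; congr (at_ _).
by rewrite -fpsXMn; congr fpsX; rewrite -[1]/(fpsC 1) -fpsCMn.
Qed.

Lemma sigma0 : s 0%N = 0.
Proof. by rewrite sigma_at fps_at0 slog0 // scale0r. Qed.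

Lemma e1_at : exp_sigma = at_ (fps_exp slog).
Proof. by rewrite /exp_sigma sigma_at fps_at_exp. Qed.
Lemma e1'_at : exp_sigmaN = at_ (fps_exp (- slog)).
Proof. by rewrite /exp_sigmaN sigma_at -rmorphN fps_at_exp. Qed.
Lemma em2_at : exp_sigmaN2 = at_ (fps_exp (- (slog *+ 2))).
Proof. by rewrite /exp_sigmaN2 sigma_at -rmorphMn -rmorphN fps_at_exp. Qed.

Lemma fps_at_at f g : at_ f * at_ g = at_ g * at_ f.
Proof. by rewrite -!rmorphM mulrC. Qed.
Lemma ua_fps_atC j f : a j * at_ f = at_ f * a j.
Proof.
apply: fps_at_comm => -[|k]; rewrite /= ?mul0r ?mulr0 //; exact: uae.
Qed.
Lemma ub_fps_atC j f : b j * at_ f = at_ f * b j.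
Proof.
apply: fps_at_comm => -[|k]; rewrite /= ?mul0r ?mulr0 //; exact: ube.
Qed.
Lemma ue_fps_atC f : e * at_ f = at_ f * e.
Proof. by apply: fps_at_comm => -[|k]; rewrite /= ?mul0r ?mulr0. Qed.

Lemma exp_sigmaK : exp_sigma * exp_sigmaN = 1.
Proof. exact: fps_expN char0 _ sigma0. Qed.
Lemma exp_sigmaNK : exp_sigmaN * exp_sigma = 1.
Proof. by rewrite e1_at e1'_at fps_at_at -e1_at -e1'_at exp_sigmaK. Qed.

Lemma em2E : exp_sigmaN2 = exp_sigmaN * exp_sigmaN.
Proof.
have s0 : (- s) 0%N = 0 by rewrite fcoefN sigma0 oppr0.
by rewrite /exp_sigmaN -fps_expD // -mulr2n mulNrn.
Qed.
Lemma em2_e1 : exp_sigmaN2 * exp_sigma = exp_sigmaN.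
Proof. by rewrite em2E -mulrA exp_sigmaNK mulr1. Qed.

Lemma e2E : exp_sigma * exp_sigma = 1 + fpsX e *+ 2.
Proof.
rewrite /exp_sigma -fps_expD ?sigma0 // -mulr2n sigma_at -rmorphMn -fps_at_exp exp_slog //.
by rewrite rmorphD rmorph1 rmorphMn /= fps_atX.
Qed.
Lemma e2K : exp_sigma * exp_sigma * exp_sigmaN2 = 1.
Proof. by rewrite em2E mulrA -[exp_sigma * exp_sigma * _]mulrA exp_sigmaK mulr1 exp_sigmaK. Qed.
(** A restatement of e^(2 sigma) = 1 + 2 xi E_1N. It absorbs the explicit xi E_1N produced by
    commutators into exponentials of sigma, where cancellations become visible. *)
Lemma em2_sub : fpsX e *+ 2 * exp_sigmaN2 = 1 - exp_sigmaN2.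
Proof.
have -> : fpsX e *+ 2 = exp_sigma * exp_sigma - 1 by rewrite e2E addrC addKr.
by rewrite mulrBl mul1r e2K.
Qed.

Lemma comm_h_at f : h * at_ f = at_ f * h + at_ (theta f *+ 2).
Proof. by apply: fps_at_theta; exact: uhe. Qed.

(** On series in xi E_1N the commutator with h is 2 theta, and theta [slog] = t e^(-2 slog);
    [em2_sub] does the rest. *)
Lemma comm_h_sigma : h * s = s * h + (1 - exp_sigmaN2).
Proof.
rewrite sigma_at comm_h_at; congr (_ + _).
rewrite theta_slogE // -mulrnAl rmorphM rmorphMn /= fps_atX -em2_at.
exact: em2_sub.
Qed.

Lemma comm_h_em2 : h * exp_sigmaN2 = exp_sigmaN2 * h - ((1 - exp_sigmaN2) * exp_sigmaN2) *+ 2.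
Proof.
rewrite {1 2}em2_at comm_h_at; congr (_ + _).
rewrite theta_exp //; last by rewrite fcoefN fcoefMn slog0 // mul0rn oppr0.
have -> : theta (- (slog *+ 2)) = - (theta slog *+ 2).
  by apply: fpsP => k; rewrite coef_theta !fcoefN !fcoefMn coef_theta mulNrn mulrnAC.
rewrite mulNr mulNrn rmorphN rmorphMn rmorphM rmorphMn /= -em2_at theta_slogE //.
congr (- (_ * _ *+ 2)); rewrite rmorphM /= fps_atX -mulrnAl -em2_at.
by rewrite em2_sub.
Qed.

Local Notation p j := (b j * exp_sigmaN2).

Lemma comm_h_p j : h * p j = p j * h - p j + (p j * exp_sigmaN2) *+ 2.
Proof.
have hb : h * b j = b j * h + b j by rewrite /h /b -!fpsCM uhb fpsCD.
rewrite mulrA hb mulrDl -mulrA comm_h_em2 mulrBr mulrnAr mulrBl mul1r mulrBr.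
rewrite !mulrA -!addrA; congr (_ + _).
rewrite mulrnBl opprB [X in _ - X]mulr2n opprD addrA subrK addrC //.
Qed.

Lemma fpsC_uaC i j : a i * a j = a j * a i.
Proof. by rewrite /a -!fpsCM uaa. Qed.
Lemma fpsC_ubC i j : b i * b j = b j * b i.
Proof. by rewrite /b -!fpsCM ubb. Qed.
Lemma fpsC_uaeC j : a j * e = e * a j.
Proof. by rewrite /a /e -!fpsCM uae. Qed.
Lemma fpsC_ubeC j : b j * e = e * b j.
Proof. by rewrite /b /e -!fpsCM ube. Qed.
Lemma fpsC_uab i j : a i * b j = b j * a i + e *+ (i == j).
Proof. by rewrite /a /b /e -!fpsCM uab fpsCD fpsCMn. Qed.
Lemma ub_piC i j : b i * p j = p j * b i.
Proof. by rewrite mulrA fpsC_ubC -!mulrA em2_at ub_fps_atC. Qed.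
Lemma pi_piC i j : p i * p j = p j * p i.
Proof. by rewrite mulrA -ub_piC -!mulrA [exp_sigmaN2 * (_ * _)]mulrA em2_at -ub_fps_atC !mulrA fpsC_ubC. Qed.
Lemma pi_ueC j : p j * e = e * p j.
Proof. by rewrite -mulrA em2_at -ue_fps_atC mulrA fpsC_ubeC mulrA. Qed.
Lemma pi_fps_atC j f : p j * at_ f = at_ f * p j.
Proof. by rewrite -mulrA em2_at fps_at_at mulrA ub_fps_atC mulrA. Qed.
Lemma ua_piC i j : a i * p j = p j * a i + (e * exp_sigmaN2) *+ (i == j).
Proof. by rewrite mulrA fpsC_uab mulrDl -mulrA em2_at ua_fps_atC mulrA mulrnAl. Qed.

Variables il ir : {lrmorphism U -> T}.
Hypothesis lrC : forall u v, ir v * il u = il u * ir v.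
Local Notation l := (fps_map il).
Local Notation r := (fps_map ir).

Lemma fps_map_rl x y : r y * l x = l x * r y.
Proof.
apply: fpsP => k /=; rewrite (reindex_inj rev_ord_inj) /=.
by apply: eq_bigr => i _; rewrite subSS subKn -1?ltnS.
Qed.

Lemma fps_map_lM x y : l (x * y) = l x * l y. Proof. exact: rmorphM. Qed.
Lemma fps_map_rM x y : r (x * y) = r x * r y. Proof. exact: rmorphM. Qed.
Lemma fps_map_lD x y : l (x + y) = l x + l y. Proof. exact: rmorphD. Qed.
Lemma fps_map_lB x y : l (x - y) = l x - l y. Proof. exact: rmorphB. Qed.
Lemma fps_map_lMn x k : l (x *+ k) = l x *+ k. Proof. exact: rmorphMn. Qed.
Lemma fps_map_l1 : l 1 = 1. Proof. exact: rmorph1. Qed.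
Lemma fps_map_rD x y : r (x + y) = r x + r y. Proof. exact: rmorphD. Qed.
Lemma fps_map_rB x y : r (x - y) = r x - r y. Proof. exact: rmorphB. Qed.
Lemma fps_map_rMn x k : r (x *+ k) = r x *+ k. Proof. exact: rmorphMn. Qed.
Lemma fps_map_r1 : r 1 = 1. Proof. exact: rmorph1. Qed.

Lemma fps_map_lrM x y z w : l x * r y * (l z * r w) = l (x * z) * r (y * w).
Proof. by rewrite mulrA -[_ * r y * _]mulrA fps_map_rl mulrA -fps_map_lM -mulrA -fps_map_rM. Qed.

Let X2 : fps T := \sum_(j < n) fpsX (l (a j) * r (p j) *+ 2).
Let G1 : fps T := fps_exp (l h * r s).
Definition ttwist : fps T := G1 * \prod_(j < n) fps_exp (fpsX (l (a j) * r (p j) *+ 2)).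
Let G2 : fps T := fps_exp X2.

(** The a_j commute with each other and so do the p_j, hence the exponents commute and merge into
    one. Conjugation by the twist becomes conjugation by [G2] followed by [G1]. *)
Lemma ttwistE : ttwist = G1 * G2.
Proof.
congr (_ * _); apply: fps_exp_sum => // i j.
rewrite -!fpsX_mull -!fpsX_mulr; congr (fpsX (fpsX _)).
by rewrite !mulrnAl !mulrnAr !fps_map_lrM fpsC_uaC pi_piC.
Qed.

Let X20 : X2 0%N = 0.
Proof. by rewrite fcoef_sum big1. Qed.
Let X10 : (l h * r s) 0%N = 0.
Proof. by rewrite fcoefM0 !fcoef_map sigma0 // rmorph0 mulr0. Qed.

Lemma ttwist_conj u v w : G2 * u = v * G2 -> G1 * v = w * G1 ->
  ttwist * u = w * ttwist.
Proof. by move=> e2 exp_sigma; rewrite ttwistE -mulrA e2 mulrA exp_sigma mulrA. Qed.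

(** An element x of weight k under h satisfies (h (x) sigma)(x (x) 1) = (x (x) 1)(h (x) sigma + k (1
    (x) sigma)); exponentiating, the second leg acquires e^(k sigma). *)
Lemma G1_l x k : h * x = x * h + x *+ k -> G1 * l x = l x * r (exp_sigma ^+ k) * G1.
Proof.
move=> hx.
have c : r (exp_sigma ^+ k) * G1 = G1 * r (exp_sigma ^+ k).
  apply/esym/fps_exp_intertwine => //.
  rewrite -mulrA -fps_map_rM [RHS]mulrA fps_map_rl -mulrA -fps_map_rM.
  by congr (_ * r _); rewrite e1_at sigma_at -rmorphXn fps_at_at.
rewrite -mulrA c.
have E : r (exp_sigma ^+ k) = fps_exp (r s *+ k).
  elim: k {hx c} => [|k IH]; first by rewrite mulr0n fps_exp0 expr0 fps_map_r1.
  rewrite exprS fps_map_rM IH mulrS fps_expD // ?fps_map_exp //.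
  - by rewrite fcoef_map sigma0 // rmorph0.
  - by rewrite fcoefMn fcoef_map sigma0 // rmorph0 mul0rn.
  - by rewrite mulrnAr mulrnAl.
rewrite E -fps_expD //.
- apply: fps_exp_intertwine => //.
    by rewrite fcoefD X10 add0r fcoefMn fcoef_map sigma0 // rmorph0 mul0rn.
  rewrite -mulrA fps_map_rl mulrA -fps_map_lM hx fps_map_lD fps_map_lMn mulrDl mulrDr.
  by rewrite mulrnAl mulrnAr mulrA fps_map_lM.
- by rewrite fcoefMn fcoef_map sigma0 // rmorph0 mul0rn.
- by rewrite mulrnAr mulrnAl mulrA fps_map_rl -!mulrA.
Qed.

Lemma G1_r x : s * x = x * s -> G1 * r x = r x * G1.
Proof.
move=> sx; apply: fps_exp_intertwine => //.
by rewrite -mulrA -fps_map_rM sx fps_map_rM mulrA -fps_map_rl mulrA.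
Qed.

Lemma ttwist_e :
  ttwist * (l e + r e) = (l e * r (exp_sigma * exp_sigma) + r e) * ttwist.
Proof.
apply: (@ttwist_conj _ (l e + r e)).
  apply: fps_exp_intertwine => //; rewrite mulr_suml mulr_sumr.
  apply: eq_bigr => j _; rewrite -fpsX_mull -fpsX_mulr; congr fpsX.
  rewrite mulrnAl mulrnAr mulrDl mulrDr; congr ((_ + _) *+ 2).
    by rewrite -mulrA fps_map_rl !mulrA -!fps_map_lM fpsC_uaeC.
  by rewrite -mulrA -fps_map_rM pi_ueC fps_map_rM mulrA -fps_map_rl mulrA.
rewrite mulrDr mulrDl (@G1_l e 2) ?G1_r //.
  by rewrite sigma_at ue_fps_atC.
by rewrite /h /e -!fpsCM uhe fpsCD fpsCMn.
Qed.

Lemma ttwist_a j :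
  ttwist * (l (a j) + r (a j)) = (l (a j) * r exp_sigmaN + r (a j)) * ttwist.
Proof.
(* Conjugation by [G2] adds -2 xi E_1j (x) E_1N e^(-2 sigma), which comes from [E_jN, E_1j] = - E_1N
   in the second leg. By [em2_sub] this turns E_1j (x) 1 into E_1j (x) e^(-2 sigma), and [G1] then
   contributes e^sigma. *)
apply: (@ttwist_conj _ (l (a j) * r exp_sigmaN2 + r (a j))).
  have -> : l (a j) * r exp_sigmaN2 + r (a j) =
      l (a j) + r (a j) - l (a j) * r (fpsX e *+ 2 * exp_sigmaN2).
    rewrite em2_sub // fps_map_rB fps_map_r1 mulrBr mulr1.
    by rewrite opprB [RHS]addrC addrA subrK.
  apply: fps_exp_shift => //.
    rewrite mulr_suml mulr_sumr.
    rewrite [LHS](bigD1 j) // [X in _ = X + _](bigD1 j) //=.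
    set S1 := \sum_(i < n | _) _; set S2 := \sum_(i < n | _) _.
    have -> : S1 = S2.
      apply: eq_bigr => i ij; rewrite -fpsX_mull -fpsX_mulr; congr fpsX.
      rewrite mulrnAl mulrnAr mulrDl mulrDr; congr ((_ + _) *+ 2).
        by rewrite -mulrA fps_map_rl !mulrA -!fps_map_lM fpsC_uaC.
      rewrite -mulrA -fps_map_rM; have := ua_piC j i; rewrite eq_sym (negPf ij) mulr0n addr0.
      by move=> <-; rewrite fps_map_rM mulrA -fps_map_rl mulrA.
    rewrite addrAC; congr (_ + _); rewrite -fpsX_mull -fpsX_mulr.
    have -> : fpsX e *+ 2 * exp_sigmaN2 = fpsX (e * exp_sigmaN2 *+ 2) by rewrite -fpsXMn -fpsX_mull mulrnAl.
    rewrite fps_mapX -fpsX_mulr -fpsXN -fpsXD; congr fpsX.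
    rewrite mulrnAl mulrnAr fps_map_rMn mulrnAr -mulrnBl; congr (_ *+ 2).
    rewrite mulrDl mulrDr -addrA; congr (_ + _).
      by rewrite -mulrA fps_map_rl !mulrA.
    rewrite -mulrA -fps_map_rM; have := ua_piC j j; rewrite eqxx mulr1n => /(canLR (addrK _)) <-.
    by rewrite fps_map_rB mulrBr; congr (_ - _); rewrite (fps_map_rM (a j)) [RHS]mulrA fps_map_rl -mulrA.
  rewrite mulrN mulNr; congr (- _); rewrite mulr_suml mulr_sumr.
  apply: eq_bigr => i _; rewrite -fpsX_mull -fpsX_mulr; congr fpsX.
  rewrite mulrnAl mulrnAr !fps_map_lrM fpsC_uaC; congr (_ * r _ *+ 2).
  have -> : fpsX e *+ 2 * exp_sigmaN2 = at_ (1 - fps_exp (- (slog *+ 2))).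
    by rewrite em2_sub // rmorphB rmorph1 em2_at.
  by rewrite pi_fps_atC.
rewrite mulrDr mulrDl mulrA (@G1_l (a j) 1); last first.
  by rewrite /h /a -!fpsCM uha fpsCD.
rewrite expr1 -[_ * G1 * _]mulrA G1_r; last by rewrite sigma_at em2_at fps_at_at.
rewrite G1_r; last by rewrite sigma_at ua_fps_atC.
congr (_ + _); rewrite mulrA -[_ * r exp_sigma * _]mulrA -fps_map_rM; congr (_ * r _ * _).
by rewrite e1_at em2_at fps_at_at -e1_at -em2_at em2_e1.
Qed.

Lemma ttwist_b j :
  ttwist * (l (b j) + r (b j)) = (l (b j) * r exp_sigma + l (exp_sigma * exp_sigma) * r (b j)) * ttwist.
Proof.
(* The commutator [E_1j, E_jN] = E_1N now occurs in the first leg. [G1] supplies e^(2 sigma), which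
   cancels the e^(-2 sigma) of p_j; the extra term 2 xi E_1N (x) E_jN completes 1 (x) E_jN to e^(2
   sigma) (x) E_jN. *)
apply: (@ttwist_conj _ (l (b j) + r (b j) + fpsX (l e * r (p j) *+ 2))).
  apply: fps_exp_shift => //.
    rewrite mulr_suml mulr_sumr.
    rewrite [LHS](bigD1 j) // [X in _ = X + _](bigD1 j) //=.
    set S1 := \sum_(i < n | _) _; set S2 := \sum_(i < n | _) _.
    have -> : S1 = S2.
      apply: eq_bigr => i ij; rewrite -fpsX_mull -fpsX_mulr; congr fpsX.
      rewrite mulrnAl mulrnAr mulrDl mulrDr; congr ((_ + _) *+ 2).
        rewrite -mulrA fps_map_rl !mulrA -!fps_map_lM; have := fpsC_uab i j.
        by rewrite (negPf ij) mulr0n addr0 => ->.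
      by rewrite -mulrA -fps_map_rM -ub_piC fps_map_rM mulrA -fps_map_rl mulrA.
    rewrite addrAC; congr (_ + _); rewrite -fpsX_mull -fpsX_mulr -fpsXD; congr fpsX.
    rewrite mulrnAl mulrnAr -mulrnDl; congr (_ *+ 2).
    rewrite mulrDl mulrDr addrAC; congr (_ + _).
      rewrite -mulrA fps_map_rl !mulrA -!fps_map_lM; have := fpsC_uab j j.
      by rewrite eqxx mulr1n => ->; rewrite fps_map_lD mulrDl.
    by rewrite -mulrA -fps_map_rM -ub_piC fps_map_rM mulrA -fps_map_rl mulrA.
  rewrite mulr_suml mulr_sumr; apply: eq_bigr => i _.
  rewrite -!fpsX_mull -!fpsX_mulr; congr (fpsX (fpsX _)).
  by rewrite !mulrnAl !mulrnAr !fps_map_lrM fpsC_uaeC pi_piC.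
rewrite !mulrDr !mulrDl (@G1_l (b j) 1); last first.
  by rewrite /h /b -!fpsCM uhb fpsCD.
rewrite expr1 G1_r; last by rewrite sigma_at ub_fps_atC.
rewrite -addrA; congr (_ + _).
rewrite e2E // fps_map_lD fps_map_l1 mulrDl mulrDl mul1r; congr (_ + _).
rewrite -fpsX_mulr fps_map_lMn fps_mapX mulrnAr mulrA (@G1_l e 2); last first.
  by rewrite /h /e -!fpsCM uhe fpsCD fpsCMn.
rewrite -[_ * G1 * _]mulrA G1_r; last by rewrite sigma_at -pi_fps_atC.
have E : r (exp_sigma ^+ 2) * r (p j) = r (b j).
  by rewrite -fps_map_rM em2_at ub_fps_atC mulrA -em2_at expr2 e2K // mul1r.
by rewrite mulrA -[_ * r (p j)]mulrA E !mulrnAl -!fpsX_mull fpsXMn.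
Qed.

Lemma ttwist_h :
  ttwist * (l h + r h) =
  (l h * r exp_sigmaN2 + r h - \sum_(j < n) fpsX (l (a j) * r (p j * exp_sigmaN) *+ 4)) * ttwist.
Proof.
(* The commutator in the first leg gives -2 xi a_j (x) p_j, the one in the second leg 2 xi a_j (x)
   (p_j - 2 p_j e^(-2 sigma)) by [comm_h_p]. The terms in p_j cancel, which leaves the factor 4. *)
pose v := - \sum_(j < n) fpsX (l (a j) * r (p j * exp_sigmaN2) *+ 4) : fps T.
apply: (@ttwist_conj _ (l h + r h + v)).
  apply: fps_exp_shift => //.
    rewrite /v mulr_suml mulr_sumr -sumrN -big_split; apply: eq_bigr => j _ /=.
    rewrite -fpsX_mull -fpsX_mulr -fpsXN -fpsXD; congr fpsX.
    have -> : l (a j) * r (p j * exp_sigmaN2) *+ 4 = l (a j) * r (p j * exp_sigmaN2) *+ 2 *+ 2.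
      by rewrite -mulrnA.
    rewrite mulrnAl mulrnAr -mulrnBl; congr (_ *+ 2).
    rewrite mulrDl mulrDr.
    have ha : h * a j = a j * h + a j by rewrite /h /a -!fpsCM uha fpsCD.
    rewrite -mulrA fps_map_rl mulrA -fps_map_lM; have := ha => /(canLR (addrK _)) <-.
    rewrite -mulrA -fps_map_rM.
    have -> : p j * h = h * p j + p j - p j * exp_sigmaN2 *+ 2.
      by rewrite comm_h_p // [_ + _ + p j]addrAC subrK addrK.
    rewrite fps_map_lB fps_map_rB fps_map_rD mulrBl mulrBr mulrDr (fps_map_lM h) (fps_map_rM h) fps_map_rMn mulrnAr.
    rewrite addrA; congr (_ - _).
    rewrite [r h * (_ * _)]mulrA fps_map_rl -!mulrA [X in _ + X = _]addrC addrA.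
    by rewrite subrK.
  rewrite /v mulrN mulNr; congr (- _); rewrite [LHS]mulr_suml [RHS]mulr_sumr.
  apply: eq_bigr => i _; rewrite mulr_sumr mulr_suml; apply: eq_bigr => j _.
  rewrite -!fpsX_mull -!fpsX_mulr; congr (fpsX (fpsX _)).
  rewrite !mulrnAl !mulrnAr !fps_map_lrM fpsC_uaC mulrnAC; congr (_ * r _ *+ _ *+ _).
  rewrite mulrA pi_piC -[LHS]mulrA -[RHS]mulrA; congr (_ * _).
  by have := pi_fps_atC i (fps_exp (- (slog *+ 2))); rewrite -em2_at.
rewrite !mulrDr !mulrDl; congr (_ + _).
  have -> : G1 * l h = l h * G1.
    apply: fps_exp_intertwine => //.
    by rewrite -mulrA fps_map_rl mulrA.
  (* The commutator of h (x) sigma with 1 (x) h is -h (x) (1 - e^(-2 sigma)); added to h (x) 1 it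
     leaves h (x) e^(-2 sigma). *)
  have -> : G1 * r h = (r h - l h * r (1 - exp_sigmaN2)) * G1.
    apply: fps_exp_shift => //.
      rewrite -mulrA -fps_map_rM; have := comm_h_sigma => /(canLR (addrK _)) <-.
      by rewrite fps_map_rB mulrBr; congr (_ - _); rewrite (fps_map_rM h) [RHS]mulrA fps_map_rl -mulrA.
    rewrite mulrN mulNr !fps_map_lrM; congr (- (_ * r _)).
    by rewrite sigma_at em2_at -[1](rmorph1 at_) -rmorphB fps_at_at.
  rewrite mulrBl addrCA addrC; congr (_ + _); rewrite -mulrBl; congr (_ * _).
  by rewrite fps_map_rB fps_map_r1 mulrBr mulr1 opprB addrC subrK.
rewrite mulrN mulNr; congr (- _); rewrite mulr_sumr mulr_suml.
apply: eq_bigr => j _; rewrite -fpsX_mull -fpsX_mulr; congr fpsX.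
rewrite mulrnAl mulrnAr mulrA (@G1_l (a j) 1); last first.
  by rewrite /h /a -!fpsCM uha fpsCD.
rewrite expr1 -[_ * G1 * _]mulrA G1_r; last first.
  by rewrite sigma_at mulrA -pi_fps_atC -!mulrA em2_at fps_at_at.
rewrite mulrA -[_ * r exp_sigma * _]mulrA -fps_map_rM; congr (_ * r _ * _ *+ 4).
have := pi_fps_atC j (fps_exp slog); rewrite -e1_at => E; rewrite mulrA -E -[LHS]mulrA; congr (_ * _).
rewrite e1_at em2_at fps_at_at -e1_at -em2_at em2_e1 //.
Qed.

Variable cop : {lrmorphism U -> T}.
Hypotheses (cop_h : cop uh = il uh + ir uh) (cop_e : cop ue = il ue + ir ue)
  (cop_a : forall j, cop (ua j) = il (ua j) + ir (ua j))
  (cop_b : forall j, cop (ub j) = il (ub j) + ir (ub j)).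

Definition tcop (x : A) : fps T := ttwist * fps_map cop x * fps_inv ttwist.

Let ttwist0 : ttwist 0%N = 1.
Proof. by rewrite ttwistE fcoefM0 !fps_exp_coef0 mulr1. Qed.
Let ttwistV : ttwist * fps_inv ttwist = 1.
Proof. exact: (fps_invr ttwist0).1. Qed.
Let ttwistVK : fps_inv ttwist * ttwist = 1.
Proof. exact: (fps_invr ttwist0).2. Qed.

Lemma tcop_linear : linear tcop.
Proof.
move=> c x y; rewrite /tcop linearP mulrDr mulrDl.
by rewrite -scalerAr -scalerAl.
Qed.
Lemma tcop1 : tcop 1 = 1.
Proof. by rewrite /tcop rmorph1 mulr1 ttwistV. Qed.
Lemma tcopM x y : tcop (x * y) = tcop x * tcop y.
Proof.
rewrite /tcop rmorphM; move: ttwistVK; move: (fps_inv ttwist) => V.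
move: ttwist => F VF; rewrite !mulrA -[_ * V * F]mulrA VF mulr1 //.
Qed.

Lemma tcopE x w : ttwist * fps_map cop x = w * ttwist -> tcop x = w.
Proof. by move=> E; rewrite /tcop E -mulrA ttwistV mulr1. Qed.

Lemma tcop_h :
  tcop h = l h * r exp_sigmaN2 + r h - \sum_(j < n) fpsX (l (a j) * r (p j * exp_sigmaN) *+ 4).
Proof. by apply: tcopE; rewrite fps_mapC cop_h fpsCD -ttwist_h !fps_mapC. Qed.
Lemma tcop_e : tcop e = l e * r (exp_sigma * exp_sigma) + r e.
Proof. by apply: tcopE; rewrite fps_mapC cop_e fpsCD -ttwist_e !fps_mapC. Qed.
Lemma tcop_a j : tcop (a j) = l (a j) * r exp_sigmaN + r (a j).
Proof. by apply: tcopE; rewrite fps_mapC cop_a fpsCD -ttwist_a !fps_mapC. Qed.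
Lemma tcop_b j : tcop (b j) = l (b j) * r exp_sigma + l (exp_sigma * exp_sigma) * r (b j).
Proof. by apply: tcopE; rewrite fps_mapC cop_b fpsCD -ttwist_b !fps_mapC. Qed.

Let tcop_coef0 (x : A) : x 0%N = 0 -> tcop x 0%N = 0.
Proof. by move=> x0; rewrite /tcop !fcoefM0 fcoef_map x0 rmorph0 mulr0 mul0r. Qed.

Lemma tcop_exp (x : A) : x 0%N = 0 -> tcop (fps_exp x) = fps_exp (tcop x).
Proof.
move=> x0; apply: tcopE; rewrite fps_map_exp; apply/esym.
apply: fps_exp_intertwine; first exact: tcop_coef0.
  by rewrite fcoef_map x0 rmorph0.
by rewrite /tcop -mulrA ttwistVK mulr1.
Qed.

(** By [tcop_e], e^(2 sigma) = 1 + 2 xi E_1N is group-like. So the doubles of both sides have the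
    same exponential, [fps_exp_inj] identifies them, and 2 is invertible. *)
Lemma tcop_sigma : tcop s = l s + r s.
Proof.
have s20 : (s *+ 2) 0%N = 0 by rewrite fcoefMn sigma0 // mul0rn.
have lr0 : (l s + r s) 0%N = 0.
  by rewrite fcoefD !fcoef_map sigma0 // !rmorph0 addr0.
have E : fps_exp (s *+ 2) = exp_sigma * exp_sigma by rewrite mulr2n fps_expD ?sigma0.
have : tcop (s *+ 2) = (l s + r s) *+ 2.
  apply: (fps_exp_inj (tcop_coef0 s20)).
    by rewrite fcoefMn lr0 mul0rn.
  rewrite -tcop_exp // E mulr2n fps_expD //.
  rewrite fps_expD ?fcoef_map ?sigma0 ?rmorph0 ?fps_map_rl //.
  rewrite -!fps_map_exp fps_map_lrM {1}e2E // (linD tcop_linear) tcop1.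
  rewrite (linMn tcop_linear) (lin_fpsX tcop_linear) tcop_e.
  set x := r (exp_sigma * exp_sigma); rewrite {1}[exp_sigma * exp_sigma]e2E // fps_map_lD fps_map_l1 mulrDl mul1r.
  rewrite {2}/x e2E // fps_map_rD fps_map_r1 !(fps_map_lMn, fps_map_rMn) !fps_mapX fpsXD mulrnDl fpsX_mull.
  by rewrite mulrnAl [X in 1 + X = _]addrC addrA.
rewrite (linMn tcop_linear) => E2; apply: fpsP => k.
have /eqP := congr1 (fun x : fps T => x k) E2.
rewrite !fcoefMn -subr_eq0 -mulrnBl -scaler_nat scaler_eq0.
by rewrite (negPf (char0 1)) subr_eq0 => /eqP.
Qed.

Lemma tcop_e1 : tcop exp_sigma = l exp_sigma * r exp_sigma.
Proof.
rewrite tcop_exp ?sigma0 // tcop_sigma fps_expD ?fcoef_map ?sigma0 ?rmorph0 ?fps_map_rl //.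
by rewrite -!fps_map_exp.
Qed.

Lemma tcop_e1' : tcop exp_sigmaN = l exp_sigmaN * r exp_sigmaN.
Proof.
have K1 : (l exp_sigmaN * r exp_sigmaN) * tcop exp_sigma = 1 by rewrite tcop_e1 fps_map_lrM exp_sigmaNK // fps_map_l1 fps_map_r1 mulr1.
by rewrite -[LHS]mul1r -K1 -mulrA -tcopM exp_sigmaK // tcop1 mulr1.
Qed.

Lemma tcop_p j : tcop (p j) = l (p j) * r exp_sigmaN + r (p j).
Proof.
rewrite tcopM em2E // tcopM tcop_e1' fps_map_lrM tcop_b mulrDl fps_map_lrM.
congr (_ + _); first by congr (_ * r _); rewrite mulrA exp_sigmaK // mul1r.
rewrite mulrA -[_ * r (b j) * _]mulrA fps_map_rl mulrA -fps_map_lM -mulrA -fps_map_rM.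
by rewrite -em2E // e2K // fps_map_l1 mul1r.
Qed.

End TwistAlgebra.

(** * The twisted coproduct of the generators x_i and pi_i *)

Section Twisting.
Variables (K : fieldType) (n : nat).
Local Notation N := n.+2.
Local Notation U := (UB K N).
Local Notation A := (fps U).
Local Notation T := (tens U U).
Local Notation l := (fps_map (@tinl K _ (@Bvee_br K N))).
Local Notation r := (fps_map (@tinr K _ (@Bvee_br K N))).
Local Notation D := (@twisted_coproduct K N).
Local Notation tD := (tcop (@uh K n) (@ue K n) (@ua K n) (@ub K n)
  (@tinl K _ (@Bvee_br K N)) (@tinr K _ (@Bvee_br K N)) (@ucoproduct K _ (@Bvee_br K N))).

Lemma twistE : twist K N = ttwist (@uh K n) (@ue K n) (@ua K n) (@ub K n)
  (@tinl K _ (@Bvee_br K N)) (@tinr K _ (@Bvee_br K N)).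
Proof.
rewrite /twist /ttwist fps_tpureE; congr (_ * _).
rewrite -{1}[2%N]add0n big_addn !subSS subn0 big_mkord.
by apply: eq_bigr => j _; rewrite fps_tpureE addn2 fpsXMn.
Qed.

Lemma twisted_coproductE a : D a = tD a.
Proof. by rewrite /twisted_coproduct twistE. Qed.

Fact twisted_coproduct_linear : linear D.
Proof. by move=> c a b; rewrite !twisted_coproductE; apply: tcop_linear. Qed.

Lemma counit_linear : linear (@counit K N : A -> fps (K^o)).
Proof. exact: (@fps_map_linear K U (K^o) (@ucounit K _ (@Bvee_br K N) : U -> K^o)). Qed.
Lemma counitM : {morph @counit K N : a b / a * b}.
Proof.
exact: (rmorphM (fps_map (@ucounit K _ (@Bvee_br K N) : U -> K^o))).
Qed.
Lemma counit1 : @counit K N 1 = 1.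
Proof.
exact: (rmorph1 (fps_map (@ucounit K _ (@Bvee_br K N) : U -> K^o))).
Qed.

Hypothesis char0 : forall k, k.+1%:R != 0 :> K.

Let lrC (u v : U) : tinr v * tinl u = tinl u * tinr v.
Proof. by rewrite tinlr tinrl. Qed.
Let cop_h : ucoproduct (@uh K n) = tinl (@uh K n) + tinr (@uh K n).
Proof. exact: ucoproduct_uin. Qed.
Let cop_e : ucoproduct (@ue K n) = tinl (@ue K n) + tinr (@ue K n).
Proof. exact: ucoproduct_uin. Qed.
Let cop_a j : ucoproduct (@ua K n j) = tinl (@ua K n j) + tinr (@ua K n j).
Proof. exact: ucoproduct_uin. Qed.
Let cop_b j : ucoproduct (@ub K n j) = tinl (@ub K n j) + tinr (@ub K n j).
Proof. exact: ucoproduct_uin. Qed.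

Let uhe := @uhe K n.
Let uha := @uha K n.
Let uhb := @uhb K n.
Let uaa := @uaa K n.
Let ubb := @ubb K n.
Let uae := @uae K n.
Let ube := @ube K n.
Let uab := @uab K n.

Ltac from_tcop L := rewrite ?twisted_coproductE; apply: L; assumption.

Lemma cop1 : D 1 = 1.
Proof. from_tcop tcop1. Qed.
Lemma copM x y : D (x * y) = D x * D y.
Proof. from_tcop tcopM. Qed.

Definition xg (i : 'I_n.+1) : A := xgen K N i.+1.
Definition pg (i : 'I_n.+1) : A := pgen K N i.+1.
Definition E1 : A := exp_sigma (@ue K n).
Definition E1' : A := exp_sigmaN (@ue K n).
Definition EE : A := fpsC (@ue K n).
Definition Em2 : A := E1' * E1'.
Definition at_ (f : fps (K^o)) : A := fps_at (@ue K n) f.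
Lemma atM f g : at_ (f * g) = at_ f * at_ g.
Proof. exact: (rmorphM (fps_at (@ue K n))). Qed.
Lemma at1 : at_ 1 = 1.
Proof. exact: (rmorph1 (fps_at (@ue K n))). Qed.
Lemma atC f g : at_ f * at_ g = at_ g * at_ f.
Proof. by rewrite -!atM mulrC. Qed.
Lemma at_EE f : EE * at_ f = at_ f * EE.
Proof. exact: ue_fps_atC. Qed.
Lemma at_split f : at_ f = (fpsC (f 0%N : K))%:A + at_ (fps_divX f) * fpsX EE.
Proof. exact: fps_at_split. Qed.

Lemma xg0 : xg ord0 = fpsC (@uh K n). Proof. by []. Qed.
Lemma xgS j : xg (lift ord0 j) = fpsC (@ua K n j) *+ 2.
Proof. by rewrite /xg /xgen lift0 /= fpsCMn. Qed.
Lemma pgS j : pg (lift ord0 j) = fpsC (@ub K n j) * exp_sigmaN2 (@ue K n).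
Proof. by rewrite /pg /pgen lift0. Qed.
Lemma pg0X : fpsX (pg ord0) = tsigma (@ue K n).
Proof.
have s0 : tsigma (@ue K n) 0%N = 0 by apply: sigma0.
by rewrite [RHS]fps_splitX s0 fpsC0 add0r.
Qed.
Lemma Em2E : exp_sigmaN2 (@ue K n) = Em2.
Proof. by apply: em2E. Qed.

Lemma cop_E1 : D E1 = l E1 * r E1.
Proof. from_tcop tcop_e1. Qed.
Lemma cop_xS j : D (xg (lift ord0 j)) = l (xg (lift ord0 j)) * r E1' + r (xg (lift ord0 j)).
Proof.
rewrite xgS (linMn twisted_coproduct_linear) !(rmorphMn (fps_map (@tinl K _ (@Bvee_br K N)))).
rewrite !(rmorphMn (fps_map (@tinr K _ (@Bvee_br K N)))) mulrnAl -mulrnDl; congr (_ *+ 2).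
from_tcop tcop_a.
Qed.
Lemma cop_pS j : D (pg (lift ord0 j)) = l (pg (lift ord0 j)) * r E1' + r (pg (lift ord0 j)).
Proof. rewrite pgS; from_tcop tcop_p. Qed.
Lemma cop_p0 : D (pg ord0) = l (pg ord0) + r (pg ord0).
Proof.
apply: fpsX_inj; rewrite fpsXD -!fps_mapX -(lin_fpsX twisted_coproduct_linear) pg0X.
from_tcop tcop_sigma.
Qed.
(** The coefficient 4 of [tcop_h] becomes 2 because x_j = 2 E_1j. *)
Lemma cop_x0 : D (xg ord0) = l (xg ord0) * r Em2 + r (xg ord0)
  - \sum_(j < n) fpsX (l (xg (lift ord0 j)) * r (pg (lift ord0 j) * E1') *+ 2).
Proof.
have -> : D (xg ord0) = l (xg ord0) * r (exp_sigmaN2 (@ue K n)) + r (xg ord0)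
  - \sum_(j < n) fpsX (l (fpsC (@ua K n j)) * r (pg (lift ord0 j) * E1') *+ 4).
  under eq_bigr do rewrite pgS.
  rewrite xg0; from_tcop tcop_h.
rewrite Em2E; congr (_ - _); apply: eq_bigr => j _; congr fpsX.
by rewrite xgS (rmorphMn (fps_map (@tinl K _ (@Bvee_br K N)))) mulrnAl -mulrnA.
Qed.

Lemma E1K : E1 * E1' = 1. Proof. by apply: exp_sigmaK. Qed.
Lemma E1'K : E1' * E1 = 1. Proof. by apply: exp_sigmaNK. Qed.
Lemma E1_at : E1 = at_ (fps_exp (slog K)). Proof. by apply: e1_at. Qed.
Lemma E1'_at : E1' = at_ (fps_exp (- slog K)). Proof. by apply: e1'_at. Qed.
Lemma Em2_at : Em2 = at_ (fps_exp (- slog K) ^+ 2).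
Proof. by rewrite /Em2 E1'_at -atM expr2. Qed.

Lemma xgSC i j : xg (lift ord0 i) * xg (lift ord0 j) = xg (lift ord0 j) * xg (lift ord0 i).
Proof. by rewrite !xgS !mulrnAl !mulrnAr -!fpsCM uaa. Qed.
Lemma xg0S j : xg ord0 * xg (lift ord0 j) = xg (lift ord0 j) * xg ord0 + xg (lift ord0 j).
Proof. by rewrite !xgS xg0 mulrnAl mulrnAr -!fpsCM uha fpsCD mulrnDl. Qed.

(* pi_1 = u(xi E_1N) E_1N, where u has constant term 1. *)
Definition pi_unit : fps (K^o) := fps_divX (slog K).
Lemma pg0E : pg ord0 = at_ pi_unit * EE.
Proof.
apply: fpsX_inj; rewrite pg0X fpsX_mulr.
transitivity (at_ (slog K)); first exact: sigma_at.
rewrite at_split.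
have -> : fpsC (slog K 0%N : K) = 0 by apply: fpsP => -[|k] //; apply: slog0.
by rewrite scale0r add0r.
Qed.
(** [pi_unit] starts with 1 and is invertible, so pi_1 and E_1N differ by a unit commuting with
    both, and vanishing on multiples of one is vanishing on multiples of the other. *)
Lemma pi_unitK : EE = at_ (fps_inv pi_unit) * pg ord0.
Proof.
have c1 : pi_unit 0%N = 1.
  by rewrite -[LHS]/(slog K 1%N) slog_coef // !expr0 mulr1 invr1 mulr1.
by rewrite pg0E mulrA -atM (fps_invr c1).2 at1 mul1r.
Qed.

Lemma pgS_EE j : pg (lift ord0 j) * EE = EE * pg (lift ord0 j).
Proof. rewrite pgS; apply: pi_ueC; assumption. Qed.
Lemma pg_at i f : pg i * at_ f = at_ f * pg i.
Proof.
case: (unliftP ord0 i) => [j|] ->; last first.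
  by rewrite pg0E -mulrA at_EE !mulrA atC.
rewrite pgS; apply: pi_fps_atC; assumption.
Qed.
Lemma pgC i j : pg i * pg j = pg j * pg i.
Proof.
case: (unliftP ord0 j) => [j'|] ->; last first.
  rewrite pg0E mulrA pg_at -!mulrA; congr (_ * _).
  case: (unliftP ord0 i) => [i'|] ->; first by rewrite pgS_EE.
  by rewrite pg0E mulrA at_EE.
case: (unliftP ord0 i) => [i'|] ->.
  rewrite !pgS; apply: pi_piC; assumption.
by rewrite pg0E -mulrA -pgS_EE mulrA -pg_at mulrA.
Qed.

End Twisting.

(** * Ordered monomials and the PBW spanning property *)

Lemma prod_comm_mulr (R : pzRingType) (J : finType) (g : J -> R) (m : J -> nat) i :
    (forall j k, g j * g k = g k * g j) ->
  (\prod_j g j ^+ m j) * g i = \prod_j g j ^+ (m j + (j == i)).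
Proof.
move=> gC.
have H (s : seq J) : uniq s -> (\prod_(j <- s) g j ^+ m j) * g i ^+ (i \in s) =
    \prod_(j <- s) g j ^+ (m j + (j == i)).
  elim: s => [|k s IH] /=; first by rewrite !big_nil mulr1.
  case/andP=> ks us; rewrite !big_cons inE -(IH us).
  case: (eqVneq i k) => [->|ki] /=; last by rewrite addn0 mulrA.
  rewrite (negPf ks) mulr1 exprD -!mulrA; congr (_ * _); apply/esym.
  by apply: commr_prod => j _; apply: commrX; apply: gC.
by have := H _ (index_enum_uniq J); rewrite mem_index_enum.
Qed.

Lemma prod_count_comm (R : pzRingType) (J : finType) (g : J -> R) (w : seq J) :
    (forall j k, g j * g k = g k * g j) ->
  \prod_(j <- w) g j = \prod_j g j ^+ count_mem j w.
Proof.
move=> gC; elim/last_ind: w => [|w i IH]; first by rewrite big_nil big1.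
rewrite -cats1 big_cat big_seq1 /= IH prod_comm_mulr //.
by apply: eq_bigr => j _; rewrite count_cat /= addn0 eq_sym.
Qed.

(* The hypothesis says x_j x_0 = (x_0 - 1) x_j, so x_j can be moved to the left of
   a power of x_0. *)
Lemma shift_closed (R : pzRingType) (P : R -> Prop) (x0 xj v : R) :
    (forall u w, P u -> P w -> P (u - w)) -> x0 * xj = xj * x0 + xj ->
    (forall c, P (x0 ^+ c * (xj * v))) ->
  forall a c, P (x0 ^+ c * (xj * (x0 ^+ a * v))).
Proof.
move=> PB e P0; elim=> [|a IH] c; first by rewrite mul1r.
have E w : xj * (x0 * w) = x0 * (xj * w) - xj * w.
  by rewrite !mulrA e mulrDl addrK.
rewrite exprS -(mulrA x0) E.
by rewrite mulrBr mulrA -exprSr; apply: PB.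
Qed.

Section Monomials.
Variable n : nat.
Local Notation I := 'I_n.+1.
Local Notation mi := {ffun I -> nat}.

Definition mon (R : pzRingType) (g : I -> R) (m : mi) : R := \prod_i g i ^+ m i.
Definition incr (m : mi) (i : I) : mi := [ffun j => (m j + (j == i))%N].

Lemma mon_incr (R : pzRingType) (g : I -> R) m i :
  (forall j k, g j * g k = g k * g j) -> mon g m * g i = mon g (incr m i).
Proof.
by move=> gC; rewrite /mon prod_comm_mulr //; apply: eq_bigr => j _; rewrite ffunE.
Qed.

Lemma mon0 (R : pzRingType) (g : I -> R) : mon g [ffun=> 0%N] = 1.
Proof. by rewrite /mon big1 // => i _; rewrite ffunE. Qed.

Lemma mon_recl (R : pzRingType) (g : I -> R) m : mon g m =
  g ord0 ^+ m ord0 * \prod_(j < n) g (lift ord0 j) ^+ m (lift ord0 j).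
Proof. by rewrite /mon big_ord_recl. Qed.

Lemma mon_incr0 (R : pzRingType) (g : I -> R) m :
  g ord0 * mon g m = mon g (incr m ord0).
Proof.
rewrite !mon_recl mulrA -exprS ffunE eqxx addn1; congr (_ * _).
by apply: eq_bigr => j _; rewrite ffunE addn0.
Qed.

Section Shift.
Variables (R : pzRingType) (x : I -> R) (P : R -> Prop) (v : R).
Hypotheses (PB : forall u w, P u -> P w -> P (u - w))
  (x0S : forall j, x ord0 * x (lift ord0 j) = x (lift ord0 j) * x ord0 + x (lift ord0 j))
  (xSC : forall i j, x (lift ord0 i) * x (lift ord0 j) = x (lift ord0 j) * x (lift ord0 i)).

(** Moving x_j past a power of x_1 by [shift_closed] never loses x_j, so x_i x^m is a combination of
    ordered monomials that all contain x_i. This serves for the ordering of words and for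
    functionals that must vanish on x_i A. *)
Lemma mon_shift i m : (forall m' : mi, m' i != 0%N -> P (mon x m' * v)) ->
  P (x i * (mon x m * v)).
Proof.
case: (unliftP ord0 i) => [j|] -> {i} Pm; last first.
  by rewrite mulrA mon_incr0; apply: Pm; rewrite ffunE eqxx addn1.
rewrite mon_recl -mulrA; set w := _ * v.
have := @shift_closed R P (x ord0) (x (lift ord0 j)) w PB (x0S j) _ (m ord0) 0%N.
rewrite expr0 mul1r; apply=> c; rewrite {}/w.
pose m' : mi := [ffun i => if unlift ord0 i is Some k then m i + (k == j) else c]%N.
have -> : x ord0 ^+ c * (x (lift ord0 j) *
   (\prod_(k < n) x (lift ord0 k) ^+ m (lift ord0 k) * v)) = mon x m' * v.
  rewrite mon_recl /m' ffunE unlift_none -!mulrA; congr (_ * _).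
  rewrite !mulrA; congr (_ * _).
  have <- : \prod_(k < n) x (lift ord0 k) ^+ (m (lift ord0 k) + (k == j)) =
      \prod_(k < n) x (lift ord0 k) ^+ m' (lift ord0 k).
    by apply: eq_bigr => k _; rewrite ffunE liftK.
  rewrite -(@prod_comm_mulr _ _ (fun k => x (lift ord0 k))) //.
  by apply: commr_prod => k _; apply: commrX; apply: xSC.
by apply: Pm; rewrite ffunE liftK eqxx addn1.
Qed.
End Shift.
End Monomials.

Section Spanning.
Variables (K : fieldType) (n : nat).
Hypothesis char0 : forall k, k.+1%:R != 0 :> K.
Local Notation N := n.+2.
Local Notation U := (UB K N).
Local Notation A := (fps U).
Local Notation I := 'I_n.+1.
Local Notation mi := {ffun I -> nat}.

(** Reduction modulo xi. Up to the factor 2 of [uxS], [ux] and [up] are the basis matrices of B^vee,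
    so topological spanning of A becomes a classical statement on U(B^vee). *)
Definition ux (i : I) : U := xg K i 0%N.
Definition up (i : I) : U := pg K i 0%N.

Lemma ux0 : ux ord0 = @uh K n. Proof. by rewrite /ux xg0. Qed.
Lemma uxS j : ux (lift ord0 j) = @ua K n j *+ 2.
Proof. by rewrite /ux xgS fcoefMn. Qed.
Lemma up0 : up ord0 = @ue K n.
Proof.
rewrite /up pg0E // fcoefM0 /at_ fps_at0.
have -> : (pi_unit K 0%N : K) = 1.
  by rewrite -[LHS]/(slog K 1%N) slog_coef // !expr0 mulr1 invr1 mulr1.
by rewrite scale1r mul1r.
Qed.
Lemma upS j : up (lift ord0 j) = @ub K n j.
Proof. by rewrite /up pgS fcoefM0 fps_exp_coef0 mulr1. Qed.

Definition lin_closed (P : U -> Prop) := forall c u v, P u -> P v -> P (c *: u + v).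

Lemma lin_closed0 P u : lin_closed P -> P u -> P 0.
Proof. by move=> PL Pu; have := PL (-1) _ _ Pu Pu; rewrite scaleN1r addNr. Qed.
Lemma lin_closedD P u v : lin_closed P -> P u -> P v -> P (u + v).
Proof. by move=> PL Pu Pv; rewrite -[u]scale1r; apply: PL. Qed.
Lemma lin_closedZ P c u : lin_closed P -> P u -> P (c *: u).
Proof.
move=> PL Pu; have P0 := lin_closed0 PL Pu.
by rewrite -[_ *: _]addr0; apply: PL.
Qed.
Lemma lin_closedB P u v : lin_closed P -> P u -> P v -> P (u - v).
Proof.
by move=> PL Pu Pv; rewrite -scaleN1r; apply: lin_closedD => //; apply: lin_closedZ.
Qed.
Lemma lin_closed_mul P a : lin_closed P -> lin_closed (fun u => P (a * u)).
Proof. by move=> PL c u v Pu Pv; rewrite mulrDr -scalerAr; apply: PL. Qed.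
Lemma lin_closed_mulr P a : lin_closed P -> lin_closed (fun u => P (u * a)).
Proof. by move=> PL c u v Pu Pv; rewrite mulrDl -scalerAl; apply: PL. Qed.

(** Modulo xi, the commutator of a pi-generator with an x-generator is a multiple of a pi-generator,
    so the terms created by the exchange fall under the last hypothesis. *)
Lemma up_ux_closed (P : U -> Prop) i k v : lin_closed P ->
  P (ux k * (up i * v)) -> (forall j, P (up j * v)) -> P (up i * (ux k * v)).
Proof.
move=> PL P1 P2.
case: (unliftP ord0 k) P1 => [k'|] -> P1; case: (unliftP ord0 i) P1 => [i'|] ->.
- rewrite uxS upS mulrnAl => P1.
  have -> : ub K i' * (ua K k' *+ 2 * v) =
     ua K k' * (ub K i' * v) *+ 2 - (ue K n * v) *+ (k' == i') *+ 2.
    rewrite mulrnAl mulrnAr -mulrnBl; congr (_ *+ 2).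
    by rewrite !mulrA uab mulrDl mulrnAl addrK.
  apply: lin_closedB => //; rewrite -!scaler_nat; do 2!apply: lin_closedZ => //.
  by rewrite -up0.
- rewrite up0 uxS => P1; rewrite mulrA mulrnAr -uae -mulrnAl -mulrA //.
- rewrite ux0 upS => P1.
  have -> : ub K i' * (uh K n * v) = uh K n * (ub K i' * v) - ub K i' * v.
    by rewrite !mulrA uhb mulrDl addrK.
  by apply: lin_closedB => //; rewrite -upS.
- rewrite ux0 up0 => P1.
  have -> : ue K n * (uh K n * v) = uh K n * (ue K n * v) - (ue K n * v) *+ 2.
    by rewrite !mulrA uhe mulrDl mulrnAl addrK.
  by apply: lin_closedB => //; rewrite -scaler_nat; apply: lin_closedZ => //; rewrite -up0.
Qed.

Lemma uenv_words (P : U -> Prop) : lin_closed P ->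
    (forall w w', P ((\prod_(i <- w) ux i) * \prod_(i <- w') up i)) ->
  forall u, P u.
Proof.
(* Quantifying over the predicate lets a left factor [ux k] be absorbed into it during the induction
   on the word. *)
have key w : forall P : U -> Prop, lin_closed P ->
    (forall w w', P ((\prod_(i <- w) ux i) * \prod_(i <- w') up i)) ->
    forall i w', P (up i * ((\prod_(i <- w) ux i) * \prod_(i <- w') up i)).
  elim: w => [|k w IH] Q QL Qw i w'.
    by have := Qw [::] (i :: w'); rewrite !big_nil !mul1r big_cons.
  rewrite big_cons -mulrA; apply: up_ux_closed => // [|j].
    apply: (IH (fun u => Q (ux k * u))) => [|v v']; first exact: lin_closed_mul.
    by have := Qw (k :: v) v'; rewrite big_cons -mulrA.
  exact: IH.
move=> PL Pw u; move: P PL Pw; move: u.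
apply: ugen_ind => [P PL Pw|c u v Pu Pv P PL Pw|i u Pu P PL Pw].
- by have := Pw [::] [::]; rewrite !big_nil mulr1.
- by apply: (PL); [apply: Pu | apply: Pv].
have half j : P (ux j * u).
  apply: (Pu (fun u => P (ux j * u))) => [|w w']; first exact: lin_closed_mul.
  by have := Pw (j :: w) w'; rewrite big_cons -mulrA.
have halfp j : P (up j * u).
  apply: (Pu (fun u => P (up j * u))) => [|w w']; first exact: lin_closed_mul.
  exact: key.
case: i => [[]|[[] j]] /=.
- by rewrite -ux0.
- by rewrite -up0.
- have := half (lift ord0 j); rewrite uxS => /(@lin_closedZ P 2%:R^-1) -/(_ PL).
  by rewrite mulrnAl -scaler_nat scalerA mulVf ?scale1r //; apply: (char0 1).
- by rewrite -upS.
Qed.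

Lemma upC i j : up i * up j = up j * up i.
Proof. by rewrite /up -!fcoefM0 pgC. Qed.

Lemma pbw_span (P : U -> Prop) : lin_closed P ->
  (forall m k : mi, P (mon ux m * mon up k)) -> forall u, P u.
Proof.
move=> PL Pm; apply: uenv_words => // w w'.
rewrite (prod_count_comm _ upC).
have -> : \prod_j up j ^+ count_mem j w' = mon up [ffun j => count_mem j w'].
  by apply: eq_bigr => j _; rewrite ffunE.
move: [ffun _ => _] => k.
have key v : forall Q : U -> Prop, lin_closed Q -> (forall m, Q (mon ux m)) ->
    Q (\prod_(i <- v) ux i).
  elim: v => [|i v IH] Q QL Qm; first by rewrite big_nil -(mon0 ux).
  rewrite big_cons; apply: (IH (fun u => Q (ux i * u))) => [|m].
    exact: lin_closed_mul.
  rewrite -[mon ux m]mulr1; apply: mon_shift => [u u'|j|j j'|m' _]; last by rewrite mulr1.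
  - exact: lin_closedB.
  - by rewrite /ux -!fcoefM0 xg0S fcoefD.
  - by rewrite /ux -!fcoefM0 xgSC.
by apply: (key w (fun u => P (u * mon up k))) => //; apply: lin_closed_mulr.
Qed.

Lemma coef_mon0 (g : I -> A) m : mon g m 0%N = mon (fun i => g i 0%N) m.
Proof. by rewrite /mon fcoef_prod0; apply: eq_bigr => i _; rewrite fcoefX0. Qed.

(** Only constant terms are prescribed, because x^m pi^n and y^m q^n reduce to the same monomials
    modulo xi. *)
Lemma spanning (w : mindex N * mindex N -> A) :
    (forall k, w k 0%N = mon ux k.1 * mon up k.2) ->
  forall v : U, exists s : seq (K * (mindex N * mindex N)),
    v = \sum_(t <- s) t.1 *: w t.2 0%N.
Proof.
move=> w0; apply: pbw_span => [c u v [s ->] [s' ->]|m k].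
  exists ([seq (c * t.1, t.2) | t <- s] ++ s').
  rewrite big_cat big_map scaler_sumr /=; congr (_ + _).
  by apply: eq_bigr => t _; rewrite scalerA.
by exists [:: (1, (m, k))]; rewrite big_seq1 scale1r w0.
Qed.
End Spanning.

(** * Convolution of functionals *)

Section Functionals.
Variables (K : fieldType) (n : nat).
Hypothesis char0 : forall k, k.+1%:R != 0 :> K.
Local Notation N := n.+2.
Local Notation U := (UB K N).
Local Notation A := (fps U).
Local Notation T := (tens U U).
Local Notation I := 'I_n.+1.
Local Notation mi := {ffun I -> nat}.
Local Notation l := (fps_map (@tinl K _ (@Bvee_br K N))).
Local Notation r := (fps_map (@tinr K _ (@Bvee_br K N))).
Local Notation D := (@twisted_coproduct K N).
Local Notation xg := (@xg K n).
Local Notation pg := (@pg K n).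
Local Notation E1 := (@E1 K n).
Local Notation E1' := (@E1' K n).
Local Notation EE := (@EE K n).
Local Notation at_ := (@at_ K n).

Lemma fps_tinlM x y : l (x * y) = l x * l y. Proof. exact: rmorphM. Qed.
Lemma fps_tinrM x y : r (x * y) = r x * r y. Proof. exact: rmorphM. Qed.
Lemma fps_tinl1 : l 1 = 1. Proof. exact: rmorph1. Qed.
Lemma fps_tinr1 : r 1 = 1. Proof. exact: rmorph1. Qed.

Section Types.
Variable V : algType K.
Implicit Types f g : A -> fps V.

Definition convol f g : A -> fps V := fun a => pairing f g (D a).

Lemma convol_linear f g : linear f -> linear g -> linear (convol f g).
Proof.
move=> fl gl c a b; rewrite /convol twisted_coproduct_linear; exact: pairing_linear.
Qed.

(** [xtype] is the condition met by products of the x^i, [ptype] the one met by products of the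
    pi^i. The weaker [blind] can be read off the dual basis directly; for [ord0] it makes e^sigma
    and e^(-sigma) on the right invisible. *)
Definition xtype f := forall i a b, f (a * pg i * b) = 0.
Definition ptype f := forall i a, f (xg i * a) = 0.
Definition blind i f := forall a, f (a * pg i) = 0.

Lemma pairing_add f g u v : linear f -> linear g ->
  pairing f g (u + v) = pairing f g u + pairing f g v.
Proof. by move=> fl gl; rewrite (linD (pairing_linear fl gl)). Qed.

(** [W1] is decomposed into pure tensors, which are absorbed into the functionals. So a factor in
    the middle of a product can be replaced as soon as this is possible in the leftmost position for
    all translates of f and g. *)
Lemma pairing_ext_mid f g (u v : fps T) : linear f -> linear g ->
    (forall c d, forall W, pairing (fun a => f (c * a)) (fun a => g (d * a)) (u * W) =
       pairing (fun a => f (c * a)) (fun a => g (d * a)) (v * W)) ->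
  forall W1 W2, pairing f g (W1 * u * W2) = pairing f g (W1 * v * W2).
Proof.
move=> fl gl e W1 W2; move: W1.
have L w : linear (fun W => pairing f g (W * w * W2)).
  by move=> c x y; rewrite !mulrDl -!scalerAl pairing_linear.
apply: fps_tens_ext => [||a b]; [exact: L|exact: L|].
by rewrite -!(mulrA (l _ * r _)) !pairing_mull.
Qed.

Lemma pairing_midl0 f g p W1 W2 : linear f -> linear g ->
  (forall a b, f (a * p * b) = 0) -> pairing f g (W1 * l p * W2) = 0.
Proof.
move=> fl gl fp; rewrite (@pairing_ext_mid f g _ 0) // ?mulr0 ?mul0r; last first.
  move=> c d W; rewrite mul0r pairing_mulll; try exact: linear_mull.
  rewrite (lin0 (pairing_linear (linear_mull c fl) (linear_mull d gl))).
  apply: pairing0l; [|exact: linear_mull|].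
    by move=> k x y; rewrite mulrDr mulrDr -!scalerAr fl.
  by move=> b; rewrite mulrA fp.
by rewrite (lin0 (pairing_linear fl gl)).
Qed.

Lemma pairing_midr0 f g p W1 W2 : linear f -> linear g ->
  (forall a b, g (a * p * b) = 0) -> pairing f g (W1 * r p * W2) = 0.
Proof.
move=> fl gl gp; rewrite (@pairing_ext_mid f g _ 0) // ?mulr0 ?mul0r; last first.
  move=> c d W; rewrite mul0r pairing_mullr; try exact: linear_mull.
  rewrite (lin0 (pairing_linear (linear_mull c fl) (linear_mull d gl))).
  apply: pairing0r; [exact: linear_mull| |].
    by move=> k x y; rewrite mulrDr mulrDr -!scalerAr gl.
  by move=> b; rewrite mulrA gp.
by rewrite (lin0 (pairing_linear fl gl)).
Qed.

(** A uniform form for all i: the group-like factor is a series in xi E_1N with constant term 1, and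
    the second clause records that pi_1 is primitive. *)
Lemma cop_p i : exists f : fps (K^o),
  [/\ f 0%N = 1, i = ord0 -> f = 1 & D (pg i) = l (pg i) * r (at_ f) + r (pg i)].
Proof.
case: (unliftP ord0 i) => [j|] ->.
  exists (fps_exp (- slog K)); split=> //; first exact: fps_exp_coef0.
  by rewrite cop_pS // E1'_at.
by exists 1; split=> //; rewrite cop_p0 // at1 fps_tinr1 mulr1.
Qed.

Lemma convol_xtype f g : linear f -> linear g -> xtype f -> xtype g -> xtype (convol f g).
Proof.
move=> fl gl fx gx i a b; rewrite /convol !copM //.
have [c [_ _ ->]] := cop_p i.
move: (D a) (D b) => W1 W2.
rewrite mulrDr mulrDl pairing_add // mulrA -(mulrA (_ * l _)).
rewrite pairing_midl0 // ?pairing_midr0 ?addr0 //.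
Qed.

Lemma pairing_px f g i W : linear f -> linear g -> ptype f ->
  pairing f g (l (xg i) * W) = 0.
Proof.
by move=> fl gl fp; rewrite pairing_mulll //; apply: pairing0l => //; apply: linear_mull.
Qed.
Lemma pairing_pxr f g i W : linear f -> linear g -> ptype g ->
  pairing f g (r (xg i) * W) = 0.
Proof.
by move=> fl gl fp; rewrite pairing_mullr //; apply: pairing0r => //; apply: linear_mull.
Qed.

(** Every term of the coproduct of x_i except 1 (x) x_i has some x_j leftmost in its first leg,
    where f kills it. *)
Lemma pairing_cop_x f g i W : linear f -> linear g -> ptype f ->
  pairing f g (D (xg i) * W) = pairing f (fun b => g (xg i * b)) W.
Proof.
move=> fl gl fp; rewrite -pairing_mullr //.
case: (unliftP ord0 i) => [j|] ->.
  by rewrite cop_xS // mulrDl pairing_add // -mulrA pairing_px // add0r.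
rewrite cop_x0 // mulrDl mulrDl !pairing_add // -mulrA pairing_px // add0r.
rewrite mulNr mulr_suml (linN (pairing_linear fl gl)) (lin_sum (pairing_linear fl gl)).
rewrite big1 ?subr0 // => j _; rewrite -mulrnAr fpsX_mulr -mulrA.
exact: pairing_px.
Qed.

Lemma convol_ptype f g : linear f -> linear g -> ptype f -> ptype g -> ptype (convol f g).
Proof.
move=> fl gl fx gx i a; rewrite /convol copM // pairing_cop_x //.
by apply: pairing0r => //; apply: linear_mull.
Qed.

Lemma convol_blind i f g : linear f -> linear g -> blind i f -> blind i g ->
  blind i (convol f g).
Proof.
move=> fl gl fx gx a; rewrite /convol copM //.
have [c [_ _ ->]] := cop_p i.
rewrite mulrDr pairing_add // pairing_mulr // pairing_mulrr //.
rewrite pairing0l ?pairing0r ?addr0 //; exact: linear_mulr.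
Qed.

(** By [pi_unitK] the non-constant part of the series is a left multiple of pi_1, which f does not
    see. *)
Lemma blind_at f w phi : linear f -> blind ord0 f -> f (w * at_ phi) = fpsC (phi 0%N : K) *: f w.
Proof.
move=> fl fb; rewrite at_split mulrDr (linD fl) -scalerAr mulr1 (linZ fl).
rewrite -!fpsX_mulr (lin_fpsX fl) pi_unitK // !mulrA fb.
by rewrite [fpsX 0](_ : _ = 0) ?addr0 //; apply: fpsP => -[|k].
Qed.

Lemma xtype_at f a b phi : linear f -> xtype f ->
  f (a * at_ phi * b) = fpsC (phi 0%N : K) *: f (a * b).
Proof.
move=> fl fx; rewrite at_split mulrDr mulrDl (linD fl) -scalerAr -scalerAl mulr1 (linZ fl).
rewrite -!fpsX_mulr -fpsX_mull (lin_fpsX fl) pi_unitK // !mulrA fx.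
by rewrite [fpsX 0](_ : _ = 0) ?addr0 //; apply: fpsP => -[|k].
Qed.

(** The span of E_1N and the E_jN is stable under commutation with B^vee, so the left ideal
    generated by the pi_i is two-sided. *)
Lemma xtype_of_right f : linear f -> (forall i, blind i f) -> xtype f.
Proof.
move=> fl fb.
have fE a : f (a * EE) = 0 by rewrite pi_unitK // mulrA fb.
pose B j : A := fpsC (@ub K n j).
have pB j : pg (lift ord0 j) = B j * (E1' * E1') by rewrite pgS Em2E.
have BE j : B j = E1 * E1 * pg (lift ord0 j).
  rewrite E1_at -atM -pg_at // atM -E1_at pB -!mulrA.
  by rewrite [E1' * (E1 * E1)]mulrA E1'K // mul1r E1'K // mulr1.
have fB j a : f (a * B j) = 0 by rewrite BE mulrA fb.
(* Induction on a word b: its first letter is moved to the left, into a. The claims for E_1N and for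
   the E_jN must go together, since commuting E_jN with E_1j produces E_1N. *)
have key : forall b : U, forall a, f (a * EE * fpsC b) = 0 /\ forall j, f (a * B j * fpsC b) = 0.
  apply: ugen_ind => [a|c u v Pu Pv a|i u Pu a].
  - by rewrite !mulr1; split=> // j; rewrite mulr1.
  - rewrite fpsCD fpsCZ; have [u1 u2] := Pu a; have [v1 v2] := Pv a; split=> [|j].
      by rewrite mulrDr -scalerAr fl u1 v1 scaler0 addr0.
    by rewrite mulrDr -scalerAr fl u2 v2 scaler0 addr0.
  rewrite fpsCM.
  have EC c : EE * fpsC c = fpsC c * EE ->
     f (a * EE * (fpsC c * fpsC u)) = 0.
    move=> e; rewrite mulrA -(mulrA a) e mulrA; apply: (Pu _).1.
  have BC j c : B j * fpsC c = fpsC c * B j ->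
     f (a * B j * (fpsC c * fpsC u)) = 0.
    move=> e; rewrite mulrA -(mulrA a) e mulrA; apply: (Pu _).2.
  case: i => [[]|[[] k]] /=; split=> [|j].
  - have -> : a * EE * (fpsC (uh K n) * fpsC u) =
        a * fpsC (uh K n) * EE * fpsC u - a * EE * fpsC u *+ 2.
      rewrite -!mulrA -mulrnAr -mulrBr; congr (_ * _).
by rewrite !mulrA -mulrnAl -mulrBl; congr (_ * _); rewrite /B /EE -!fpsCM uhe fpsCD fpsCMn addrK.
    by rewrite (linB fl) (linMn fl) !(Pu _).1 mul0rn subr0.
  - have -> : a * B j * (fpsC (uh K n) * fpsC u) =
        a * fpsC (uh K n) * B j * fpsC u - a * B j * fpsC u.
      rewrite -!mulrA -mulrBr; congr (_ * _).
      by rewrite !mulrA -mulrBl; congr (_ * _); rewrite /B -!fpsCM uhb fpsCD addrK.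
    by rewrite (linB fl) !(Pu _).2 subr0.
  - by apply: EC; rewrite /EE.
  - by apply: BC; rewrite /B /EE -!fpsCM ube.
  - by apply: EC; rewrite /B /EE -!fpsCM uae.
  - have -> : a * B j * (fpsC (ua K k) * fpsC u) =
        a * fpsC (ua K k) * B j * fpsC u - a * EE * fpsC u *+ (k == j).
      rewrite -!mulrA -mulrnAr -mulrBr; congr (_ * _).
      by rewrite !mulrA -mulrnAl -mulrBl; congr (_ * _); rewrite /B /EE -!fpsCM uab fpsCD fpsCMn addrK.
    by rewrite (linB fl) (linMn fl) (Pu _).1 (Pu _).2 mul0rn subr0.
  - by apply: EC; rewrite /B /EE -!fpsCM ube.
  - by apply: BC; rewrite /B /EE -!fpsCM ubb.
have L c : linear (fun b => f (c * b)) by apply: linear_mull.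
have L0 : linear (fun _ : A => 0 : fps V) by move=> c x y; rewrite scaler0 addr0.
have keyE a b : f (a * EE * b) = 0.
  by move: b; apply: (linear_eq_const (L _) L0) => v; apply: (key v a).1.
have keyB j a b : f (a * B j * b) = 0.
  by move: b; apply: (linear_eq_const (L _) L0) => v; apply: (key v a).2.
move=> i a b; case: (unliftP ord0 i) => [j|] ->.
  by rewrite pB mulrA -mulrA keyB.
by rewrite pg0E // mulrA keyE.
Qed.

Lemma xtype_mull f c : xtype f -> xtype (fun a => f (c * a)).
Proof. by move=> fx i a b; rewrite !mulrA fx. Qed.

(* u and v act in the same way on pairs of functionals vanishing on the ideal
   generated by the pi_i. *)
Definition xequiv (u v : fps T) := forall f g, linear f -> linear g ->
  xtype f -> xtype g -> forall W1 W2,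
  pairing f g (W1 * u * W2) = pairing f g (W1 * v * W2).

Lemma xequivM u v u' v' : xequiv u v -> xequiv u' v' -> xequiv (u * u') (v * v').
Proof.
move=> e e' f g fl gl fx gx W1 W2.
by rewrite mulrA -(mulrA _ u') e // mulrA -(mulrA _ u') mulrA e' // mulrA.
Qed.
Lemma xequiv1 : xequiv 1 1. Proof. by []. Qed.
Lemma xequivX u v k : xequiv u v -> xequiv (u ^+ k) (v ^+ k).
Proof.
move=> e; elim: k => [|k IH]; first by rewrite !expr0; apply: xequiv1.
by rewrite !exprS; apply: (xequivM e IH).
Qed.
Lemma xequiv_prod (J : Type) (s : seq J) (u v : J -> fps T) :
  (forall j, xequiv (u j) (v j)) -> xequiv (\prod_(j <- s) u j) (\prod_(j <- s) v j).
Proof.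
move=> e; elim: s => [|j s IH]; first by rewrite !big_nil; apply: xequiv1.
by rewrite !big_cons; apply: (xequivM (e j) IH).
Qed.

(** Modulo the ideal the powers of e^(-sigma) act as 1, and each correction term of [cop_x0] carries
    some pi_j in its second leg. *)
Lemma xequiv_x i : xequiv (D (xg i)) (l (xg i) * r 1 + l 1 * r (xg i)).
Proof.
move=> f g fl gl fx gx W1 W2; rewrite fps_tinr1 fps_tinl1 mulr1 mul1r.
have RA W W' (phi : fps (K^o)) : phi 0%N = 1 ->
    pairing f g (W * r (at_ phi) * W') = pairing f g (W * W').
  move=> p1; rewrite (@pairing_ext_mid f g _ 1) // ?mulr1 // => c d w.
  have gl' := linear_mull d gl; have fl' := linear_mull c fl.
  rewrite mul1r pairing_mullr //; apply: eq_pairing => // b.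
  by rewrite mulrA xtype_at // [phi 0%N]p1 scale1r.
case: (unliftP ord0 i) => [j|] ->.
  rewrite cop_xS // !mulrDr !mulrDl !pairing_add //; congr (_ + _).
  by rewrite E1'_at mulrA RA //; apply: fps_exp_coef0.
rewrite cop_x0 // mulrDr mulrDl mulrN mulNr mulr_sumr mulr_suml.
rewrite (linB (pairing_linear fl gl)) (lin_sum (pairing_linear fl gl)).
rewrite [X in _ - X]big1 ?subr0 => [|j _].
  rewrite !mulrDr !mulrDl !pairing_add //; congr (_ + _).
  rewrite Em2_at mulrA RA //.
  by rewrite fcoefX0 fps_exp_coef0 expr1n.
rewrite -fpsX_mulr -fpsX_mull (lin_fpsX (pairing_linear fl gl)).
rewrite mulrnAr mulrnAl (linMn (pairing_linear fl gl)) fps_tinrM.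
rewrite !mulrA -(mulrA _ (r E1')) pairing_midr0 // mul0rn.
by apply: fpsP => -[|k].
Qed.

End Types.
End Functionals.

Lemma mon_ind n (R : pzRingType) (g : 'I_n.+1 -> R) (P : R -> Prop) :
    P 1 -> (forall u v, P u -> P v -> P (u * v)) -> (forall i, P (g i)) ->
  forall m, P (mon g m).
Proof.
move=> P1 PM Pg m; rewrite /mon; elim/big_rec: _ => // i u _ Pu; apply: (PM _ _ _ Pu).
by elim: (m i) => [|k IH]; rewrite ?expr0 // exprS; apply: PM.
Qed.

Lemma mon_ind2 n (R : pzRingType) (g h : 'I_n.+1 -> R) (P : R -> R -> Prop) :
    P 1 1 -> (forall u v u' v', P u v -> P u' v' -> P (u * u') (v * v')) ->
    (forall i, P (g i) (h i)) ->
  forall m, P (mon g m) (mon h m).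
Proof.
move=> P1 PM Pg m; rewrite /mon; elim/big_rec2: _ => // i u v _ Pu; apply: (PM _ _ _ _ _ Pu).
by elim: (m i) => [|k IH]; rewrite ?expr0 // !exprS; apply: PM.
Qed.

(** * Products of an x-functional and a pi-functional on mixed monomials *)

Section Mixing.
Variables (K : fieldType) (n : nat).
Hypothesis char0 : forall k, k.+1%:R != 0 :> K.
Local Notation N := n.+2.
Local Notation U := (UB K N).
Local Notation A := (fps U).
Local Notation T := (tens U U).
Local Notation I := 'I_n.+1.
Local Notation mi := {ffun I -> nat}.
Local Notation l := (fps_map (@tinl K _ (@Bvee_br K N))).
Local Notation r := (fps_map (@tinr K _ (@Bvee_br K N))).
Local Notation D := (@twisted_coproduct K N).
Local Notation xg := (@xg K n).
Local Notation pg := (@pg K n).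
Local Notation E1 := (@E1 K n).
Local Notation E1' := (@E1' K n).
Local Notation EE := (@EE K n).
Local Notation at_ := (@at_ K n).
Variable V : algType K.
Implicit Types f g : A -> fps V.

Lemma fps_tinlrM x y z w : l x * r y * (l z * r w) = l (x * z) * r (y * w).
Proof. by rewrite mulrA -[_ * r y * _]mulrA fps_lrC mulrA -fps_tinlM -mulrA -fps_tinrM. Qed.

Lemma fpsX_tmull (u v : fps T) : fpsX u * v = fpsX (u * v).
Proof. by apply/esym; apply: (@fpsX_mull K). Qed.

Lemma E1_0 : (fps_exp (slog K) 0%N : K) = 1. Proof. exact: (@fps_exp_coef0 K (K^o)). Qed.

Lemma xtype_at1 f b (phi : fps (K^o)) : linear f -> xtype f -> (phi 0%N : K) = 1 ->
  f (at_ phi * b) = f b.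
Proof.
by move=> fl fx p1; have := xtype_at char0 1 b phi fl fx; rewrite !mul1r p1 scale1r.
Qed.
Lemma xtype_at2 f a b (phi : fps (K^o)) : linear f -> xtype f -> (phi 0%N : K) = 1 ->
  f (a * at_ phi * b) = f (a * b).
Proof. by move=> fl fx p1; rewrite xtype_at // p1 scale1r. Qed.

(** g kills the term 1 (x) pi_i and does not see the group-like factor in the second leg of the
    other one. *)
Lemma pairing_cop_p f g i W : linear f -> linear g -> xtype g ->
  pairing f g (D (pg i) * W) = pairing (fun a => f (pg i * a)) g W.
Proof.
move=> fl gl gx; have [c [c0 _ ->]] := cop_p char0 i.
rewrite mulrDl pairing_add // pairing_mull // pairing_mullr //.
rewrite [X in _ + X]pairing0r ?addr0 //; last 2 first.
- exact: linear_mull.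
- by move=> b; have := gx i 1 b; rewrite mul1r.
by apply: eq_pairing => // b; apply: xtype_at1.
Qed.

(** Read from the left: f forces each x_i into the second leg; once x^m is absorbed there, g still
    vanishes on the ideal and forces each pi_i into the first leg. *)
Lemma convol_mon_xp f g (m k : mi) : linear f -> linear g -> ptype f -> xtype g ->
  convol f g (mon xg m * mon pg k) = f (mon pg k) * g (mon xg m).
Proof.
move=> fl gl fp gx; rewrite /convol copM //.
have step1 : forall g, linear g -> forall W,
    pairing f g (D (mon xg m) * W) = pairing f (fun b => g (mon xg m * b)) W.
  apply: (mon_ind (P := fun u => forall g, linear g -> forall W,
    pairing f g (D u * W) = pairing f (fun b => g (u * b)) W)) => [h hl W|u v Pu Pv h hl W|i h hl W].
  - by rewrite cop1 // mul1r; apply: eq_pairing => // b; rewrite mul1r.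
  - rewrite copM // -mulrA Pu // Pv; last exact: linear_mull.
    by apply: eq_pairing => // b; rewrite mulrA.
  - exact: pairing_cop_x.
have gl' := linear_mull (mon xg m) gl; have gx' := @xtype_mull _ _ _ g (mon xg m) gx.
rewrite step1 // -[D (mon pg k)]mulr1; move: gl' gx'; set g' := fun b => g _ => gl' gx'.
have step2 : forall f, linear f -> forall W,
    pairing f g' (D (mon pg k) * W) = pairing (fun b => f (mon pg k * b)) g' W.
  apply: (mon_ind (P := fun u => forall f, linear f -> forall W,
    pairing f g' (D u * W) = pairing (fun b => f (u * b)) g' W)) => [h hl W|u v Pu Pv h hl W|i h hl W].
  - by rewrite cop1 // mul1r; apply: eq_pairing => // b; rewrite mul1r.
  - rewrite copM // -mulrA Pu // Pv; last exact: linear_mull.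
    by apply: eq_pairing => // b; rewrite mulrA.
  - exact: pairing_cop_p.
rewrite step2 // pairing1 //; last exact: linear_mull.
by rewrite /g' !mulr1.
Qed.

(* These are - S(x_i) and - S(pi_i); see [antipode_x] and [antipode_p]. *)
Definition yg (i : I) : A := if i == ord0 then
    (xg ord0 + \sum_(j < n) fpsX (xg (lift ord0 j) * pg (lift ord0 j)) *+ 2) * (E1 * E1)
  else xg i * E1.
Definition qg (i : I) : A := if i == ord0 then pg i else pg i * E1.

Lemma yg0 : yg ord0 = (xg ord0 +
  \sum_(j < n) fpsX (xg (lift ord0 j) * pg (lift ord0 j)) *+ 2) * (E1 * E1).
Proof. by []. Qed.
Lemma ygS j : yg (lift ord0 j) = xg (lift ord0 j) * E1. Proof. by []. Qed.
Lemma qg0 : qg ord0 = pg ord0. Proof. by rewrite /qg eqxx. Qed.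
Lemma qgS j : qg (lift ord0 j) = pg (lift ord0 j) * E1. Proof. by []. Qed.

Section Core.
Variables (f g : A -> fps V) (x0 e e' : A) (x p : 'I_n -> A) (W : fps T).
Hypotheses (fl : linear f) (gl : linear g) (e'K : e' * e = 1)
  (fe : forall a b, f (a * (e * e) * b) = f (a * b))
  (fp : forall j a b, f (a * p j * b) = 0)
  (pi_ueC : forall j, p j * e = e * p j)
  (gx0 : forall a, g (x0 * a) = 0) (gx : forall j a, g (x j * a) = 0).
Let pl := pairing_linear fl gl.

Let K1 : e' * (e * e) = e. Proof. by rewrite mulrA e'K mul1r. Qed.
Let W' := l (e * e) * r (e * e) * W.

Let rx0 w : pairing f g (r x0 * w) = 0.
Proof. by rewrite pairing_mullr //; apply: pairing0r => //; apply: linear_mull. Qed.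
Let rx j w : pairing f g (r (x j) * w) = 0.
Proof. by rewrite pairing_mullr //; apply: pairing0r => //; apply: linear_mull. Qed.

(** The contribution of x_1 to y_1. Multiplication by e^(2 sigma) clears the second leg of x_1 (x)
    e^(-2 sigma), but leaves the unwanted terms -2 xi x_j (x) pi_j e^sigma. *)
Lemma pairing_core0 :
  pairing f g ((l x0 * r (e' * e') + r x0
     - \sum_(j < n) fpsX (l (x j) * r (p j * e') *+ 2)) * W') =
  pairing (fun a => f (x0 * a)) g W - \sum_(j < n)
    fpsX (pairing (fun b => f (x j * b)) (fun b => g (p j * e * b)) W *+ 2).
Proof.
rewrite !mulrDl !pairing_add // rx0 addr0; congr (_ + _).
  rewrite /W' mulrA fps_tinlrM -(mulrA e' e') K1 e'K fps_tinr1 mulr1 pairing_mulll //.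
  by apply: eq_pairing => // b; rewrite fe.
rewrite mulNr mulr_suml (linN pl) (lin_sum pl); congr (- _).
apply: eq_bigr => j _; rewrite fpsX_tmull (lin_fpsX pl); congr fpsX.
rewrite mulrnAl (linMn pl) /W' mulrA fps_tinlrM -(mulrA (p j)) K1 pairing_mull //.
by congr (_ *+ 2); apply: eq_pairing => // b; rewrite fe.
Qed.

(** The contribution of the summand x_j pi_j of y_1: of its four terms only x_j (x) pi_j e^sigma
    survives, and these terms cancel the unwanted ones of [pairing_core0]. *)
Lemma pairing_core1 j :
  pairing f g ((l (x j) * r e' + r (x j)) * ((l (p j) * r e' + r (p j)) * W')) =
  pairing (fun b => f (x j * b)) (fun b => g (p j * e * b)) W.
Proof.
rewrite mulrDl pairing_add // rx addr0 mulrA mulrDr mulrDl pairing_add // fps_tinlrM.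
rewrite pairing_mull // pairing0l; last 3 first.
- exact: linear_mull.
- exact: linear_mull.
- by move=> b; rewrite fp.
rewrite add0r -(mulrA (l (x j))) -fps_tinrM /W' mulrA fps_tinlrM.
have -> : e' * p j * (e * e) = p j * e.
  by rewrite -mulrA (mulrA (p j)) pi_ueC -mulrA pi_ueC mulrA -(mulrA e') mulrA e'K mul1r -pi_ueC.
rewrite pairing_mull //; apply: eq_pairing => // b; by rewrite fe.
Qed.
End Core.

(** For x_i itself the surviving term has e^(-sigma) or e^(-2 sigma) in its second leg, and g sees
    these factors. The powers of e^sigma in y_i cancel them, while the powers they put in the first
    leg are invisible to f. *)
Lemma pairing_cop_y f g i W : linear f -> linear g -> xtype f -> ptype g ->
  pairing f g (D (yg i) * W) = pairing (fun a => f (xg i * a)) g W.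
Proof.
move=> fl gl fx gp; have pl := pairing_linear fl gl.
have E20 : ((fps_exp (slog K) ^+ 2) 0%N : K) = 1.
  rewrite (@fcoefX0 K (K^o)) (@fps_exp_coef0 K (K^o)) expr1n //.
have fE a b : f (a * (E1 * E1) * b) = f (a * b).
  by rewrite E1_at -atM -expr2 xtype_at2.
have pE j : pg (lift ord0 j) * E1 = E1 * pg (lift ord0 j).
  by rewrite E1_at pg_at.
have DE : D (E1 * E1) = l (E1 * E1) * r (E1 * E1).
  by rewrite copM // cop_E1 // fps_tinlrM.
case: (unliftP ord0 i) => [j|] ->.
  rewrite ygS copM // cop_xS // cop_E1 // mulrDl fps_tinlrM E1'K // mulrDl pairing_add //.
  rewrite -[r _ * _ * W]mulrA pairing_pxr // addr0 pairing_mull //.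
  by apply: eq_pairing => b; rewrite ?mul1r // E1_at xtype_at2 // E1_0.
have T1 := @pairing_core0 f g (xg ord0) E1 E1' _ (fun j => pg (lift ord0 j)) W
  fl gl (E1'K n char0) fE (gp ord0).
have T2 := @pairing_core1 f g E1 E1' (fun j => xg (lift ord0 j))
  (fun j => pg (lift ord0 j)) W fl gl (E1'K n char0) fE (fun j => fx (lift ord0 j)) pE
  (fun j => gp (lift ord0 j)).
rewrite yg0 copM // (linD (@twisted_coproduct_linear K n)).
rewrite (lin_sum (@twisted_coproduct_linear K n)) DE.
set W' := l (E1 * E1) * r (E1 * E1).
have {}T1 : pairing f g (D (xg ord0) * (W' * W)) = pairing (fun a => f (xg ord0 * a)) g W
    - \sum_(j < n) fpsX (pairing (fun b => f (xg (lift ord0 j) * b))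
        (fun b => g (pg (lift ord0 j) * E1 * b)) W *+ 2).
  by rewrite cop_x0 //; apply: T1.
rewrite -mulrA mulrDl pairing_add // {}T1 mulr_suml (lin_sum pl).
rewrite -[RHS]addr0 -addrA; congr (_ + _); rewrite addrC; apply/eqP; rewrite subr_eq0.
apply/eqP; apply: eq_bigr => j _.
rewrite (linMn (@twisted_coproduct_linear K n)) (lin_fpsX (@twisted_coproduct_linear K n)).
rewrite mulrnAl (linMn pl) fpsX_tmull (lin_fpsX pl) -fpsXMn; congr (fpsX (_ *+ 2)).
by rewrite copM // cop_xS // cop_pS // -mulrA; apply: T2.
Qed.

End Mixing.

Section Expansion.
Variables (K : fieldType) (n : nat).
Hypothesis char0 : forall k, k.+1%:R != 0 :> K.
Local Notation N := n.+2.
Local Notation U := (UB K N).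
Local Notation A := (fps U).
Local Notation T := (tens U U).
Local Notation I := 'I_n.+1.
Local Notation mi := {ffun I -> nat}.
Local Notation l := (fps_map (@tinl K _ (@Bvee_br K N))).
Local Notation r := (fps_map (@tinr K _ (@Bvee_br K N))).
Local Notation D := (@twisted_coproduct K N).
Local Notation xg := (@xg K n).
Local Notation pg := (@pg K n).
Local Notation yg := (@yg K n).
Local Notation qg := (@qg K n).
Local Notation E1 := (@E1 K n).
Local Notation E1' := (@E1' K n).
Local Notation EE := (@EE K n).
Local Notation at_ := (@at_ K n).
Variable V : algType K.
Implicit Types f g : A -> fps V.

Lemma cop_q_core (p e e' : A) : e' * e = 1 ->
  (l p * r e' + r p) * (l e * r e) = l (p * e) + l e * r (p * e).
Proof.
by move=> eK; rewrite mulrDl fps_tinlrM eK fps_tinr1 mulr1 mulrA fps_lrC -mulrA -fps_tinrM.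
Qed.

(** Multiplying pi_j by e^sigma moves the group-like factor from the second leg to the first. This
    is why products of the pi^i on q-monomials are taken in decreasing order. *)
Lemma cop_q i : exists c : fps (K^o),
  [/\ (c 0%N : K) = 1, i = ord0 -> c = 1
    & D (qg i) = l (qg i) + l (at_ c) * r (qg i)].
Proof.
case: (unliftP ord0 i) => [j|] ->.
  exists (fps_exp (slog K)); split=> //; first exact: E1_0.
  rewrite -E1_at qgS copM // cop_pS // cop_E1 //; exact: (cop_q_core _ (E1'K n char0)).
by exists 1; split=> //; rewrite qg0 cop_p0 // at1 fps_tinl1 mul1r.
Qed.

Lemma q_at i : exists c : fps (K^o),
  [/\ (c 0%N : K) = 1, i = ord0 -> c = 1 & qg i = pg i * at_ c].
Proof.
case: (unliftP ord0 i) => [j|] ->.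
  by exists (fps_exp (slog K)); split=> //; [exact: E1_0 | rewrite qgS E1_at].
by exists 1; split=> //; rewrite qg0 at1 mulr1.
Qed.

Lemma pairing_cop_q f g i W : linear f -> linear g -> xtype f ->
  pairing f g (D (qg i) * W) = pairing f (fun b => g (qg i * b)) W.
Proof.
move=> fl gl fx; have [c [c0 _ ->]] := cop_q i.
rewrite mulrDl pairing_add // pairing_mull // pairing_mulll //.
rewrite [X in X + _]pairing0l ?add0r //; last 2 first.
- exact: linear_mull.
- have [d [_ _ ->]] := q_at i.
  by move=> b; have := fx i 1 (at_ d * b); rewrite mul1r mulrA.
by apply: eq_pairing => // b; apply: xtype_at1.
Qed.

(** The counterpart of [convol_mon_xp] for the opposite order of functionals: each y_i acts as x_i
    in the first leg, and then each q_i goes to the second leg because f vanishes on the ideal. *)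
Lemma convol_mon_yq f g (m k : mi) : linear f -> linear g -> xtype f -> ptype g ->
  convol f g (mon yg m * mon qg k) = f (mon xg m) * g (mon qg k).
Proof.
move=> fl gl fx gp; rewrite /convol copM //.
have step1 : forall f, linear f -> xtype f -> forall W,
    pairing f g (D (mon yg m) * W) = pairing (fun b => f (mon xg m * b)) g W.
  apply: (mon_ind2 (P := fun u v => forall f, linear f -> xtype f -> forall W,
    pairing f g (D u * W) = pairing (fun b => f (v * b)) g W))
    => [h hl hx W|u v u' v' Pu Pv h hl hx W|i h hl hx W].
  - by rewrite cop1 // mul1r; apply: eq_pairing => // b; rewrite mul1r.
  - rewrite copM // -mulrA Pu // Pv; [|exact: linear_mull|exact: xtype_mull].
    by apply: eq_pairing => // b; rewrite mulrA.
  - exact: pairing_cop_y.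
have fl' := linear_mull (mon xg m) fl; have fx' := @xtype_mull _ _ _ f (mon xg m) fx.
rewrite step1 // -[D (mon qg k)]mulr1; move: fl' fx'; set f' := fun b => f _ => fl' fx'.
have step2 : forall g, linear g -> forall W,
    pairing f' g (D (mon qg k) * W) = pairing f' (fun b => g (mon qg k * b)) W.
  apply: (mon_ind (P := fun u => forall g, linear g -> forall W,
    pairing f' g (D u * W) = pairing f' (fun b => g (u * b)) W)) => [h hl W|u v Pu Pv h hl W|i h hl W].
  - by rewrite cop1 // mul1r; apply: eq_pairing => // b; rewrite mul1r.
  - rewrite copM // -mulrA Pu // Pv; last exact: linear_mull.
    by apply: eq_pairing => // b; rewrite mulrA.
  - exact: pairing_cop_q.
rewrite step2 // pairing1 //; last exact: linear_mull.
by rewrite /f' !mulr1.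
Qed.

Lemma prod_lr (J : Type) (s : seq J) (u v : J -> A) :
  \prod_(j <- s) (l (u j) * r (v j)) = l (\prod_(j <- s) u j) * r (\prod_(j <- s) v j).
Proof.
elim: s => [|j s IH]; first by rewrite !big_nil fps_tinl1 fps_tinr1 mulr1.
by rewrite !big_cons IH fps_tinlrM.
Qed.

(** The binomial formula over a range [M] independent of k, the additional terms having coefficient
    0; a common range allows a product of such sums to be expanded over functions. *)
Lemma lr_expand (x c d : A) k M : (k < M)%N -> x * c = c * x -> x * d = d * x ->
  (l x * r c + l d * r x) ^+ k =
  \sum_(a < M) (l (x ^+ a * d ^+ (k - a)) * r (c ^+ a * x ^+ (k - a))) *+ 'C(k, a).
Proof.
move=> kM xc xd; rewrite addrC exprDn_comm; last first.
  by rewrite /GRing.comm !fps_tinlrM xc xd.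
rewrite (big_ord_widen M (fun i => (l d * r x) ^+ (k - i) * (l x * r c) ^+ i *+ 'C(k, i))) //.
rewrite big_mkcond; apply: eq_bigr => a _; rewrite ltnS; case: leqP => ak; last first.
  by rewrite bin_small // mulr0n.
congr (_ *+ _).
have P u v j : (l u * r v) ^+ j = l (u ^+ j) * r (v ^+ j).
  by elim: j => [|j IH]; rewrite ?fps_tinl1 ?fps_tinr1 ?mulr1 // !exprS IH fps_tinlrM.
rewrite !P fps_tinlrM; congr (l _ * r _).
  by apply/esym/commrX/commr_sym/commrX/commr_sym.
by apply/esym/commrX/commr_sym/commrX/commr_sym.
Qed.

Lemma prod_mulrn (R : pzRingType) (J : Type) (s : seq J) (F : J -> R) (c : J -> nat) :
  \prod_(j <- s) (F j *+ c j) = (\prod_(j <- s) F j) *+ (\prod_(j <- s) c j)%N.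
Proof.
elim: s => [|j s IH]; first by rewrite !big_nil.
by rewrite !big_cons IH mulrnAr mulrnAl -mulrnA mulnC.
Qed.

Lemma pairing_single f g (x c d : I -> A) (k a0 : mi) : linear f -> linear g ->
    (forall i, x i * c i = c i * x i) -> (forall i, x i * d i = d i * x i) ->
    (forall a : mi, (forall i, (a i <= k i)%N) -> a != a0 ->
      f (\prod_i (x i ^+ a i * d i ^+ (k i - a i))) *
      g (\prod_i (c i ^+ a i * x i ^+ (k i - a i))) = 0) ->
  pairing f g (\prod_i (l (x i) * r (c i) + l (d i) * r (x i)) ^+ k i) =
  f (\prod_i (x i ^+ a0 i * d i ^+ (k i - a0 i))) *
  g (\prod_i (c i ^+ a0 i * x i ^+ (k i - a0 i))) *+ (\prod_i 'C(k i, a0 i))%N.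
Proof.
move=> fl gl xc xd H; have pl := pairing_linear fl gl.
(* The bound also exceeds the exponents of [a0], so that [a0] is one of the functions into 'I_M. *)
pose M := (\max_i maxn (k i) (a0 i)).+1.
have kM i : (k i < M)%N.
  by rewrite ltnS; apply: leq_trans (leq_bigmax i); apply: leq_maxl.
have aM i : (a0 i < M)%N.
  by rewrite ltnS; apply: leq_trans (leq_bigmax i); apply: leq_maxr.
pose G (a : mi) := f (\prod_i (x i ^+ a i * d i ^+ (k i - a i))) *
      g (\prod_i (c i ^+ a i * x i ^+ (k i - a i))) *+ (\prod_i 'C(k i, a i))%N.
under eq_bigr => i _ do rewrite (lr_expand (kM i)) //.
rewrite bigA_distr_bigA /= (lin_sum pl).
transitivity (\sum_(a : {ffun I -> 'I_M}) G [ffun i => a i : nat]).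
  apply: eq_bigr => a _; rewrite prod_mulrn prod_lr (linMn pl) pairing_pure //.
  by rewrite /G; congr (f _ * g _ *+ _); apply: eq_bigr => i _; rewrite ffunE.
rewrite (bigD1 [ffun i => Ordinal (aM i)]) //= big1 ?addr0 => [|a ne].
  by rewrite /G; congr (f _ * g _ *+ _); apply: eq_bigr => i _; rewrite !ffunE.
rewrite /G; case: (boolP [forall i, a i <= k i]%N) => [/forallP le|].
  rewrite H ?mul0rn // => [i|]; first by rewrite ffunE.
  apply: contra ne => /eqP e; apply/eqP/ffunP => i; apply: val_inj.
  by rewrite ffunE /= -e ffunE.
move/forallPn; case=> i; rewrite -ltnNge => lt.
by rewrite (bigD1 i) //= ffunE bin_small // mul0n mulr0n.
Qed.
Lemma pairing_single_eq f g (x c d : I -> A) (k a0 : mi) (F G : mi -> fps V) :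
    linear f -> linear g ->
    (forall i, x i * c i = c i * x i) -> (forall i, x i * d i = d i * x i) ->
    (forall a : mi, (forall i, (a i <= k i)%N) ->
      f (\prod_i (x i ^+ a i * d i ^+ (k i - a i))) *
      g (\prod_i (c i ^+ a i * x i ^+ (k i - a i))) = F a * G a) ->
    (forall a : mi, (forall i, (a i <= k i)%N) -> a != a0 -> F a * G a = 0) ->
  pairing f g (\prod_i (l (x i) * r (c i) + l (d i) * r (x i)) ^+ k i) =
  F a0 * G a0 *+ (\prod_i 'C(k i, a0 i))%N.
Proof.
move=> fl gl xc xd FG H; rewrite (pairing_single (a0 := a0)) // => [|a le ne].
  (* If [a0] is not below k, some binomial coefficient is 0 and both sides vanish. *)
  case: (boolP [forall i, a0 i <= k i]%N) => [/forallP le|]; first by rewrite FG.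
  move/forallPn; case=> i; rewrite -ltnNge => lt.
  by rewrite (bigD1 i) //= bin_small // mul0n !mulr0n.
by rewrite FG // H.
Qed.
End Expansion.

Section Indices.
Variable n : nat.
Local Notation I := 'I_n.+1.
Local Notation mi := {ffun I -> nat}.
Implicit Types (m a : mi) (i : I).

Definition single i k : mi := [ffun j => if j == i then k else 0%N].
Definition clear m i : mi := [ffun j => if j == i then 0%N else m j].

Lemma single_bin m i : (\prod_j 'C(m j, single i (m i) j))%N = 1%N.
Proof.
rewrite big1 // => j _; rewrite ffunE; case: eqP => [->|_]; first exact: binn.
exact: bin0.
Qed.

Lemma single_neq m a i : a = single i (a i) -> a != single i (m i) -> a i != m i.
Proof. by move=> e; apply: contra => /eqP <-; apply/eqP. Qed.
End Indices.

(** * Convolution with a functional of one variable *)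

Section OneVariable.
Variables (K : fieldType) (n : nat).
Hypothesis char0 : forall k, k.+1%:R != 0 :> K.
Local Notation N := n.+2.
Local Notation U := (UB K N).
Local Notation A := (fps U).
Local Notation T := (tens U U).
Local Notation I := 'I_n.+1.
Local Notation mi := {ffun I -> nat}.
Local Notation l := (fps_map (@tinl K _ (@Bvee_br K N))).
Local Notation r := (fps_map (@tinr K _ (@Bvee_br K N))).
Local Notation D := (@twisted_coproduct K N).
Local Notation xg := (@xg K n).
Local Notation pg := (@pg K n).
Local Notation yg := (@yg K n).
Local Notation qg := (@qg K n).
Local Notation EE := (@EE K n).
Local Notation at_ := (@at_ K n).
Variable V : algType K.
Implicit Types (f g : A -> fps V) (m a : mi).

Lemma cop_mon (g : I -> A) m : D (mon g m) = \prod_i D (g i) ^+ m i.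
Proof.
have X u k : D (u ^+ k) = D u ^+ k.
  by elim: k => [|k IH]; rewrite ?expr0 ?cop1 // !exprS copM // IH.
rewrite /mon; elim: (index_enum _) => [|i s IH]; first by rewrite !big_nil cop1.
by rewrite !big_cons copM // X IH.
Qed.

(** f is supported on the powers of g_i, with values u. Powers of a dual element and exponentials
    both have this form, which allows one evaluation of their products. *)
Definition onevar (g : I -> A) f i (u : nat -> fps V) :=
  forall m, f (mon g m) = if m == single i (m i) then u (m i) else 0.

Lemma cv_x_mon f g m : linear f -> linear g -> xtype f -> xtype g ->
  convol f g (mon xg m) = pairing f g (\prod_i (l (xg i) * r 1 + l 1 * r (xg i)) ^+ m i).
Proof.
move=> fl gl fx gx; rewrite /convol cop_mon.
have E : xequiv V (\prod_i D (xg i) ^+ m i)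
    (\prod_i (l (xg i) * r 1 + l 1 * r (xg i)) ^+ m i).
  by apply: xequiv_prod => i; apply: xequivX; apply: xequiv_x.
by have := E f g fl gl fx gx 1 1; rewrite !mul1r !mulr1.
Qed.

Lemma mon1r (g : I -> A) m (b : I -> nat) : \prod_i (g i ^+ m i * 1 ^+ b i) = mon g m.
Proof. by apply: eq_bigr => i _; rewrite expr1n mulr1. Qed.
Lemma mon1l (g : I -> A) (b : I -> nat) m :
  \prod_i (1 ^+ b i * g i ^+ m i) = mon g m.
Proof. by apply: eq_bigr => i _; rewrite expr1n mul1r. Qed.

Definition msub m a : mi := [ffun i => (m i - a i)%N].
Lemma mon1l_sub (g : I -> A) m a :
  \prod_i (1 ^+ a i * g i ^+ (m i - a i)) = mon g (msub m a).
Proof. by rewrite -(mon1l _ a); apply: eq_bigr => i _; rewrite ffunE. Qed.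

Lemma msub_single m i : msub m (single i (m i)) = clear m i.
Proof. by apply/ffunP => j; rewrite !ffunE; case: eqP => [->|_]; rewrite ?subnn ?subn0. Qed.

Lemma msub_neq0 m a i : (a i <= m i)%N -> a i != m i -> msub m a i != 0%N.
Proof. by move=> le ne; rewrite ffunE subn_eq0 -ltnNge ltn_neqAle ne. Qed.

Lemma cv_x_single f g m (a0 : mi) : linear f -> linear g -> xtype f -> xtype g ->
    (forall a, (forall i, (a i <= m i)%N) -> a != a0 ->
      f (mon xg a) * g (mon xg (msub m a)) = 0) ->
  convol f g (mon xg m) =
    f (mon xg a0) * g (mon xg (msub m a0)) *+ (\prod_i 'C(m i, a0 i))%N.
Proof.
move=> fl gl fx gx H; rewrite cv_x_mon //.
apply: (pairing_single_eq (F := fun a => f (mon xg a)) (G := fun a => g (mon xg (msub m a))))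
  => // [i|i|a _].
- by rewrite mulr1 mul1r.
- by rewrite mulr1 mul1r.
- exact: (congr2 (fun u v => f u * g v) (mon1r xg a _) (mon1l_sub xg m a)).
Qed.

(** f accepts only powers of x_i and g none, so the single surviving splitting sends the whole of
    x_i^(m_i) to f and the rest to g. *)
Lemma cv_x_onevar f g i u m : linear f -> linear g -> xtype f -> xtype g ->
    onevar xg f i u -> (forall m, m i != 0%N -> g (mon xg m) = 0) ->
  convol f g (mon xg m) = u (m i) * g (mon xg (clear m i)).
Proof.
move=> fl gl fx gx fo g0; rewrite (@cv_x_single _ _ _ (single i (m i))) //.
  rewrite single_bin mulr1n msub_single fo ffunE !eqxx.
  by [].
move=> a le ne; rewrite fo; case: eqP => [e|_]; last by rewrite mul0r.
by rewrite g0 ?mulr0 // msub_neq0 // single_neq.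
Qed.

Lemma prod_at_comm (s : seq I) (g : I -> A) (c : I -> fps (K^o)) (b k : I -> nat) :
    (forall i phi, g i * at_ phi = at_ phi * g i) ->
  \prod_(i <- s) (g i ^+ k i * at_ (c i) ^+ b i) =
  (\prod_(i <- s) g i ^+ k i) * at_ (\prod_(i <- s) c i ^+ b i).
Proof.
move=> gC; have atX phi j : at_ phi ^+ j = at_ (phi ^+ j).
  by elim: j => [|j IH]; rewrite ?expr0 ?at1 // !exprS IH atM.
elim: s => [|i s IH]; first by rewrite !big_nil at1 mulr1.
rewrite !big_cons IH atX atM -!mulrA; congr (_ * _); rewrite !mulrA; congr (_ * _).
by apply: commr_prod => j _; apply: commrX; rewrite /GRing.comm gC.
Qed.

Lemma prod_coef0 (c : I -> fps (K^o)) (b : I -> nat) : (forall i, (c i 0%N : K) = 1) ->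
  ((\prod_i c i ^+ b i) 0%N : K) = 1.
Proof.
move=> c0; rewrite (@fcoef_prod0 K (K^o)) big1 // => i _.
rewrite (@fcoefX0 K (K^o)) c0; exact: expr1n.
Qed.

(** The parts of the pi_i sent to f leave group-like factors in the argument of g. They disappear if
    g is blind to pi_1, or if f accepts only powers of pi_1, which is primitive. *)
Lemma cv_p_single f g m (a0 : mi) : linear f -> linear g ->
    (blind ord0 g \/ forall a : mi, f (mon pg a) != 0 -> a = single ord0 (a ord0)) ->
    (forall a, (forall i, (a i <= m i)%N) -> a != a0 ->
      f (mon pg a) * g (mon pg (msub m a)) = 0) ->
  convol f g (mon pg m) =
    f (mon pg a0) * g (mon pg (msub m a0)) *+ (\prod_i 'C(m i, a0 i))%N.
Proof.
move=> fl gl fg H.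
have [c Hc] := choice (@cop_p K n char0).
have gE a : f (mon pg a) * g (\prod_i (at_ (c i) ^+ a i * pg i ^+ (m i - a i))) =
    f (mon pg a) * g (mon pg (msub m a)).
  have -> : \prod_i (at_ (c i) ^+ a i * pg i ^+ (m i - a i)) =
      mon pg (msub m a) * at_ (\prod_i c i ^+ a i).
    rewrite -prod_at_comm; last by move=> i phi; rewrite pg_at.
    apply: eq_bigr => i _; rewrite ffunE; apply: commrX; apply: commr_sym.
    by apply: commrX; rewrite /GRing.comm pg_at.
  case: fg => [gb|fs].
    rewrite blind_at // prod_coef0 ?scale1r // => i; by have [] := Hc i.
  have [->|/fs ->] := eqVneq (f (mon pg a)) 0; first by rewrite !mul0r.
  rewrite big1 ?at1 ?mulr1 // => i _; rewrite ffunE.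
  by have [_ + _] := Hc i; case: eqP => [-> ->|_ _]; rewrite ?expr1n ?expr0.
rewrite /convol cop_mon.
have -> : \prod_i D (pg i) ^+ m i =
    \prod_i (l (pg i) * r (at_ (c i)) + l 1 * r (pg i)) ^+ m i.
  by apply: eq_bigr => i _; have [_ _ ->] := Hc i; rewrite fps_tinl1 mul1r.
apply: (pairing_single_eq (F := fun a => f (mon pg a)) (G := fun a => g (mon pg (msub m a))))
  => // [i|i|a _].
- exact: pg_at.
- by rewrite mulr1 mul1r.
- rewrite -gE; exact: (congr1 (fun u => f u * _) (mon1r pg a _)).
Qed.

Lemma cv_p_onevar f g i u m : linear f -> linear g ->
    onevar pg f i u -> (forall m, m i != 0%N -> g (mon pg m) = 0) ->
    i = ord0 \/ blind ord0 g ->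
  convol f g (mon pg m) = u (m i) * g (mon pg (clear m i)).
Proof.
move=> fl gl fo g0 ib; rewrite (@cv_p_single _ _ _ (single i (m i))) //.
- by rewrite single_bin mulr1n msub_single fo ffunE !eqxx.
- case: ib => [i0|gb]; [right=> a | by left].
  by rewrite fo i0; case: (a =P single ord0 (a ord0)) => [e _ //|_]; rewrite eqxx.
move=> a le ne; rewrite fo; case: eqP => [e|_]; last by rewrite mul0r.
by rewrite g0 ?mulr0 // msub_neq0 // single_neq.
Qed.

Lemma qg_at i phi : qg i * at_ phi = at_ phi * qg i.
Proof. by have [c [_ _ ->]] := q_at K i; rewrite -mulrA atC !mulrA pg_at. Qed.

(** For the q_i the group-like factors are in the argument of f, one for each q_i sent to g. They
    disappear if f is blind to pi_1, or if g accepts only the empty monomial. *)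
Lemma cv_q_onevar f g i u m : linear f -> linear g ->
    onevar qg f i u -> (forall m, m i != 0%N -> g (mon qg m) = 0) ->
    blind ord0 f \/ (forall m, m != [ffun=> 0%N] -> g (mon qg m) = 0) ->
  convol f g (mon qg m) = u (m i) * g (mon qg (clear m i)).
Proof.
move=> fl gl fo g0 ib.
have [c Hc] := choice (@cop_q K n char0).
have fE a : (forall i, (a i <= m i)%N) ->
   f (\prod_i (qg i ^+ a i * at_ (c i) ^+ (m i - a i))) * g (mon qg (msub m a)) =
   f (mon qg a) * g (mon qg (msub m a)).
  move=> le; rewrite prod_at_comm; last exact: qg_at.
  case: ib => [fb|gz].
    rewrite blind_at // prod_coef0 ?scale1r // => j; by have [] := Hc j.
  have [e|/gz ->] := eqVneq (msub m a) [ffun=> 0%N]; last by rewrite !mulr0.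
  rewrite [X in at_ X]big1 ?at1 ?mulr1 // => j _.
  by move/ffunP: e => /(_ j); rewrite !ffunE => ->; rewrite expr0.
rewrite /convol cop_mon.
have -> : \prod_i D (qg i) ^+ m i =
    \prod_i (l (qg i) * r 1 + l (at_ (c i)) * r (qg i)) ^+ m i.
  by apply: eq_bigr => j _; have [_ _ ->] := Hc j; rewrite fps_tinr1 mulr1.
rewrite (pairing_single_eq (a0 := single i (m i)) (F := fun a => f (mon qg a))
  (G := fun a => g (mon qg (msub m a)))) //.
- by rewrite single_bin mulr1n msub_single fo ffunE !eqxx.
- by move=> j; rewrite mulr1 mul1r.
- by move=> j; apply: qg_at.
- move=> a le; rewrite -fE //; exact: (congr1 (fun u => _ * g u) (mon1l_sub qg m a)).
move=> a le ne; rewrite fo; case: eqP => [e|_]; last by rewrite mul0r.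
by rewrite g0 ?mulr0 // msub_neq0 // single_neq.
Qed.

(** One unit for convolution in both target algebras: [counit] for scalars and [conv_unit] for V =
    U. *)
Definition eps : A -> fps V := fun x => counit x *: 1.

Lemma eps_linear : linear eps.
Proof. by move=> c x y; rewrite /eps counit_linear scalerDl scalerA. Qed.
Lemma epsM (x y : A) : eps (x * y) = eps x * eps y.
Proof. by rewrite /eps counitM -scalerAl mul1r scalerA. Qed.
Lemma eps1 : eps 1 = 1.
Proof. by rewrite /eps counit1 scale1r. Qed.

Lemma eps_uin x : eps (fpsC (uin (@Bvee_br K N) x)) = 0.
Proof.
rewrite /eps (_ : counit _ = 0) ?scale0r //.
by apply: fpsP => -[|k] /=; rewrite ?ucounit_uin //; apply: (lin0 (@ucounit_linear K _ _)).
Qed.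

Lemma eps_p i : eps (pg i) = 0.
Proof.
case: (unliftP ord0 i) => [j|] ->; last by rewrite pg0E // epsM eps_uin mulr0.
by rewrite pgS epsM eps_uin mul0r.
Qed.
Lemma eps_x i : eps (xg i) = 0.
Proof.
case: (unliftP ord0 i) => [j|] ->; last by rewrite xg0 eps_uin.
by rewrite xgS (linMn eps_linear) eps_uin mul0rn.
Qed.
Lemma eps_q i : eps (qg i) = 0.
Proof. by have [c [_ _ ->]] := q_at K i; rewrite epsM eps_p mul0r. Qed.

Lemma eps_xtype : xtype eps.
Proof. by move=> i a b; rewrite !epsM eps_p mulr0 mul0r. Qed.
Lemma eps_ptype : ptype eps.
Proof. by move=> i a; rewrite !epsM eps_x mul0r. Qed.
Lemma eps_blind i : blind i eps.
Proof. by move=> a; rewrite !epsM eps_p mulr0. Qed.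

Lemma eps_mon (g : I -> A) m : (forall i, eps (g i) = 0) ->
  eps (mon g m) = (m == [ffun=> 0%N])%:R.
Proof.
move=> g0; case: eqP => [->|ne]; first by rewrite mon0 eps1.
have [i mi] : exists i, m i != 0%N.
  apply: contra_notP ne => H; apply/ffunP => i; rewrite ffunE; apply/eqP.
  by apply: contra_notT H => ?; exists i.
have X u k : eps (u ^+ k) = eps u ^+ k.
  by elim: k => [|k IH]; rewrite ?expr0 ?eps1 // !exprS epsM IH.
have : i \in index_enum I by rewrite mem_index_enum.
rewrite /mon; elim: (index_enum I) => //= j s IH; rewrite inE => /orP[/eqP <-|/IH e].
  by rewrite big_cons epsM X g0 expr0n (negPf mi) mul0r.
by rewrite big_cons epsM e mulr0.
Qed.

End OneVariable.

Lemma prod_perm_comm (R : pzRingType) (J : eqType) (F : J -> R) (s t : seq J) :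
    (forall i j, F i * F j = F j * F i) -> perm_eq s t ->
  \prod_(i <- s) F i = \prod_(i <- t) F i.
Proof.
move=> FC; elim: s t => [|x s IH] t.
  by move/perm_size/esym/size0nil ->.
move=> p; have xt : x \in t by rewrite -(perm_mem p) inE eqxx.
move: p; case/splitPr: xt => a b p.
have {}p : perm_eq s (a ++ b).
  rewrite -(perm_cons x); apply: (perm_trans p).
  by rewrite -cat1s perm_catCA.
rewrite big_cons (IH _ p) !big_cat big_cons /= !mulrA; congr (_ * _).
by apply/commr_prod => i _; apply: FC.
Qed.

(** * Ordered convolution products of one-variable functionals *)

Section Iterated.
Variables (K : fieldType) (n : nat).
Hypothesis char0 : forall k, k.+1%:R != 0 :> K.
Local Notation N := n.+2.
Local Notation U := (UB K N).
Local Notation A := (fps U).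
Local Notation I := 'I_n.+1.
Local Notation mi := {ffun I -> nat}.
Local Notation xg := (@xg K n).
Local Notation pg := (@pg K n).
Local Notation qg := (@qg K n).
Variable V : algType K.
Local Notation eps := (@eps K n V).
Implicit Types (f g : A -> fps V) (m : mi).

Definition supp (s : seq I) m := [forall j, (j \in s) || (m j == 0%N)].

Lemma supp_cons i s m : supp (i :: s) m = supp s (clear m i).
Proof.
apply: eq_forallb => j; rewrite inE ffunE.
by case: (j =P i) => _; rewrite ?eqxx ?orbT.
Qed.

Lemma supp_notin (s : seq I) m i : i \notin s -> m i != 0%N -> supp s m = false.
Proof.
by move=> is_ mi; apply/negP => /forallP /(_ i); rewrite (negPf is_) (negPf mi).
Qed.

Lemma supp_nil m : supp [::] m = (m == [ffun=> 0%N]).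
Proof.
apply/forallP/eqP => [H|-> j]; last by rewrite ffunE.
by apply/ffunP => j; rewrite ffunE; apply/eqP; have := H j.
Qed.

Lemma prod_clear (u : I -> nat -> fps V) i s m : i \notin s ->
  \prod_(j <- s) u j (clear m i j) = \prod_(j <- s) u j (m j).
Proof.
move=> is_; rewrite big_seq [RHS]big_seq; apply: eq_bigr => j js.
by rewrite ffunE; case: eqP => // e; rewrite -e js in is_.
Qed.

Section Products.
Variables (G : I -> A -> fps V) (u : I -> nat -> fps V).
Hypothesis Gl : forall i, linear (G i).
Local Notation R s := (\big[@convol K n V/eps]_(i <- s) G i).

Lemma cvprod_linear s : linear (R s).
Proof.
elim: s => [|i s IH]; first by rewrite big_nil; apply: eps_linear.
by rewrite big_cons; apply: convol_linear.
Qed.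

Lemma cvprod_xtype s : (forall i, xtype (G i)) -> xtype (R s).
Proof.
move=> Gx; elim: s => [|i s IH]; first by rewrite big_nil; apply: eps_xtype.
by rewrite big_cons; apply: convol_xtype => //; apply: cvprod_linear.
Qed.

Lemma cvprod_ptype s : (forall i, ptype (G i)) -> ptype (R s).
Proof.
move=> Gx; elim: s => [|i s IH]; first by rewrite big_nil; apply: eps_ptype.
by rewrite big_cons; apply: convol_ptype => //; apply: cvprod_linear.
Qed.

Lemma cvprod_blind s k : k \notin s -> (forall i, i != k -> blind k (G i)) ->
  blind k (R s).
Proof.
move=> ks Gx; elim: s ks => [|i s IH]; first by rewrite big_nil => _; apply: eps_blind.
rewrite inE negb_or eq_sym => /andP[ik ks].
by rewrite big_cons; apply: convol_blind => //; [apply: cvprod_linear|apply: Gx|apply: IH].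
Qed.

Lemma cvprod_x s m : uniq s -> (forall i, xtype (G i)) ->
    (forall i, onevar xg (G i) i (u i)) ->
  R s (mon xg m) = if supp s m then \prod_(i <- s) u i (m i) else 0.
Proof.
move=> + Gx Go; elim: s m => [|i s IH] m /=.
  rewrite !big_nil supp_nil eps_mon //; first by case: eqP.
  exact: eps_x.
case/andP=> is_ us; rewrite !big_cons (@cv_x_onevar _ _ char0 _ _ _ i (u i)) //.
- rewrite IH // supp_cons; case: ifP => _; rewrite ?mulr0 // prod_clear //.
- exact: cvprod_linear.
- exact: cvprod_xtype.
- by move=> m' mi; rewrite IH // (supp_notin is_).
Qed.

(** In increasing order [ord0] can only be the head, so the product of the remaining factors is
    blind to pi_1, as [cv_p_onevar] requires. *)
Lemma cvprod_p s m : sorted (fun i j : I => (i < j)%N) s ->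
    (forall i, i != ord0 -> blind ord0 (G i)) ->
    (forall i, onevar pg (G i) i (u i)) ->
  R s (mon pg m) = if supp s m then \prod_(i <- s) u i (m i) else 0.
Proof.
move=> + Gb Go; elim: s m => [|i s IH] m ss.
  rewrite !big_nil supp_nil eps_mon //; first by case: eqP.
  exact: eps_p.
have tr : transitive (fun i j : I => (i < j)%N) by move=> a b c; apply: ltn_trans.
have lt : all (fun j : I => (i < j)%N) s by apply: (order_path_min tr ss).
have is_ : i \notin s by apply/negP => /(allP lt); rewrite ltnn.
have {}ss := path_sorted ss.
rewrite !big_cons (@cv_p_onevar _ _ char0 _ _ _ i (u i)) //.
- rewrite IH // supp_cons; case: ifP => _; rewrite ?mulr0 // prod_clear //.
- exact: cvprod_linear.
- by move=> m' mi; rewrite IH // (supp_notin is_).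
right; apply: cvprod_blind => //.
by apply/negP => /(allP lt).
Qed.

(** In decreasing order [ord0] can only be the last factor: every earlier one is blind to pi_1, and
    after it only [eps] remains, so one of the alternatives in [cv_q_onevar] always holds. *)
Lemma cvprod_q s m : sorted (fun i j : I => (j < i)%N) s ->
    (forall i, i != ord0 -> blind ord0 (G i)) ->
    (forall i, onevar qg (G i) i (u i)) ->
  R s (mon qg m) = if supp s m then \prod_(i <- s) u i (m i) else 0.
Proof.
move=> + Gb Go; elim: s m => [|i s IH] m ss.
  rewrite !big_nil supp_nil eps_mon //; first by case: eqP.
  exact: eps_q.
have tr : transitive (fun i j : I => (j < i)%N).
  by move=> a b c fpsC_uab ac; apply: ltn_trans ac fpsC_uab.
have lt : all (fun j : I => (j < i)%N) s by apply: (order_path_min tr ss).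
have is_ : i \notin s by apply/negP => /(allP lt); rewrite ltnn.
have {}ss := path_sorted ss.
rewrite !big_cons (@cv_q_onevar _ _ char0 _ _ _ i (u i)) //.
- rewrite IH // supp_cons; case: ifP => _; rewrite ?mulr0 // prod_clear //.
- exact: cvprod_linear.
- by move=> m' mi; rewrite IH // (supp_notin is_).
have [i0|] := eqVneq i ord0; last by move/Gb; left.
right; case: s lt {IH is_ ss} => [|j s] /=; last by rewrite i0 ltn0.
by move=> _ m' ne; rewrite big_nil eps_mon ?(negPf ne) //; apply: eps_q.
Qed.
End Products.

Lemma msub_single1 m i :
  (msub m (single i 1) == single i (msub m (single i 1) i)) = (m == single i (m i)).
Proof.
apply/eqP/eqP => /ffunP e; apply/ffunP => j; have := e j; rewrite !ffunE ?eqxx;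
  by case: eqP => [->|_] //; rewrite subn0.
Qed.

Lemma single1_bin m i : (\prod_j 'C(m j, single i 1 j))%N = m i.
Proof.
rewrite (bigD1 i) //= ffunE eqxx bin1 big1 ?muln1 // => j /negPf ji.
by rewrite ffunE ji bin0.
Qed.

(** The factor [m i] counts the copies of g_i that can be sent to the new factor; at [m i] = a + 1
    it turns a! into (a + 1)!. *)
Lemma power_step i a m (c : A -> fps V) (g : I -> A) :
    onevar g c i (fun k => if k == a then a`!%:R else 0) ->
  c (mon g (msub m (single i 1))) *+ m i =
  if m == single i (m i) then if m i == a.+1 then a.+1`!%:R else 0 else 0.
Proof.
move=> ->; rewrite msub_single1; case: eqP => _; last by rewrite mul0rn.
rewrite !ffunE eqxx; case: (m i) => [|k]; first by rewrite mulr0n.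
rewrite subn1 /= eqSS; case: eqP => [->|_]; last by rewrite mul0rn.
by rewrite -mulrnA factS mulnC.
Qed.

End Iterated.

(** * The dual basis *)

Lemma sorted_index_ord m : sorted (fun i j : 'I_m => (i < j)%N) (index_enum 'I_m).
Proof.
have -> : index_enum 'I_m = enum 'I_m by rewrite /index_enum unlock; apply/esym/enumT.
by have := iota_ltn_sorted 0 m; rewrite -val_enum_ord sorted_map; apply: sub_sorted.
Qed.

Section DualBasis.
Variables (K : fieldType) (n : nat).
Hypothesis char0 : forall k, k.+1%:R != 0 :> K.
Local Notation N := n.+2.
Local Notation U := (UB K N).
Local Notation A := (fps U).
Local Notation I := 'I_n.+1.
Local Notation mi := {ffun I -> nat}.
Local Notation xg := (@xg K n).
Local Notation pg := (@pg K n).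
Local Notation yg := (@yg K n).
Local Notation qg := (@qg K n).

Lemma mon_peel (R : pzRingType) (g : I -> R) (m : mi) i : m i != 0%N ->
  exists j w, mon g m = g j * w.
Proof.
move=> mi; have : i \in index_enum I by rewrite mem_index_enum.
rewrite /mon; elim: (index_enum I) => // j s IH; rewrite inE big_cons.
case mj: (m j) => [|k] H; last first.
  by exists j, (g j ^+ k * \prod_(i <- s) g i ^+ m i); rewrite exprS mulrA.
rewrite expr0 mul1r; apply: IH; case/orP: H => // /eqP e.
by rewrite e mj in mi.
Qed.

Lemma exists_neq0 (m : mi) : m != [ffun=> 0%N] -> exists i, m i != 0%N.
Proof.
move=> ne; apply: contra_notP (negP ne) => H; apply/eqP/ffunP => i.
by rewrite ffunE; apply/eqP; apply: contra_notT H => ?; exists i.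
Qed.

Lemma mon_unincr (m : mi) i : m i != 0%N -> exists m', m = incr m' i.
Proof.
move=> mi; exists [ffun j => (m j - (j == i))%N]; apply/ffunP => j.
by rewrite !ffunE; case: eqP => [->|_]; rewrite ?subn0 ?addn0 // subnK // lt0n.
Qed.

Definition zm (k : mindex N * mindex N) : A := mon xg k.1 * mon pg k.2.
Definition wm (k : mindex N * mindex N) : A := mon yg k.1 * mon qg k.2.

Lemma zm_span (v : U) : exists s : seq (K * (mindex N * mindex N)),
  v = \sum_(t <- s) t.1 *: zm t.2 0%N.
Proof.
by apply: (spanning char0) => k; rewrite /zm fcoefM0 !coef_mon0.
Qed.

(** As e^sigma = 1 modulo xi and the correction in y_1 is divisible by xi, y_i and q_i agree with
    x_i and pi_i modulo xi. *)
Lemma wm_span (v : U) : exists s : seq (K * (mindex N * mindex N)),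
  v = \sum_(t <- s) t.1 *: wm t.2 0%N.
Proof.
have E10 : E1 K n 0%N = 1 by apply: fps_exp_coef0.
have y0 i : yg i 0%N = ux K i.
  case: (unliftP ord0 i) => [j|] ->; first by rewrite ygS fcoefM0 E10 mulr1.
  rewrite yg0 !fcoefM0 E10 !mulr1 fcoefD fcoef_sum big1 ?addr0 // => j _.
  by rewrite fcoefMn mul0rn.
have q0 i : qg i 0%N = up K i.
  case: (unliftP ord0 i) => [j|] ->.
    rewrite qgS.
    rewrite fcoefM0.
    rewrite E10.
    exact: mulr1.
  rewrite qg0; reflexivity.
apply: (spanning char0) => k; rewrite /wm.
rewrite fcoefM0.
rewrite (coef_mon0 yg) (coef_mon0 qg).
rewrite (funext y0 : (fun i => yg i 0%N) = @ux K n).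
rewrite (funext q0 : (fun i => qg i 0%N) = @up K n).
reflexivity.
Qed.

Section Eval.
Variable V : algType K.
Implicit Types f g : A -> fps V.

Lemma xtype_mon f (m k : mi) : xtype f ->
  f (mon xg m * mon pg k) = if k == [ffun=> 0%N] then f (mon xg m) else 0.
Proof.
move=> fx; case: eqP => [->|/eqP/exists_neq0[i ki]]; first by rewrite mon0 mulr1.
have [k' ->] := mon_unincr ki.
rewrite -mon_incr; last exact: pgC.
by rewrite mulrA -[_ * pg i]mulr1 fx.
Qed.

Lemma ptype_mon f (m k : mi) : ptype f ->
  f (mon xg m * mon pg k) = if m == [ffun=> 0%N] then f (mon pg k) else 0.
Proof.
move=> fp; case: eqP => [->|/eqP/exists_neq0[i mi]]; first by rewrite mon0 mul1r.
by have [j [w ->]] := mon_peel xg mi; rewrite -mulrA fp.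
Qed.
End Eval.

Section Dual.
Variable zdual : mindex N * mindex N -> A -> fps (K^o).
Hypothesis zl : forall k, linear (zdual k).
Hypothesis hz : forall k l, zdual k (zm l) = (k == l)%:R.

Definition zx (m : mi) := zdual (m, [ffun=> 0%N]).
Definition zp (m : mi) := zdual ([ffun=> 0%N], m).

Let hzx m l : zx m (zm l) = ((m, [ffun=> 0%N]) == l)%:R. Proof. exact: hz. Qed.
Let hzp m l : zp m (zm l) = (([ffun=> 0%N], m) == l)%:R. Proof. exact: hz. Qed.

(** Right multiplication by pi_i permutes nothing but exponents: it sends a basis monomial to one
    that contains pi_i, on which this dual functional is 0. *)
Lemma zdual_blind (k : mindex N * mindex N) (i : I) : (k.2 : mi) i = 0%N -> blind i (zdual k).
Proof.
move=> ki; have fl := linear_mulr (pg i) (zl k).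
apply: (linear_coef0 fl _ zm_span) => -[m j].
rewrite /zm -mulrA mon_incr; last exact: pgC.
rewrite -[_ * _]/(zm (m, incr j i)) hz; case: eqP => // e.
by have := ki; rewrite e ffunE eqxx addn1.
Qed.

Lemma zx_xtype m : xtype (zx m).
Proof.
by apply: (xtype_of_right char0 (zl _)) => i; apply: (@zdual_blind (m, _)); rewrite /= ffunE.
Qed.

(** By [mon_shift], x_i times a basis monomial is a combination of basis monomials containing an
    x. *)
Lemma zp_ptype m : ptype (zp m).
Proof.
move=> i; have fl := linear_mull (xg i) (zl ([ffun=> 0%N], m)).
apply: (linear_coef0 fl _ zm_span) => -[k j].
apply: (mon_shift (P := fun u => zp m u = 0)) => [u w pu pw|j'|j' j''|m' mi].
- by rewrite /zp in pu pw *; rewrite (linB (zl _)) pu pw subrr.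
- exact: xg0S.
- exact: xgSC.
rewrite -[_ * _]/(zm (m', j)) hzp; case: eqP => // /(congr1 fst) /= e.
by rewrite -e ffunE in mi.
Qed.

Lemma zx_mon m k : zx m (mon xg k) = (m == k)%:R.
Proof.
rewrite -[mon xg k]mulr1 -(mon0 pg) -[_ * _]/(zm (k, _)) hzx.
by rewrite xpair_eqE eqxx andbT.
Qed.
Lemma zp_mon m k : zp m (mon pg k) = (m == k)%:R.
Proof.
rewrite -[mon pg k]mul1r -(mon0 xg) -[_ * _]/(zm (_, k)) hzp.
by rewrite xpair_eqE eqxx.
Qed.

Local Notation eps := (@eps K n (K^o)).
Definition xpow i a := iter a (@convol K n (K^o) (zx (single i 1))) eps.
Definition ppow i a := iter a (@convol K n (K^o) (zp (single i 1))) eps.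

Let fact_if a : nat -> fps (K^o) := fun k => if k == a then a`!%:R else 0.

Let onevar_eps (g : I -> A) i : (forall j, eps (g j) = 0) -> onevar g eps i (fact_if 0).
Proof.
move=> g0 m; rewrite eps_mon // /fact_if.
case: (m =P single i (m i)) => e.
  have -> : (m == [ffun=> 0%N]) = (m i == 0%N).
    apply/eqP/eqP => [->|m0]; first by rewrite ffunE.
    by rewrite e m0; apply/ffunP => j; rewrite !ffunE; case: ifP.
  by case: eqP.
case: eqP => // m0; case: e; rewrite m0; apply/ffunP => j; rewrite !ffunE.
by case: ifP.
Qed.

Lemma xpow_linear i a : linear (xpow i a).
Proof.
elim: a => [|a IH]; first exact: eps_linear.
by rewrite /xpow iterS; apply: convol_linear => //; apply: zl.
Qed.
Lemma ppow_linear i a : linear (ppow i a).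
Proof.
elim: a => [|a IH]; first exact: eps_linear.
by rewrite /ppow iterS; apply: convol_linear => //; apply: zl.
Qed.
Lemma xpow_xtype i a : xtype (xpow i a).
Proof.
elim: a => [|a IH]; first exact: eps_xtype.
rewrite /xpow iterS; apply: convol_xtype => //; [exact: zl|exact: xpow_linear|exact: zx_xtype].
Qed.
Lemma ppow_ptype i a : ptype (ppow i a).
Proof.
elim: a => [|a IH]; first exact: eps_ptype.
rewrite /ppow iterS; apply: convol_ptype => //; [exact: zl|exact: ppow_linear|exact: zp_ptype].
Qed.
Lemma ppow_blind i j a : j != i -> blind j (ppow i a).
Proof.
move=> ji; elim: a => [|a IH]; first exact: eps_blind.
rewrite /ppow iterS; apply: convol_blind => //; [exact: zl|exact: ppow_linear|].
by apply: (@zdual_blind (_, _)); rewrite /= ffunE (negPf ji).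
Qed.

Lemma xpow_onevar i a : onevar xg (xpow i a) i (fact_if a).
Proof.
elim: a => [|a IH]; first by apply: onevar_eps; apply: eps_x.
move=> m; rewrite /xpow iterS.
rewrite (@cv_x_single _ _ char0 _ _ _ m (single i 1)) //.
- rewrite zx_mon eqxx mul1r single1_bin; exact: power_step.
- exact: zl.
- exact: xpow_linear.
- exact: zx_xtype.
- exact: xpow_xtype.
by move=> b _ ne; rewrite zx_mon eq_sym (negPf ne) mul0r.
Qed.

Lemma ppow_onevar i a : onevar pg (ppow i a) i (fact_if a).
Proof.
elim: a => [|a IH]; first by apply: onevar_eps; apply: eps_p.
move=> m; rewrite /ppow iterS.
rewrite (@cv_p_single _ _ char0 _ _ _ m (single i 1)) //.
- rewrite zp_mon eqxx mul1r single1_bin; exact: power_step.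
- exact: zl.
- exact: ppow_linear.
(* For pi^1 the left functional accepts only pi_1; for the other indices the remaining power is
   blind to pi_1. *)
- have [->|i0] := eqVneq i ord0.
    right=> b; rewrite zp_mon; case: (single ord0 1 =P b) => [<- _|_]; last by rewrite eqxx.
    by apply/ffunP => j; rewrite !ffunE eqxx.
  by left; apply: ppow_blind; rewrite eq_sym.
by move=> b _ ne; rewrite zp_mon eq_sym (negPf ne) mul0r.
Qed.

(** Both sides vanish on the ideal of the pi_i, so [xpow_onevar] decides. The functional dual to
    x_i^a is thus the divided power (x^i)^a / a!, the source of the exponential series. *)
Lemma xpowE i a b : xpow i a b = a`!%:R * zx (single i a) b.
Proof.
move: b; apply: (linear_eq_span (xpow_linear i a) _ _ zm_span) => [c x y|[m k]].
  by rewrite [zx _ _]zl mulrDr -scalerAr.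
rewrite /zm [fst _]/= [snd _]/= [LHS]xtype_mon ?[X in _ * X]xtype_mon; try exact: zx_xtype; last first.
  exact: xpow_xtype.
case: ifP => _; last by rewrite mulr0.
rewrite xpow_onevar zx_mon /fact_if.
case: (m =P single i (m i)) => [->|ne]; last first.
  case: eqP => [e|]; last by rewrite mulr0.
  by case: ne; rewrite -e ffunE eqxx.
rewrite ffunE eqxx; case: (m i =P a) => [->|ne]; first by rewrite eqxx mulr1.
case: eqP => [/ffunP/(_ i)|]; last by rewrite mulr0.
by rewrite !ffunE eqxx => e; case: ne.
Qed.

Lemma ppowE i a b : ppow i a b = a`!%:R * zp (single i a) b.
Proof.
move: b; apply: (linear_eq_span (ppow_linear i a) _ _ zm_span) => [c x y|[m k]].
  by rewrite [zp _ _]zl mulrDr -scalerAr.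
rewrite /zm [fst _]/= [snd _]/= [LHS]ptype_mon ?[X in _ * X]ptype_mon; try exact: zp_ptype; last first.
  exact: ppow_ptype.
case: ifP => _; last by rewrite mulr0.
rewrite ppow_onevar zp_mon /fact_if.
case: (k =P single i (k i)) => [->|ne]; last first.
  case: eqP => [e|]; last by rewrite mulr0.
  by case: ne; rewrite -e ffunE eqxx.
rewrite ffunE eqxx; case: (k i =P a) => [->|ne]; first by rewrite eqxx mulr1.
case: eqP => [/ffunP/(_ i)|]; last by rewrite mulr0.
by rewrite !ffunE eqxx => e; case: ne.
Qed.

Definition xmon (m : mi) := \big[@convol K n (K^o)/eps]_(i < n.+1) xpow i (m i).
Definition pmon (m : mi) := \big[@convol K n (K^o)/eps]_(i < n.+1) ppow i (m i).

Lemma fact_prod (m k : mi) : \prod_i fact_if (m i) (k i) =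
  if m == k then (mfact (m : mindex N))%:R else 0.
Proof.
rewrite /mfact natr_prod.
case: eqP => [->|/eqP ne]; first by apply: eq_bigr => i _; rewrite /fact_if eqxx.
have [i mk] : exists i, m i != k i.
  apply: contra_notP (negP ne) => H; apply/eqP/ffunP => i.
  by apply/eqP; apply: contra_notT H => ?; exists i.
by rewrite (bigD1 i) //= /fact_if eq_sym (negPf mk) mul0r.
Qed.

Lemma supp_enum (m : mi) : supp (index_enum I) m.
Proof. by apply/forallP => j; rewrite mem_index_enum. Qed.

Lemma xmon_mon m k : xmon m (mon xg k) = if m == k then (mfact (m : mindex N))%:R else 0.
Proof.
rewrite /xmon (@cvprod_x _ _ char0 _ _ (fun i => fact_if (m i))).
- by rewrite supp_enum fact_prod.
- by move=> i; apply: xpow_linear.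
- exact: index_enum_uniq.
- by move=> i; apply: xpow_xtype.
- by move=> i; apply: xpow_onevar.
Qed.

Lemma pmon_mon m k : pmon m (mon pg k) = if m == k then (mfact (m : mindex N))%:R else 0.
Proof.
rewrite /pmon (@cvprod_p _ _ char0 _ _ (fun i => fact_if (m i))).
- by rewrite supp_enum fact_prod.
- by move=> i; apply: ppow_linear.
- exact: sorted_index_ord.
- by move=> i i0; apply: ppow_blind; rewrite eq_sym.
- by move=> i; apply: ppow_onevar.
Qed.

(** By [convol_mon_xp] the product separates into its pi-part and its x-part, and these take the
    values n! and m! on the matching monomials; this is the first formula, term by term. *)
Lemma dual_monE (k : mindex N * mindex N) b :
  fpsC (((mfact k.1)%:R * (mfact k.2)%:R : K)^-1 : K^o) * convol (pmon k.2) (xmon k.1) b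
  = zdual k b.
Proof.
have pl : linear (pmon k.2) by apply: cvprod_linear => i; apply: ppow_linear.
have xl : linear (xmon k.1) by apply: cvprod_linear => i; apply: xpow_linear.
have cl := convol_linear pl xl.
move: b; apply: (linear_eq_span _ (zl k) _ zm_span) => [c x y|[m l]].
  by rewrite cl mulrDr -scalerAr.
rewrite hz /zm convol_mon_xp //; last 2 first.
- by apply: cvprod_ptype => // i; [apply: ppow_linear|apply: ppow_ptype].
- by apply: cvprod_xtype => // i; [apply: xpow_linear|apply: xpow_xtype].
rewrite /= xmon_mon pmon_mon; case: k {pl xl cl} => k1 k2 /=.
rewrite xpair_eqE; case: (k1 =P m) => [_|]; last by rewrite !mulr0.
case: (k2 =P l) => [_|]; last by rewrite mul0r mulr0.
have nz (j : mindex N) : (mfact j)%:R != 0 :> K.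
  rewrite /mfact natr_prod; apply/prodf_neq0 => i _; exact: fact_neq0.
have -> : (mfact k2)%:R * (mfact k1)%:R =
    fpsC ((mfact k1)%:R * (mfact k2)%:R : K^o) :> fps (K^o).
  by rewrite fpsCM mulrC !fpsC_nat.
rewrite -fpsCM; set c := (_ * _ : K).
have cV : c^-1 * c = 1 :> K by rewrite mulVf // mulf_neq0.
exact: (congr1 (fun v : K^o => fpsC v) cV).
Qed.

End Dual.
End DualBasis.

(** * Sums, exponentials and the antipode *)

Lemma sum_supp (V : nmodType) (J : eqType) (F : J -> V) (s t : seq J) :
    uniq s -> uniq t -> (forall j, j \notin s -> F j = 0) -> {subset s <= t} ->
  \sum_(j <- t) F j = \sum_(j <- s) F j.
Proof.
move=> us ut F0 st; rewrite (bigID (mem s)) /= [X in _ + X]big1 ?addr0; last first.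
  by move=> j /F0.
rewrite -big_filter; apply: perm_big; apply: uniq_perm => //; first exact: filter_uniq.
by move=> j; rewrite mem_filter; case: (boolP (j \in s)) => //= /st ->.
Qed.

Section Sums.
Variables (K : fieldType) (n : nat).
Local Notation N := n.+2.
Local Notation U := (UB K N).
Local Notation A := (fps U).

(** The second hypothesis says that, at each point and modulo each xi^p, only finitely many terms
    are nonzero. *)
Lemma sum_exists (J : eqType) (F : J -> A -> A) : (forall j, linear (F j)) ->
    (forall b p, exists s : seq J, forall j, j \notin s -> forall q, (q < p)%N -> F j b q = 0) ->
  exists G : {linear A -> A}, has_sum F G.
Proof.
move=> Fl fin.
pose Q (ub_piC : A * nat) (s : seq J) :=
  forall j, j \notin s -> forall q, (q < ub_piC.2)%N -> F j ub_piC.1 q = 0.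
have [s Hs] : {s : A * nat -> seq J & forall ub_piC, Q ub_piC (s ub_piC)}.
  apply: choice => -[b p]; have [s Hs] := cid (fin b p); exists s; exact: Hs.
(* The coefficient of xi^q is read from a finite sum that contains all terms nonzero modulo
   xi^(q+1); [undup] because the chosen list may repeat indices. *)
pose G b : A := Fps (fun q => (\sum_(j <- undup (s (b, q.+1))) F j b) q).
pose J0 b p := flatten [seq s (b, q.+1) | q <- iota 0 p].
have GE b p J' : uniq J' -> {subset J0 b p <= J'} ->
    forall q, (q < p)%N -> (\sum_(j <- J') F j b) q = G b q.
  move=> uJ sJ q qp; rewrite /= !fcoef_sum; apply: sum_supp => //.
  - exact: undup_uniq.
  - by move=> j; rewrite mem_undup => /Hs; apply.
  move=> j; rewrite mem_undup => js; apply: sJ; apply/flatten_mapP.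
  by exists q => //; rewrite mem_iota.
have Gl : linear G.
  move=> c a b; apply: fpsP => q.
  (* One finite set large enough for all three points reduces linearity to that of a finite sum. *)
  pose J' := undup (J0 (c *: a + b) q.+1 ++ J0 a q.+1 ++ J0 b q.+1).
  have sub : [/\ {subset J0 (c *: a + b) q.+1 <= J'}, {subset J0 a q.+1 <= J'}
     & {subset J0 b q.+1 <= J'}].
    rewrite /J'; move: (J0 _ _) (J0 _ _) (J0 _ _) => t1 t2 t3.
    by split=> j jJ; rewrite mem_undup !mem_cat jJ ?orbT.
  case: sub => s1 s2 s3; have uJ : uniq J' by apply: undup_uniq.
  rewrite -(GE _ _ _ uJ s1 q (leqnn _)) fcoefD -(GE _ _ _ uJ s3 q (leqnn _)).
  have -> : \sum_(j <- J') F j (c *: a + b) = c *: (\sum_(j <- J') F j a) + \sum_(j <- J') F j b.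
    by rewrite scaler_sumr -big_split; apply: eq_bigr => j _; rewrite Fl.
  rewrite fcoefD; congr (_ + _); apply: eq_bigr => i _.
  by rewrite (GE _ _ _ uJ s2) // ltnS leq_subr.
pose Glin : {linear A -> A} := HB.pack G (GRing.isLinear.Build _ _ _ _ G Gl).
exists Glin => b p; exists (J0 b p) => J' uJ sJ q qp; exact: (GE b p J').
Qed.

Lemma has_sum_eval (J : eqType) (F : J -> A -> A) (G : A -> A) (s : seq J) b :
    has_sum F G -> uniq s -> (forall j, j \notin s -> F j b = 0) ->
  G b = \sum_(j <- s) F j b.
Proof.
move=> hs us F0; apply: fpsP => q; have [s0 H] := hs b q.+1.
have uJ : uniq (undup (s0 ++ s)) by apply: undup_uniq.
rewrite -(H _ uJ) //; last by move=> j jJ; rewrite mem_undup mem_cat jJ.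
congr (coef _ _); apply: sum_supp => // j js.
by rewrite mem_undup mem_cat js orbT.
Qed.

Lemma eq_has_sum (J : eqType) (F F' : J -> A -> A) (G : A -> A) :
  (forall j b, F j b = F' j b) -> has_sum F G -> has_sum F' G.
Proof.
move=> e H b p; have [J0 HJ] := H b p; exists J0 => J' uJ sJ q qp.
by rewrite -(HJ J' uJ sJ q qp); congr (coef _ _); apply: eq_bigr.
Qed.
End Sums.

Section RankOne.
Variables (K : fieldType) (n : nat).
Local Notation N := n.+2.
Local Notation U := (UB K N).
Local Notation A := (fps U).
Implicit Types f g : A -> fps (K^o).

Definition scalar_rank1 f (y : A) : A -> A := fun b => (f b : fps K) *: y.

Lemma rank1_linear f y : linear f -> linear (scalar_rank1 f y).
Proof. by move=> fl c a b; rewrite /scalar_rank1 fl scalerDl -scalerA. Qed.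

Lemma convol_rank1 f g y z : linear f -> linear g ->
  convol (scalar_rank1 f y) (scalar_rank1 g z) =1 scalar_rank1 (convol f g) (y * z).
Proof.
move=> fl gl b; rewrite /convol /scalar_rank1.
have fl' := rank1_linear y fl; have gl' := rank1_linear z gl.
move: (twisted_coproduct b); apply: fps_tens_ext => [|c u v|u v].
- exact: pairing_linear.
- by rewrite (pairing_linear fl gl) scalerDl -scalerA.
rewrite !pairing_pure // /scalar_rank1 -scalerAl -scalerAr scalerA.
by [].
Qed.

Lemma eps_scalar : @eps K n K^o =1 @counit K n.+2.
Proof. by move=> b; rewrite /eps; apply: mulr1. Qed.

Lemma eps_rank1 : @eps K n U =1 scalar_rank1 (@eps K n K^o) 1.
Proof. by move=> b; rewrite /scalar_rank1 eps_scalar. Qed.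

Lemma iter_convol_rank1 f y k : linear f ->
  iter k (convol (scalar_rank1 f y)) (@eps K n U) = scalar_rank1 (iter k (convol f) (@eps K n K^o)) (y ^+ k).
Proof.
move=> fl; elim: k => [|k IH]; first by apply/funext => b; rewrite /= eps_rank1.
rewrite !iterS IH exprS; apply/funext => b; apply: convol_rank1 => //.
by elim: k {IH} => [|k IH]; [exact: eps_linear | rewrite iterS; apply: convol_linear].
Qed.
End RankOne.

(** * The antipode on the generators *)

Section Antipode.
Variables (K : fieldType) (n : nat).
Hypothesis char0 : forall k, k.+1%:R != 0 :> K.
Local Notation N := n.+2.
Local Notation U := (UB K N).
Local Notation A := (fps U).
Local Notation I := 'I_n.+1.
Local Notation xg := (@xg K n).
Local Notation pg := (@pg K n).
Local Notation yg := (@yg K n).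
Local Notation qg := (@qg K n).
Local Notation E1 := (@E1 K n).
Local Notation E1' := (@E1' K n).
Local Notation l := (fps_map (@tinl K _ (@Bvee_br K N))).
Local Notation r := (fps_map (@tinr K _ (@Bvee_br K N))).
Variable S : A -> A.
Hypotheses (Sl : linear S) (hS : forall b, convol S id b = @eps K n U b).

Let idl : linear (@id A). Proof. by []. Qed.
Let pl := pairing_linear Sl idl.

Let S1 : S 1 = 1.
Proof.
have := hS 1; rewrite /convol cop1 // pairing1 // eps1 mulr1; exact.
Qed.

Let pair_lr x c : pairing S id (l x * r c) = S x * c.
Proof. exact: pairing_pure. Qed.
Let pair_r x : pairing S id (r x) = x.
Proof. by rewrite -[r x]mul1r -(fps_tinl1 K n) pairing_pure // S1 mul1r. Qed.
Let pair_l x : pairing S id (l x) = S x.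
Proof. by rewrite -[l x]mulr1 -(fps_tinr1 K n) pairing_pure // mulr1. Qed.

Lemma antipode_unit (x c c' : A) : c' * c = 1 -> S x * c' + x = 0 -> - S x = x * c.
Proof.
move=> cK /eqP; rewrite addr_eq0 => /eqP e.
by rewrite -[S x]mulr1 -cK mulrA e mulNr opprK.
Qed.

Lemma antipode_xS j : - S (xg (lift ord0 j)) = yg (lift ord0 j).
Proof.
rewrite ygS; apply: (antipode_unit (E1'K n char0)).
have := hS (xg (lift ord0 j)).
by rewrite /convol cop_xS // (pairing_add _ _ Sl idl) pair_lr pair_r eps_x.
Qed.

Lemma antipode_pS j : - S (pg (lift ord0 j)) = qg (lift ord0 j).
Proof.
rewrite qgS; apply: (antipode_unit (E1'K n char0)).
have := hS (pg (lift ord0 j)).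
by rewrite /convol cop_pS // (pairing_add _ _ Sl idl) pair_lr pair_r eps_p.
Qed.

Lemma antipode_p0 : - S (pg ord0) = qg ord0.
Proof.
rewrite qg0; have := hS (pg ord0).
rewrite /convol cop_p0 // (pairing_add _ _ Sl idl) pair_l pair_r eps_p //.
by move/eqP; rewrite addrC addr_eq0 => /eqP {2}->.
Qed.

Lemma square_unit (e e' : A) : e' * e = 1 -> e' * e' * (e * e) = 1.
Proof. by move=> eK; rewrite mulrA -(mulrA e') eK mulr1. Qed.

Lemma conj_unit (x y e e' : A) : y * e = e * y -> e * e' = 1 -> x * e * (y * e') = x * y.
Proof. by move=> ye eK; rewrite -mulrA (mulrA e) -ye -!mulrA eK mulr1. Qed.

(** The antipode equation at x_1 involves the S(x_j). Inserting S(x_j) = - x_j e^sigma gives S(x_1)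
    e^(-2 sigma) + x_1 + 2 xi \sum_j x_j pi_j = 0, the origin of the formula for y_1. *)
Lemma antipode_x0 : - S (xg ord0) = yg ord0.
Proof.
have E2K : Em2 K n * (E1 * E1) = 1.
  exact: square_unit (E1'K n char0).
set w := \sum_(j < n) fpsX (xg (lift ord0 j) * pg (lift ord0 j)) *+ 2.
have key : S (xg ord0) * Em2 K n + (xg ord0 + w) = 0.
  have := hS (xg ord0); rewrite /convol cop_x0 // (linB pl) (lin_sum pl).
  rewrite (pairing_add _ _ Sl idl) pair_lr pair_r eps_x // => <-.
  rewrite -addrA; congr (_ + (_ + _)); rewrite -sumrN; apply: eq_bigr => j _.
  rewrite (lin_fpsX pl) (linMn pl) pair_lr.
  have -> : S (xg (lift ord0 j)) = - (xg (lift ord0 j) * E1).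
    by rewrite -ygS -antipode_xS opprK.
  rewrite mulNr conj_unit ?E1K //; last by rewrite E1_at pg_at.
  by rewrite mulNrn -fpsXN opprK fpsXMn.
rewrite yg0 -/w; move/eqP: key; rewrite addr_eq0 => /eqP key.
by rewrite -[S _]mulr1 -E2K mulrA key mulNr opprK.
Qed.

Lemma antipode_x i : - S (xg i) = yg i.
Proof. by case: (unliftP ord0 i) => [j|] ->; [apply: antipode_xS|apply: antipode_x0]. Qed.
Lemma antipode_p i : - S (pg i) = qg i.
Proof. by case: (unliftP ord0 i) => [j|] ->; [apply: antipode_pS|apply: antipode_p0]. Qed.
End Antipode.

(** * The canonical element and the exponentials as convergent sums *)

Section Canonical.
Variables (K : fieldType) (n : nat).
Hypothesis char0 : forall k, k.+1%:R != 0 :> K.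
Local Notation N := n.+2.
Local Notation U := (UB K N).
Local Notation A := (fps U).
Local Notation I := 'I_n.+1.
Local Notation mi := {ffun I -> nat}.
Local Notation ind := (mindex N * mindex N)%type.
Local Notation xg := (@xg K n).
Local Notation pg := (@pg K n).
Local Notation yg := (@yg K n).
Local Notation qg := (@qg K n).
Variable zdual : ind -> A -> fps (K^o).
Hypothesis zl : forall k, linear (zdual k).
Hypothesis hz : forall k l, zdual k (zm K l) = (k == l)%:R.
Local Notation zx := (zx zdual).
Local Notation zp := (zp zdual).

(** Modulo xi, b is a finite combination of monomials; what remains is divisible by xi, and the
    induction continues with the quotient. *)
Lemma zdual_finite b p : exists s : seq ind, forall k, k \notin s ->
  forall q, (q < p)%N -> zdual k b q = 0.
Proof.
elim: p b => [|p IH] b; first by exists [::].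
have [s es] := zm_span char0 (b 0%N).
pose c := b - \sum_(t <- s) fpsC t.1 *: zm K t.2.
have c0 : c 0%N = 0.
  rewrite /c fcoefD fcoefN fcoef_sum {1}es; apply/eqP; rewrite subr_eq0; apply/eqP.
  by apply: eq_bigr => t _; rewrite fpsZ_coef.
have cX : c = fpsX (fps_divX c) by rewrite {1}[c]fps_splitX c0 fpsC0 add0r.
have [s' H] := IH (fps_divX c).
exists (map snd s ++ s') => k; rewrite mem_cat negb_or => /andP[ks ks'] q qp.
have -> : b = c + \sum_(t <- s) fpsC t.1 *: zm K t.2 by rewrite /c subrK.
rewrite (linD (zl k)) fcoefD (lin_sum (zl k)) big1_seq ?addr0 => [|t /andP[_ ts]]; last first.
  rewrite (linZ (zl k)) hz; case: eqP => [e|_]; last by rewrite scaler0.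
  by case/negP: ks; apply/mapP; exists t.
rewrite cX (lin_fpsX (zl k)); case: q qp => [|q] //= qp.
by apply: H.
Qed.

(** The sum fixes each basis monomial, only one term being nonzero there; by linearity it is the
    identity of A. *)
Lemma canonical_exists : exists T : {linear A -> A},
  has_sum (fun k => scalar_rank1 (zdual k) (zm K k)) T /\ T =1 id.
Proof.
have [T HT] : exists T : {linear A -> A}, has_sum (fun k : ind => scalar_rank1 (zdual k) (zm K k)) T.
  apply: sum_exists => [k|b p]; first exact: rank1_linear.
  have [s H] := zdual_finite b p; exists s => k ks q qp.
  rewrite /scalar_rank1 /= big1 // => i _.
  by rewrite (H k ks) ?scale0r // (leq_ltn_trans _ qp) // -ltnS.
exists T; split=> //.
apply: (linear_eq_span _ _ _ (zm_span char0)) => [|//|l]; first exact: linearP.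
rewrite (has_sum_eval (s := [:: l]) HT) // ?big_seq1 => [|k].
  by rewrite /scalar_rank1 hz eqxx; apply: scale1r.
by rewrite inE /scalar_rank1 hz => /negPf ->; apply: scale0r.
Qed.

Lemma mon_single (R : pzRingType) (g : I -> R) i k : mon g (single i k) = g i ^+ k.
Proof.
rewrite /mon; have H (s : seq I) : uniq s ->
    \prod_(j <- s) g j ^+ single i k j = if i \in s then g i ^+ k else 1.
  elim: s => [|j s IH] /=; first by rewrite big_nil.
  case/andP=> js us; rewrite big_cons IH // inE ffunE.
  case: (eqVneq i j) => [->|ij]; last by rewrite expr0 mul1r.
  by rewrite (negPf js) mulr1.
by rewrite H ?index_enum_uniq // mem_index_enum.
Qed.

Lemma mul_mul_comm (R : pzRingType) (x y u v : R) : x * y = y * x -> x * v = v * x ->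
  y * u = u * y -> u * v = v * u -> x * u * (y * v) = y * v * (x * u).
Proof.
move=> xy xv yu uv; rewrite -!mulrA (mulrA u) -yu -(mulrA y) uv !mulrA xy.
by rewrite -(mulrA y x) xv !mulrA.
Qed.

Lemma qgC i j : qg i * qg j = qg j * qg i.
Proof.
have [c [_ _ ->]] := q_at K i; have [d [_ _ ->]] := q_at K j.
apply: mul_mul_comm; [exact: pgC|exact: pg_at|exact: pg_at|exact: atC].
Qed.

(** The left inverse [proj] turns the finite list of relevant basis indices into a finite list of
    exponents k. *)
Lemma exp_exists (y : A) (pos : nat -> ind) (proj : ind -> nat) : cancel pos proj ->
  exists G : {linear A -> A}, has_sum (fun k => scalar_rank1 (zdual (pos k)) (y ^+ k)) G.
Proof.
move=> posK; apply: sum_exists => [k|b p]; first exact: rank1_linear.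
have [s H] := zdual_finite b p; exists (map proj s) => k ks q qp.
rewrite /scalar_rank1 /= big1 // => i _; rewrite (H (pos k)) ?scale0r //.
  by apply: contra ks => ps; apply/mapP; exists (pos k).
by rewrite (leq_ltn_trans _ qp) // -ltnS.
Qed.

(** The k-th convolution power of f (x) y is f^k (x) y^k, and f^k / k! is the dual functional z
    k. *)
Lemma exp_series (f : A -> fps (K^o)) (z : nat -> A -> fps (K^o)) (y : A) k b :
    linear f -> (forall k b, iter k (convol f) (@eps K n (K^o)) b = k`!%:R * z k b) ->
  scalar_rank1 (z k) (y ^+ k) b =
  fpsC (k`!%:R : K)^-1 *: iter k (@conv K N U (scalar_rank1 f y)) (@conv_unit K N) b.
Proof.
move=> fl zE; rewrite [iter _ _ _](iter_convol_rank1 y k fl) /scalar_rank1 zE scalerA; congr (_ *: _).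
rewrite mulrA -fpsC_nat -[LHS]mul1r; congr (_ * _).
rewrite -[RHS](fpsCM (k`!%:R^-1 : K) (k`!%:R : K)) mulVf //; exact: fact_neq0.
Qed.

Definition xpos (i : I) k : ind := (single i k, [ffun=> 0%N]).
Definition ppos (i : I) k : ind := ([ffun=> 0%N], single i k).

Lemma xposE i k : zdual (xpos i k) = zx (single i k). Proof. by []. Qed.
Lemma pposE i k : zdual (ppos i k) = zp (single i k). Proof. by []. Qed.

Lemma single_inj_eq (m : mi) i (k : nat) : (single i k == m) =
  (m == single i (m i)) && (k == m i).
Proof.
apply/eqP/andP => [<-|[/eqP -> /eqP ->]]; first by rewrite !ffunE !eqxx.
by rewrite ffunE eqxx.
Qed.

Lemma exp_x (i : I) (G : {linear A -> A}) :
  has_sum (fun k => scalar_rank1 (zdual (xpos i k)) (yg i ^+ k)) G ->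
  xtype G /\ onevar xg G i (fun k => yg i ^+ k).
Proof.
move=> HG; split=> [j a b|m].
  rewrite (has_sum_eval (s := [::]) HG) ?big_nil // => k _.
  by rewrite /scalar_rank1 xposE (zx_xtype char0 zl hz); apply: scale0r.
case: (m =P single i (m i)) => [e|ne].
  rewrite (has_sum_eval (s := [:: m i]) HG) ?big_seq1 // => [|k].
    by rewrite /scalar_rank1 xposE (zx_mon hz) -e eqxx; apply: scale1r.
  rewrite inE => ki; rewrite /scalar_rank1 xposE (zx_mon hz) single_inj_eq (negPf ki) andbF.
  exact: scale0r.
rewrite (has_sum_eval (s := [::]) HG) ?big_nil // => k _.
rewrite /scalar_rank1 xposE (zx_mon hz) single_inj_eq; case: eqP => // _; exact: scale0r.
Qed.

(** The dual functionals are adapted to the pi_i, while values on the q_i are wanted. The two differ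
    by a series in xi E_1N with constant term 1: it is 1 for i = [ord0], and G is blind to pi_1
    otherwise. *)
Lemma exp_p (i : I) (G : {linear A -> A}) :
  has_sum (fun k => scalar_rank1 (zdual (ppos i k)) (qg i ^+ k)) G ->
  [/\ ptype G, forall j, j != i -> blind j G & onevar qg G i (fun k => qg i ^+ k)].
Proof.
move=> HG.
have Gb j : j != i -> blind j G.
  move=> ji a; rewrite (has_sum_eval (s := [::]) HG) ?big_nil // => k _.
  rewrite /scalar_rank1 (zdual_blind char0 zl hz); first exact: scale0r.
  by rewrite /= ffunE (negPf ji).
split=> // [j a|m].
  rewrite (has_sum_eval (s := [::]) HG) ?big_nil // => k _.
  by rewrite /scalar_rank1 pposE (zp_ptype char0 zl hz); apply: scale0r.
case: (m =P single i (m i)) => [e|ne]; last first.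
  have [j [ji mj]] : exists j, j != i /\ m j != 0%N.
    apply: contra_notP ne => H; apply/ffunP => j; rewrite ffunE.
    case: (eqVneq j i) => [->//|ji]; apply/eqP; apply: contra_notT H => mj.
    by exists j.
  have [m' ->] := mon_unincr mj.
  rewrite -mon_incr; last exact: qgC.
  have [c [_ _ ->]] := q_at K j.
  by rewrite pg_at // mulrA Gb.
have Z k k' : zdual (ppos i k') (pg i ^+ k) = (k' == k)%:R.
  rewrite -(mon_single pg i k) pposE (zp_mon hz) single_inj_eq.
  by rewrite !ffunE !eqxx.
have Gp k : G (pg i ^+ k) = qg i ^+ k.
  rewrite (has_sum_eval (s := [:: k]) HG) ?big_seq1 // => [|k'].
    by rewrite /scalar_rank1 Z eqxx; apply: scale1r.
  by rewrite inE => kk; rewrite /scalar_rank1 Z (negPf kk); apply: scale0r.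
rewrite e mon_single ffunE eqxx; move: (m i) => k.
have [c [c0 ci ei]] := q_at K i; rewrite {1}ei exprMn_comm; last by rewrite /GRing.comm pg_at.
have X d j : at_ n d ^+ j = at_ n (d ^+ j) :> A.
  by elim: j => [|j IH]; rewrite ?expr0 ?at1 // !exprS IH atM.
rewrite X; have [i0|i0] := eqVneq i ord0.
  by rewrite (ci i0) expr1n at1 mulr1 Gp.
rewrite blind_at //; first 1 last.
- exact: linearP.
- by apply: Gb; rewrite eq_sym.
rewrite (@fcoefX0 K (K^o)) c0 expr1n Gp; exact: scale1r.
Qed.

End Canonical.

(** * Proof of the two formulas *)

Section Final.
Variables (K : fieldType) (n : nat).
Hypothesis char0 : forall k, k.+1%:R != 0 :> K.
Local Notation N := n.+2.
Local Notation U := (UB K N).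
Local Notation A := (fps U).
Local Notation I := 'I_n.+1.
Local Notation xg := (@xg K n).
Local Notation pg := (@pg K n).
Local Notation yg := (@yg K n).
Local Notation qg := (@qg K n).

Lemma single_mdelta (i : I) : (mdelta (i : 'I_N.-1) : mindex N) = single i 1.
Proof. by apply/ffunP => j; rewrite !ffunE eq_sym; case: eqP. Qed.

Lemma sorted_rev_index :
  sorted (fun i j : I => (j < i)%N) [seq rev_ord i | i <- index_enum I].
Proof.
rewrite sorted_map; apply: sub_sorted (sorted_index_ord _) => i j ij /=.
by rewrite !subSS ltn_sub2l // (leq_trans ij) // -ltnS.
Qed.

Lemma rev_index_perm : perm_eq [seq rev_ord i | i <- index_enum I] (index_enum I).
Proof.
apply: uniq_perm; rewrite ?map_inj_uniq ?index_enum_uniq //; first exact: rev_ord_inj.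
move=> i; rewrite mem_index_enum; apply/mapP; exists (rev_ord i).
  by rewrite mem_index_enum.
by rewrite rev_ordK.
Qed.

(** With N = n + 2 the indices 1, ..., N - 1 become the type 'I_n.+1, where [ord0] singles out the
    special generators x_1 and pi_1. *)
Theorem canonical_element
    (S : {linear A -> A}) (hS : is_antipode S)
    (zdual : mindex N * mindex N -> {scalar A})
    (hz : forall k l, zdual k (zmon K l) = (k == l)%:R) :
  let xd i := zdual (mdelta i, mzero N) in
  let pd i := zdual (mzero N, mdelta i) in
  exists T : {linear A -> A},
    [/\ has_sum (fun k => rank1 (zdual k) (zmon K k)) T,
        has_sum (fun k : mindex N * mindex N => rank1
          (fun b => fpsC ((mfact k.1)%:R * (mfact k.2)%:R)^-1 *
                    conv (dual_mon pd k.2) (dual_mon xd k.1) b)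
          (zmon K k)) T
      & exists Ex Ep : 'I_N.-1 -> {linear A -> A},
        [/\ forall i, is_conv_exp
              (fun b => - rank1 (xd i) (S (xgen K N i.+1)) b) (Ex i),
            forall i, is_conv_exp
              (fun b => - rank1 (pd i) (S (pgen K N i.+1)) b) (Ep i)
          & T =1 conv (prod_incr Ex) (prod_decr Ep)]].
Proof.
move=> xd pd.
pose zd k : A -> fps (K^o) := zdual k.
have zl k : linear (zd k) by move=> c a b; apply: (linearP (zdual k)).
have hz' k l : zd k (zm K l) = (k == l)%:R by apply: hz.
have epsE : @eps K n (K^o) = @counit K N by apply/funext/eps_scalar.
have [T [HT Tid]] := canonical_exists char0 zl hz'.
have Sl : linear S by exact: linearP.
have hS' b : convol S id b = @eps K n U b by apply: hS.1.
have xpowE' i a : iter a (@conv K N K (xd i)) (@counit K N) = xpow zd i a.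
  by rewrite /xpow epsE /zx -single_mdelta.
have ppowE' i a : iter a (@conv K N K (pd i)) (@counit K N) = ppow zd i a.
  by rewrite /ppow epsE /zp -single_mdelta.
have xdE k : dual_mon xd k = xmon zd k.
  rewrite /dual_mon /xmon epsE; apply: eq_bigr => i _; exact: xpowE'.
have pdE k : dual_mon pd k = pmon zd k.
  rewrite /dual_mon /pmon epsE; apply: eq_bigr => i _; exact: ppowE'.
exists T; split; first exact: HT.
  apply: eq_has_sum HT => k b; rewrite /scalar_rank1 /rank1; congr (_ *: _).
  rewrite -(dual_monE char0 zl hz') xdE pdE; reflexivity.
have HEx (i : I) : exists G : {linear A -> A},
    has_sum (fun k => scalar_rank1 (zd (xpos i k)) (yg i ^+ k)) G.
  apply: (exp_exists char0 zl hz' _ (proj := fun k => k.1 i)) => k.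
  by rewrite /xpos /= ffunE eqxx.
have HEp (i : I) : exists G : {linear A -> A},
    has_sum (fun k => scalar_rank1 (zd (ppos i k)) (qg i ^+ k)) G.
  apply: (exp_exists char0 zl hz' _ (proj := fun k => k.2 i)) => k.
  by rewrite /ppos /= ffunE eqxx.
have [Ex HX] := choice HEx.
have [Ep HP] := choice HEp.
(* The sign is moved to the second leg, which the antipode formulas then identify with y_i or
   q_i. *)
have negF f (x : A) : (fun b => - rank1 f (S x) b) = scalar_rank1 (f : A -> fps (K^o)) (- S x).
  by apply/funext => b; rewrite /rank1 /scalar_rank1 scalerN.
exists Ex, Ep; split=> [i|i|].
- rewrite /is_conv_exp negF (antipode_x char0 Sl hS').
  apply: eq_has_sum (HX i) => k b.
  apply: (exp_series char0 (z := fun k => zd (xpos i k))) => [|a c]; first exact: zl.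
  by have := xpowE char0 zl hz' i a c; rewrite -xpowE' epsE.
- rewrite /is_conv_exp negF (antipode_p char0 Sl hS').
  apply: eq_has_sum (HP i) => k b.
  apply: (exp_series char0 (z := fun k => zd (ppos i k))) => [|a c]; first exact: zl.
  by have := ppowE char0 zl hz' i a c; rewrite -ppowE' epsE.
have Xl i : linear (Ex i) by exact: linearP.
have Pl i : linear (Ep i) by exact: linearP.
have Xx i : xtype (Ex i) := (exp_x char0 zl hz' (HX i)).1.
have Xo i : onevar xg (Ex i) i (fun k => yg i ^+ k) := (exp_x char0 zl hz' (HX i)).2.
have PH i := exp_p char0 zl hz' (HP i).
pose X := \big[@convol K n U/@eps K n U]_(i <- index_enum I) Ex i.
pose Q := \big[@convol K n U/@eps K n U]_(i <- [seq rev_ord i | i <- index_enum I]) Ep i.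
have Xlin : linear X by apply: cvprod_linear.
have Qlin : linear Q by apply: cvprod_linear.
have XE m : X (mon xg m) = mon yg m.
  rewrite /X (@cvprod_x _ _ char0 _ _ (fun i k => yg i ^+ k)) ?index_enum_uniq //.
  by rewrite supp_enum.
have QE m : Q (mon qg m) = mon qg m.
  rewrite /Q (@cvprod_q _ _ char0 _ _ (fun i k => qg i ^+ k)) //.
  - rewrite (_ : supp _ m = true); last first.
      by apply/forallP => j; rewrite (perm_mem rev_index_perm) mem_index_enum.
    (* The decreasing product gives the powers of the q_i in reversed order; as they commute, it
       equals the ordered monomial. *)
    apply: prod_perm_comm rev_index_perm => i j.
    by apply: commrX; apply: commr_sym; apply: commrX; apply: qgC.
  - exact: sorted_rev_index.
  - by move=> i i0; have [_ Pb _] := PH i; apply: Pb; rewrite eq_sym.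
  - by move=> i; have [] := PH i.
have -> : conv (@prod_incr K N Ex) (@prod_decr K N Ep) = convol X Q.
  by rewrite /X /Q big_map.
(* Both maps are compared on the y^m q^n, where X * Q has the value X(x^m) Q(q^n) = y^m q^n. *)
apply: (linear_eq_span _ _ _ (wm_span char0)) => [| |k]; first exact: linearP.
  exact: convol_linear.
rewrite Tid {2}/wm (convol_mon_yq char0) //.
- by rewrite XE QE.
- exact: cvprod_xtype.
- by apply: cvprod_ptype => // i; have [] := PH i.
Qed.
End Final.

Theorem mainTheorem5 (R : realType) (N : nat) (hN : (3 <= N)%N)
    (S : {linear fps (UB R[i] N) -> fps (UB R[i] N)})
    (hS : is_antipode S)
    (zdual : mindex N * mindex N -> {scalar fps (UB R[i] N)})
    (hz : forall k l, zdual k (zmon R[i] l) = (k == l)%:R) :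
  let xd i := zdual (mdelta i, mzero N) in
  let pd i := zdual (mzero N, mdelta i) in
  exists T : {linear fps (UB R[i] N) -> fps (UB R[i] N)},
    [/\ has_sum (fun k => rank1 (zdual k) (zmon R[i] k)) T,
        has_sum (fun k : mindex N * mindex N => rank1
          (fun b => fpsC ((mfact k.1)%:R * (mfact k.2)%:R)^-1 *
                    conv (dual_mon pd k.2) (dual_mon xd k.1) b)
          (zmon R[i] k)) T
      & exists Ex Ep : 'I_N.-1 -> {linear fps (UB R[i] N) -> fps (UB R[i] N)},
        [/\ forall i, is_conv_exp
              (fun b => - rank1 (xd i) (S (xgen R[i] N i.+1)) b) (Ex i),
            forall i, is_conv_exp
              (fun b => - rank1 (pd i) (S (pgen R[i] N i.+1)) b) (Ep i)
          & T =1 conv (prod_incr Ex) (prod_decr Ep)]].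
Proof.
case: N hN S hS zdual hz => [|[|n]] // _ S hS zdual hz.
by apply: canonical_element => // k; rewrite Num.Theory.pnatr_eq0.
Qed.
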